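(* Let $\mathcal{S}=\{x\in\mathbb{R}^3:|x|=1\}$ and, for $x\in\mathcal{S}$, let $B(x,\vartheta)=\{y\in\mathcal{S}: x\cdot y\ge\cos(\vartheta)\}$ be the spherical cap with center $x$ and radius $\vartheta$. (1) For every $\gamma>5/2$ and almost every $0<\vartheta<\pi$ there exists a constant $c>0$ such that for every Borel set $\Omega\subseteq\mathcal{S}$, every finite (complex) Borel measure $\mu$ on $\mathcal{S}$ and every smooth function $f$ on $\mathcal{S}$, $$\left|\int_\Omega f(x)\,\overline{d\mu(x)}\right|\le c\left\{\int_{\mathcal{S}}|\mu(B(x,\vartheta)\cap\Omega)|^2dx\right\}^{1/2}\left\{\sum_{n=0}^{+\infty}(1+n^2)^{\gamma}\int_{\mathcal{S}}\left|\widehat f(n,x)\right|^2dx\right\}^{1/2}.$$ (2) For almost every $0<\vartheta<\pi/2$ there exists a constant $c>0$ such that for every Borel set $\Omega\subseteq\mathcal{S}$, every finite (complex) Borel measure $\mu$ on $\mathcal{S}$ and every smooth function $f$ on $\mathcal{S}$, $$\left|\int_\Omega f(x)\,\overline{d\mu(x)}\right|\le c\left\{\sum_{n=0}^{+\infty}(1+n^2)^{3/2}\int_{\mathcal{S}}\left|\widehat f(n,x)\right|^2dx\right\}^{1/2}\left(\left\{\int_{\mathcal{S}}|\mu(B(x,\vartheta)\cap\Omega)|^2dx\right\}^{1/2}+\left\{\int_{\mathcal{S}}|\mu(B(x,2\vartheta)\cap\Omega)|^2dx\right\}^{1/2}\right).$$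
   Context: $dx$ is the normalized (total mass one) rotation invariant surface measure on $\mathcal{S}$. $Z_n(x\cdot y)=(2n+1)P_n(x\cdot y)$, with $P_n(z)=\frac{1}{2^nn!}\frac{d^n}{dz^n}(z^2-1)^n$ the Legendre polynomial, is the zonal polynomial of degree $n$, i.e. the reproducing kernel of the space of spherical harmonics of degree $n$. For a function $f$ on $\mathcal{S}$, $\widehat f(n,x)=\int_{\mathcal{S}}Z_n(x\cdot y)f(y)\,dy$ is the projection of $f$ onto spherical harmonics of degree $n$. $\overline{d\mu}$ is the complex conjugate measure. ''Almost every'' is with respect to Lebesgue measure. *)

(* Defs.v *)
(* MathComp-Analysis, over an arbitrary [R : realType]. *)
From HB Require Import structures.
From mathcomp Require Import all_boot all_order all_algebra complex.
From mathcomp Require Import all_classical all_reals all_analysis.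
From mathcomp Require Import measurable_realfun.

Set Implicit Arguments.
Unset Strict Implicit.
Unset Printing Implicit Defensive.

Import Order.TTheory GRing.Theory Num.Theory.
Import numFieldNormedType.Exports.

Local Open Scope classical_set_scope.
Local Open Scope ring_scope.

(* R^3, with the Borel sigma-algebra on each factor, hence with the Borel
   sigma-algebra of R^3. Its library norm is the sup norm, used only to speak of
   differentiability; the Euclidean structure is given by [dot] and [enorm]. *)
Notation space3 R :=
  (measurableTypeR R * measurableTypeR R * measurableTypeR R)%type.

Section sphere.
Context {R : realType}.

Definition dot (x y : space3 R) : R :=
  x.1.1 * y.1.1 + x.1.2 * y.1.2 + x.2 * y.2.

Definition enorm (x : space3 R) : R := Num.sqrt (dot x x).

Definition sphere : set (space3 R) := [set x | enorm x = 1].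

Definition cap (x : space3 R) (theta : R) : set (space3 R) :=
  [set y | sphere y /\ cos theta <= dot x y].

Definition ball3 : set (space3 R) := [set x | enorm x <= 1].

(* [radial 0 = 0], which is harmless below since the origin is a null set. *)
Definition radial (x : space3 R) : space3 R :=
  (x.1.1 / enorm x, x.1.2 / enorm x, x.2 / enorm x).

Lemma measurable_enorm : measurable_fun setT enorm.
Proof.
have m11 : measurable_fun setT (fun x : space3 R => x.1.1).
  by apply: measurableT_comp => //; exact: measurable_fst.
have m12 : measurable_fun setT (fun x : space3 R => x.1.2).
  by apply: measurableT_comp => //; exact: measurable_snd.
have m2 : measurable_fun setT (fun x : space3 R => x.2).
  exact: measurable_snd.
apply: (measurableT_comp (f := @Num.sqrt R)).
  by apply: continuous_measurable_fun; exact: sqrt_continuous.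
by apply: measurable_funD; [apply: measurable_funD|]; apply: measurable_funM.
Qed.

Lemma measurable_radial : measurable_fun setT radial.
Proof.
have mV : measurable_fun setT (fun x : space3 R => (enorm x)^-1).
  have -> : (fun x : space3 R => (enorm x)^-1) =
            (fun y => powR y (-1)) \o enorm.
    by apply/funext => x /=; rewrite powR_inv1// sqrtr_ge0.
  apply: measurableT_comp; last exact: measurable_enorm.
  exact: measurable_powR.
have m11 : measurable_fun setT (fun x : space3 R => x.1.1).
  by apply: measurableT_comp => //; exact: measurable_fst.
have m12 : measurable_fun setT (fun x : space3 R => x.1.2).
  by apply: measurableT_comp => //; exact: measurable_snd.
have m2 : measurable_fun setT (fun x : space3 R => x.2).
  exact: measurable_snd.
by apply: measurable_fun_pair; [apply: measurable_fun_pair|];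
  apply: measurable_funM.
Qed.

Lemma measurable_ball3 : measurable ball3.
Proof.
have := measurable_enorm measurableT (measurable_itv `]-oo, (1 : R)]).
by rewrite setTI.
Qed.

Definition volume3 : set (space3 R) -> \bar R :=
  ((lebesgue_measure \x lebesgue_measure) \x lebesgue_measure)%E.

HB.instance Definition _ := Measure.on volume3.

Definition cone_volume : set (space3 R) -> \bar R :=
  pushforward (mrestr volume3 measurable_ball3) radial.

Lemma cone_volume0 : cone_volume set0 = 0%E.
Proof. by rewrite /cone_volume /pushforward preimage_set0 measure0. Qed.

Lemma cone_volume_ge0 A : (0 <= cone_volume A)%E.
Proof. exact: (measure_ge0 (mrestr volume3 measurable_ball3)). Qed.

Lemma cone_volume_sigma_additive : semi_sigma_additive cone_volume.
Proof.
exact: (@measure_semi_sigma_additive _ _ _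
  (measure_function_pushforward__canonical__measure_function_Measure _
     measurable_radial)).
Qed.

HB.instance Definition _ := isMeasure.Build _ _ _ cone_volume
  cone_volume0 cone_volume_ge0 cone_volume_sigma_additive.

Lemma normalization_ge0 : 0 <= (fine (volume3 ball3))^-1.
Proof. by rewrite invr_ge0 fine_ge0. Qed.

(* The normalized surface measure, as a measure on R^3 carried by [sphere], in
   its polar coordinates definition: the measure of a set of directions is the proportion of the
   volume of the unit ball occupied by the cone over that set. *)
Definition surface : set (space3 R) -> \bar R :=
  mscale (NngNum normalization_ge0) cone_volume.

HB.instance Definition _ := Measure.on surface.

(* C^oo on R^3: all the iterated directional derivatives of [F], including [F]
   itself, are differentiable everywhere. *)
Definition smooth (F : space3 R -> R) : Prop :=
  forall (s : seq (space3 R)) (x : space3 R),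
    differentiable (foldr (fun v G => 'D_v G) F s) x.

(* [f] is, on [sphere], the restriction of a C^oo function on R^3. Complex-valued
   maps are handled through their real and imaginary parts. *)
Definition smooth_on_sphere (f : space3 R -> R[i]) : Prop :=
  exists F1 F2 : space3 R -> R, [/\ smooth F1, smooth F2 &
    forall x, sphere x -> f x = (F1 x +i* F2 x)%C].

End sphere.

Section complex_integration.
Context d {T : measurableType d} {R : realType}.

Definition cRintegral (m : {measure set T -> \bar R}) (D : set T)
    (f : T -> R[i]) : R[i] :=
  (Rintegral m D (fun x => complex.Re (f x))
     +i* Rintegral m D (fun x => complex.Im (f x)))%C.

(* Integration against the two measures of the Jordan decomposition; these do
   not depend on the chosen Hahn decomposition. *)
Definition charge_Rintegral (nu : {charge set T -> \bar R}) (D : set T)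
    (f : T -> R) : R :=
  let: exist P exN := cid (Hahn_decomposition nu) in
  let: exist N nuPN := cid exN in
  Rintegral (jordan_pos nuPN) D f - Rintegral (jordan_neg nuPN) D f.

(* A finite complex measure, given by its real and imaginary parts; finiteness
   is part of the notion of charge. *)
Record cmeasure := CMeasure {
  cm_Re : {charge set T -> \bar R};
  cm_Im : {charge set T -> \bar R} }.

Definition cmval (mu : cmeasure) (A : set T) : R[i] :=
  (fine (cm_Re mu A) +i* fine (cm_Im mu A))%C.

Definition cmconj (mu : cmeasure) : cmeasure :=
  CMeasure (cm_Re mu) (cscale (-1) (cm_Im mu)).

Definition cmintegral (mu : cmeasure) (D : set T) (f : T -> R[i]) : R[i] :=
  let u x := complex.Re (f x) in
  let v x := complex.Im (f x) in
  ((charge_Rintegral (cm_Re mu) D u - charge_Rintegral (cm_Im mu) D v)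
   +i* (charge_Rintegral (cm_Re mu) D v + charge_Rintegral (cm_Im mu) D u))%C.

Definition carried_by (mu : cmeasure) (S : set T) : Prop :=
  forall A, measurable A -> A `&` S = set0 -> cmval mu A = 0.

End complex_integration.
Arguments cmeasure {d} T R.

Section harmonics.
Context {R : realType}.

Definition legendre (n : nat) : {poly R} :=
  (2 ^+ n * n`!%:R)^-1 *: (('X^2 - 1) ^+ n)^`(n).

(* As a function of the inner product of the two points. *)
Definition zonal (n : nat) (t : R) : R := (2 * n%:R + 1) * (legendre n).[t].

Definition harmonic_proj (f : space3 R -> R[i]) (n : nat) (x : space3 R)
    : R[i] :=
  cRintegral surface sphere (fun y => (zonal n (dot x y))%:C%C * f y).

(* The sums and integrals below are taken in [0, +oo]. *)
Definition sobolev_norm (gamma : R) (f : space3 R -> R[i]) : \bar R :=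
  sqrte (\sum_(0 <= n <oo) (powR (1 + n%:R ^+ 2) gamma)%:E *
    \int[surface]_(x in sphere) (Normc.normc (harmonic_proj f n x) ^+ 2)%:E)%E.

Definition cap_L2norm (mu : cmeasure (space3 R) R) (Omega : set (space3 R))
    (theta : R) : \bar R :=
  sqrte (\int[surface]_(x in sphere)
    (Normc.normc (cmval mu (cap x theta `&` Omega)) ^+ 2)%:E)%E.

End harmonics.

(* Main.v *)
Require Import Defs.
From HB Require Import structures.
From mathcomp Require Import all_boot all_order all_algebra complex.
From mathcomp Require Import all_classical all_reals all_analysis.
From mathcomp Require Import measurable_realfun ring lra zify.
From mathcomp Require polyrcf.
Import Order.TTheory GRing.Theory Num.Theory.
Import numFieldNormedType.Exports.
Local Open Scope classical_set_scope.
Local Open Scope ring_scope.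

Set Implicit Arguments.
Unset Strict Implicit.
Unset Printing Implicit Defensive.

(** Integration over caps of radius theta multiplies spherical harmonics of degree
    n by a number a_n (Funk-Hecke; [cap_multiplier] below). Hence f is obtained
    by integrating over caps the function h whose component of degree n is that of f divided
    by a_n, the integral of f against the measure on Omega is the integral over
    the sphere of h against the measure of the caps intersected with Omega, and
    the Cauchy-Schwarz inequality leaves a lower bound for |a_n| to be found.

    By the Legendre equation 2 n (n + 1) a_n = sin^2 P_n'(cos), and this
    quantity divided by sqrt sin solves a perturbed harmonic oscillator
    W'' + (m^2 - q) W = 0 with m = n + 1/2 and q independent of n. Therefore, up
    to a relative error O(1/n), it is an amplitude times +-sin (m theta - pi/4), and
    the amplitude gives |a_n| the size n^(-3/2). The set where that sine is less
    than n^(-s) in absolute value has measure O(n^(-s)), so the Borel-Cantelli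
    lemma gives (1). For (2), phi - pi/4 and 2 phi - pi/4 are never both close to
    a multiple of pi, so that for each large n either a_n(theta) or
    a_n(2 theta) has the size n^(-3/2), and each harmonic component of f can be
    recovered from the integrals over caps with one of the two radii. *)

(** * Legendre polynomials *)

(** Why (1) does not rest on the asymptotics: there a_n is tested against n^(-s) relative to its
    typical size, with s = gamma - 3/2, and Borel-Cantelli needs s > 1, so the error O(1/n) of the
    sine approximation is too large. The exceptional sets are estimated from the differential
    equation instead: the energy W^2 + (W'/m)^2 is nearly conserved, so where W is small its slope
    is of the order of m times the amplitude, and W soon leaves the small range. The asymptotics
    serve (2), where a fixed lower bound for the sine is enough.

    The function h would be an infinite series. This is avoided by first convolving f with a
    polynomial approximate identity: all sums become finite, the weight given to each degree lies in
    [-1, 1], so constants do not depend on the cutoff, and f returns by dominated convergence.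

    No basis of spherical harmonics is built. The analysis on the sphere rests on rotation
    invariance and on one geometric fact, Archimedes' theorem that height is uniformly distributed
    on [-1, 1]; it turns surface integrals of zonal polynomials into formal integrals of
    polynomials. *)

Section poly_mean.
Context {R : realType}.
Implicit Types p q : {poly R}.

Definition primitive_poly p : {poly R} :=
  \poly_(i < (size p).+1) (p`_i.-1 / i%:R).

Lemma deriv_primitive p : (primitive_poly p)^`() = p.
Proof.
apply/polyP => i; rewrite coef_deriv coef_poly ltnS /=.
case: ltnP => [_|le_p_i]; first by rewrite -(mulr_natr (_ / _)) divfK// pnatr_eq0.
by rewrite mul0rn nth_default.
Qed.

Lemma deriv_eq0_const p : p^`() = 0 -> p = (p`_0)%:P.
Proof.
move=> p'0; apply/polyP => -[|i]; rewrite coefC//=.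
have /eqP := congr1 (fun q : {poly R} => q`_i) p'0.
by rewrite coef_deriv coef0 mulrn_eq0 /= => /eqP.
Qed.

(* Half the integral of p over [-1, 1], computed formally. *)
Definition poly_mean p : R :=
  ((primitive_poly p).[1] - (primitive_poly p).[-1]) / 2.

Lemma poly_mean_deriv p : poly_mean p^`() = (p.[1] - p.[-1]) / 2.
Proof.
have /deriv_eq0_const e : (primitive_poly p^`() - p)^`() = 0.
  by rewrite derivB deriv_primitive subrr.
rewrite /poly_mean -[primitive_poly _](subrK p) e !hornerE.
by congr (_ / 2); ring.
Qed.

Lemma poly_meanD p q : poly_mean (p + q) = poly_mean p + poly_mean q.
Proof.
rewrite -[p in LHS]deriv_primitive -[q in LHS]deriv_primitive -derivD.
rewrite poly_mean_deriv /poly_mean !hornerD. by field.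
Qed.

Lemma poly_meanZ a p : poly_mean (a *: p) = a * poly_mean p.
Proof.
rewrite -[p in LHS]deriv_primitive -derivZ.
by rewrite poly_mean_deriv /poly_mean !hornerZ; field.
Qed.

Lemma poly_mean0 : poly_mean 0 = 0.
Proof. by rewrite -(scale0r 0) poly_meanZ mul0r. Qed.

Lemma poly_meanB p q : poly_mean (p - q) = poly_mean p - poly_mean q.
Proof. by rewrite -scaleN1r poly_meanD poly_meanZ mulN1r. Qed.

Lemma poly_mean_sum (I : Type) (r : seq I) (P : pred I) (F : I -> {poly R}) :
  poly_mean (\sum_(i <- r | P i) F i) = \sum_(i <- r | P i) poly_mean (F i).
Proof.
exact: (big_morph poly_mean poly_meanD poly_mean0).
Qed.

Lemma poly_mean_parts p q : poly_mean (p^`() * q) =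
  (p.[1] * q.[1] - p.[-1] * q.[-1]) / 2 - poly_mean (p * q^`()).
Proof.
by apply/eqP; rewrite eq_sym subr_eq -poly_meanD -derivM poly_mean_deriv !hornerE.
Qed.

(** The primitive of q^2 is nondecreasing on [-1, 1] with equal end values, so it is constant there,
    hence constant as a polynomial. *)
Lemma poly_mean_sqr_eq0 q : poly_mean (q * q) = 0 -> q = 0.
Proof.
move=> q0; set Q := primitive_poly (q * q).
have Qi (x y : R) : -1 <= x -> x <= y -> y <= 1 -> Q.[x] <= Q.[y].
  move=> x1 xy y1.
  have dQ z : z \in `]x, y[ -> is_derive z 1 (horner Q) Q^`().[z].
    by move=> _; exact: is_derive_poly.
  have cQ : {within `[x, y], continuous (horner Q)}.
    exact/continuous_subspaceT/continuous_horner.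
  have [z _] := MVT_segment xy dQ cQ.
  rewrite deriv_primitive hornerM => e; rewrite -subr_ge0 e.
  by rewrite mulr_ge0 ?subr_ge0// -expr2 sqr_ge0.
have Qc (x : R) : -1 <= x <= 1 -> Q.[x] = Q.[1].
  move=> /andP[x1 x2]; have := q0; rewrite /poly_mean -/Q => e.
  have := Qi (-1) x (lexx _) x1 x2; have := Qi x 1 x1 x2 (lexx _).
  by move=> *; lra.
have : Q - (Q.[1])%:P = 0.
  set p := Q - _.
  (* The points 1 / (i + 1) are distinct, lie in [0, 1], and are as many as the size of [p]. *)
  apply: (@roots_geq_poly_eq0 _ _ [seq i.+1%:R^-1 | i <- iota 0 (size p)]).
  - apply/allP => _ /mapP[i _ ->]; rewrite /root !hornerE Qc ?subrr//.
    by rewrite (le_trans _ (_ : 0 <= _))// ?invr_ge0// invf_le1// ler1n.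
  - rewrite map_inj_uniq ?iota_uniq// => i j /invr_inj /eqP.
    by rewrite eqr_nat => /eqP[].
  - by rewrite size_map size_iota.
move=> /(congr1 (@deriv R)).
rewrite derivB derivC subr0 deriv_primitive deriv0 => /eqP.
by rewrite mulf_eq0 orbb => /eqP.
Qed.

End poly_mean.

(** * Orthogonality, norm, differential equation and values at 0, from the Rodrigues formula *)

Section legendre.
Context {R : realType}.
Implicit Types p q r s : {poly R}.

Local Notation u := ('X^2 - 1 : {poly R}).
Local Notation P := (@legendre R).

Lemma legendre_scale_neq0 n : (2 ^+ n * n`!%:R)^-1 != 0 :> R.
Proof.
by rewrite invr_eq0 mulf_neq0// ?expf_neq0 ?pnatr_eq0 ?gtn_eqF ?fact_gt0.
Qed.

Lemma size_derivn_le n p : (size p^`(n) <= size p - n)%N.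
Proof.
elim: n => [|n ih]; first by rewrite derivn0 subn0.
rewrite derivnS subnS; case: (eqVneq p^`(n) 0) => [->|p0].
  by rewrite deriv0 size_poly0.
rewrite -ltnS; apply: leq_trans (lt_size_deriv p0) _.
by move: ih; case: (_ - _)%N => // + ; rewrite leqn0 size_poly_eq0 (negPf p0).
Qed.

Lemma size_rodrigues n : size (u ^+ n) = (2 * n).+1.
Proof.
have u0 : u ^+ n != 0 by rewrite monic_neq0// monic_exp// monicXnsubC.
by rewrite -(prednK (n := size _)) ?size_poly_gt0// size_exp size_XnsubC.
Qed.

Lemma size_legendre_le n : (size (P n) <= n.+1)%N.
Proof.
rewrite /legendre size_scale ?legendre_scale_neq0//.
apply: leq_trans (size_derivn_le _ _) _; rewrite size_rodrigues; lia.
Qed.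

Lemma legendre_lead_neq0 n : (P n)`_n != 0.
Proof.
rewrite /legendre coefZ mulf_neq0 ?legendre_scale_neq0// coef_derivn.
have -> : (n + n)%N = (size (u ^+ n)).-1 by rewrite size_rodrigues; lia.
rewrite -lead_coefE (monicP _) ?monic_exp ?monicXnsubC//.
by rewrite size_rodrigues /= pnatr_eq0 -lt0n ffact_gt0; lia.
Qed.

(** Each derivative consumes at most one factor X^2 - 1, so every derivative of order below n
    vanishes at 1 and -1. *)
Lemma rodrigues_derivn n j : (j <= n)%N ->
  exists g, (u ^+ n)^`(j) = u ^+ (n - j) * g.
Proof.
elim: j => [_|j ih jn]; first by exists 1; rewrite subn0 mulr1 derivn0.
have [g eg] := ih (ltnW jn).
exists (u^`() *+ (n - j) * g + u * g^`()).
rewrite derivnS eg derivM deriv_exp subnS.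
have -> : (n - j = (n - j).-1.+1)%N by rewrite prednK// subn_gt0.
rewrite mulrDr mulrA mulrnAr [_ * u^`()]mulrC; congr (_ + _).
by rewrite succnK exprS -mulrA mulrCA.
Qed.

(** Integration by parts j times; the boundary terms vanish because fewer than n derivatives always
    leave a factor X^2 - 1. *)
Lemma poly_mean_rodrigues n j q : (j <= n)%N ->
  poly_mean ((u ^+ n)^`(n) * q) =
  (-1) ^+ j * poly_mean ((u ^+ n)^`(n - j) * q^`(j)).
Proof.
elim: j => [_|j ih jn]; first by rewrite subn0 expr0 mul1r derivn0.
rewrite ih 1?ltnW//.
have -> : (n - j = (n - j.+1).+1)%N by lia.
rewrite derivnS poly_mean_parts.
have [|g ->] := @rodrigues_derivn n (n - j.+1); first lia.
have -> : (n - (n - j.+1) = j.+1)%N by lia.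
have -> : (u ^+ j.+1 * g).[1] = 0 by rewrite hornerM horner_exp !hornerE expr1n subrr expr0n mul0r.
have -> : (u ^+ j.+1 * g).[-1] = 0 by rewrite hornerM horner_exp !hornerE sqrrN expr1n subrr expr0n mul0r.
by rewrite !mul0r subrr mul0r sub0r -derivnS mulrN -mulNr [(-1) ^+ j.+1]exprS mulN1r.
Qed.

Lemma legendre_orthogonal n q : (size q <= n)%N -> poly_mean (P n * q) = 0.
Proof.
move=> qn; rewrite /legendre -scalerAl poly_meanZ (poly_mean_rodrigues q (leqnn n)).
have -> : q^`(n) = 0.
  apply/eqP; rewrite -size_poly_leq0; apply: leq_trans (size_derivn_le _ _) _.
  lia.
by rewrite mulr0 poly_mean0 !mulr0.
Qed.

(** The cofactor q is kept general for the induction: one derivative of (X - 1)^(n+1) q is (X - 1)^n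
    times a new cofactor whose value at 1 is (n + 1) q(1). *)
Lemma derivn_Xsub1_exp n q :
  ((('X - 1%:P) ^+ n * q)^`(n)).[1] = n`!%:R * q.[1].
Proof.
elim: n q => [|n ih] q; first by rewrite expr0 !mul1r derivn0.
rewrite derivSn.
have -> : (('X - 1%:P) ^+ n.+1 * q)^`() =
    ('X - 1%:P) ^+ n * (q *+ n.+1 + ('X - 1%:P) * q^`()).
  rewrite derivM deriv_exp derivB derivX derivC subr0 mul1r /= exprS.
  by rewrite -[in LHS]mulr_natl -[in RHS]mulr_natl; ring.
rewrite ih factS natrM hornerD hornerM hornerMn !hornerE subrr mul0r addr0.
by rewrite -mulr_natl; ring.
Qed.

Lemma legendre_horner1 n : (P n).[1] = 1.
Proof.
have e : u ^+ n = ('X - 1%:P) ^+ n * ('X + 1%:P) ^+ n.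
  by rewrite -exprMn; congr (_ ^+ _); rewrite -subr_sqr expr1n.
rewrite /legendre hornerZ e derivn_Xsub1_exp horner_exp hornerD hornerX hornerC.
rewrite [X in _ * X]mulrC mulVf// mulf_neq0// ?expf_neq0 ?pnatr_eq0// gtn_eqF// fact_gt0.
Qed.

Lemma derivn_comp_opp n p : p^`(n) \Po (- 'X) = (-1) ^+ n *: (p \Po (- 'X))^`(n).
Proof.
elim: n => [|n ih]; first by rewrite !derivn0 scale1r.
rewrite !derivnS exprS -scalerA -derivZ -ih deriv_comp derivN derivX.
by rewrite mulrN1 scaleN1r opprK.
Qed.

Lemma legendre_hornerN n x : (P n).[- x] = (-1) ^+ n * (P n).[x].
Proof.
have -> : - x = (- 'X : {poly R}).[x] by rewrite !hornerE.
rewrite -horner_comp /legendre comp_polyZ derivn_comp_opp.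
have -> : (u ^+ n) \Po (- 'X) = u ^+ n.
  by rewrite rmorphXn /= rmorphB /= comp_Xn_poly rmorph1 sqrrN.
by rewrite !hornerZ; ring.
Qed.

(** Subtracting the multiple of P_n with the same leading coefficient leaves a polynomial of degree
    below n that is orthogonal to itself. The multiple is then read off at 1, where P_n is 1. *)
Lemma legendre_unique n r :
  (size r <= n.+1)%N ->
  (forall s, (size s <= n)%N -> poly_mean (r * s) = 0) ->
  r = r.[1] *: P n.
Proof.
move=> rn r0; set c := r`_n / (P n)`_n.
suff e : r - c *: P n = 0.
  have -> : r.[1] = c.
    by rewrite -(subrK (c *: P n) r) e add0r hornerZ legendre_horner1 mulr1.
  by apply/eqP; rewrite -subr_eq0 e.
have qn : (size (r - c *: P n)%R <= n)%N.
  apply/leq_sizeP => j; rewrite leq_eqVlt => /predU1P[<-|nj].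
    by rewrite coefB coefZ /c divfK ?subrr// legendre_lead_neq0.
  rewrite coefB coefZ (nth_default _ (leq_trans rn nj)).
  by rewrite (nth_default _ (leq_trans (size_legendre_le n) nj)) mulr0 subrr.
apply: poly_mean_sqr_eq0.
rewrite [X in poly_mean X]mulrBl poly_meanB r0// -scalerAl poly_meanZ.
by rewrite legendre_orthogonal// mulr0 subrr.
Qed.

Lemma size_Xderiv_le n p : (size p <= n.+1)%N -> (size ('X * p^`() - n%:R *: p)%R <= n)%N.
Proof.
move=> pn; apply/leq_sizeP => j nj.
rewrite coefB coefZ coefXM coef_deriv; case: j nj => [|j] nj /=.
  by move: nj; rewrite leqn0 => /eqP ->; rewrite mul0r subrr.
move: nj; rewrite leq_eqVlt => /predU1P[->|nj].
  by rewrite mulr_natl subrr.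
by rewrite nth_default ?(leq_trans pn)// mul0rn mulr0 subrr.
Qed.

(** Integrate (X P_n^2)' = P_n^2 + 2 P_n (X P_n'). The left side has mean 1, and X P_n' may be
    replaced by n P_n since their difference has degree below n. *)
Lemma legendre_norm n : (2 * n%:R + 1) * poly_mean (P n * P n) = 1.
Proof.
have e1 : poly_mean ('X * (P n * P n))^`() = 1.
  rewrite poly_mean_deriv !hornerM !hornerX legendre_hornerN legendre_horner1.
  by rewrite !mulr1 -expr2 sqrr_sign; field.
have e2 : poly_mean (P n * ('X * (P n)^`() - n%:R *: P n)) = 0.
  by apply: legendre_orthogonal; apply: size_Xderiv_le; exact: size_legendre_le.
rewrite mulrBr poly_meanB -scalerAr poly_meanZ in e2.
have e3 : poly_mean ('X * (P n * P n))^`() =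
   poly_mean (P n * P n) + 2 * poly_mean (P n * ('X * (P n)^`())).
  by rewrite -poly_meanZ -poly_meanD derivM derivX derivM scaler_nat; congr poly_mean; ring.
by move: e1 e2; rewrite e3 => e1 e2; lra.
Qed.

Lemma size_deriv_le n p : (size p <= n.+1)%N -> (size p^`() <= n)%N.
Proof.
by move=> pn; apply: leq_trans (size_derivn_le 1 p) _; rewrite leq_subLR add1n.
Qed.

(** The operator is symmetric and does not raise degrees, so [r] is orthogonal to all lower degrees;
    hence so is [t] = r + n (n + 1) P_n, which itself has lower degree and must vanish. *)
Lemma legendre_ode n :
  ((1 - 'X^2) * (P n)^`())^`() = - (n * n.+1)%:R *: P n.
Proof.
set r := _^`().
have rs s : (size s <= n)%N -> poly_mean (r * s) = 0.
  move=> sn; rewrite poly_mean_parts.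
  have -> : ((1 - 'X^2) * (P n)^`()).[1] = 0.
    by rewrite hornerM !hornerE expr1n subrr mul0r.
  have -> : ((1 - 'X^2) * (P n)^`()).[-1] = 0.
    by rewrite hornerM !hornerE sqrrN expr1n subrr mul0r.
  rewrite !mul0r subrr mul0r sub0r mulrAC mulrC poly_mean_parts.
  have -> : ((1 - 'X^2) * s^`()).[1] = 0.
    by rewrite hornerM !hornerE expr1n subrr mul0r.
  have -> : ((1 - 'X^2) * s^`()).[-1] = 0.
    by rewrite hornerM !hornerE sqrrN expr1n subrr mul0r.
  rewrite !mulr0 subrr mul0r sub0r opprK; apply: legendre_orthogonal.
  apply: size_deriv_le.
  have [->|s0] := eqVneq s^`() 0; first by rewrite mulr0 size_poly0.
  apply: leq_trans (size_polyMleq _ _) _.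
  have h3 : size (1 - 'X^2 : {poly R}) = 3%N.
    by rewrite -opprB size_polyN size_XnsubC.
  have : (size s^`() < size s)%N by rewrite lt_size_deriv//; apply: contraNneq s0 => ->; rewrite deriv0.
  by move: h3 sn; lia.
set q := 'X * (P n)^`() - n%:R *: P n.
have qn : (size q <= n)%N by apply: size_Xderiv_le; exact: size_legendre_le.
pose t := (P n)^`()^`() - ('X * q)^`() - n%:R *: q.
(* Replacing X P_n' by q + n P_n twice isolates the top-degree part - n (n + 1) P_n. *)
have rE : r = t - (n * n.+1)%:R *: P n.
  rewrite /r /t /q -!mul_polyC !(derivM, derivB, derivXn, derivX, derivC) natrM /=.
  by rewrite rmorphM /= -(natr1 n) rmorphD /=; ring.
have tn : (size t <= n)%N.
  rewrite /t (leq_trans (size_polyD _ _))// geq_max size_polyN.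
  rewrite (leq_trans (size_scale_leq _ _))// andbT.
  rewrite (leq_trans (size_polyD _ _))// geq_max size_polyN.
  apply/andP; split; last first.
    apply: size_deriv_le; rewrite (leq_trans (size_polyMleq _ _))// size_polyX.
    by move: qn; lia.
  have := size_derivn_le 2 (P n); rewrite derivnS derivn1 => /leq_trans; apply.
  by have := size_legendre_le n; lia.
have t0 : t = 0.
  apply: poly_mean_sqr_eq0.
  have -> : t * t = r * t + (n * n.+1)%:R *: (P n * t).
    by rewrite scalerAl -mulrDl rE subrK.
  by rewrite poly_meanD poly_meanZ rs// legendre_orthogonal// mulr0 addr0.
by rewrite rE t0 sub0r scaleNr.
Qed.

Lemma legendre_span N p : (size p <= N)%N ->
  exists c : nat -> R, p = \sum_(n < N) c n *: P n.
Proof.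
elim: N p => [|N ih] p pN.
  by exists (fun=> 0); rewrite big_ord0; apply/eqP; rewrite -size_poly_leq0.
set a := p`_N / (P N)`_N.
have [|c ec] := ih (p - a *: P N).
  apply/leq_sizeP => j; rewrite leq_eqVlt => /predU1P[<-|nj].
    by rewrite coefB coefZ /a divfK ?subrr// legendre_lead_neq0.
  rewrite coefB coefZ (nth_default _ (leq_trans pN nj)).
  by rewrite (nth_default _ (leq_trans (size_legendre_le N) nj)) mulr0 subrr.
exists (fun n => if n == N then a else c n).
rewrite big_ord_recr /= eqxx -[LHS](subrK (a *: P N)) ec; congr (_ + _).
by apply: eq_bigr => i _; rewrite ltn_eqF.
Qed.

Lemma poly_mean_legendreM m n : m != n -> poly_mean (P m * P n) = 0.
Proof.
case: (ltngtP m n) => // mn _.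
  by rewrite mulrC legendre_orthogonal// (leq_trans (size_legendre_le m)).
by rewrite legendre_orthogonal// (leq_trans (size_legendre_le n)).
Qed.

Lemma legendre_expansion N p : (size p <= N)%N ->
  p = \sum_(n < N) ((2 * n%:R + 1) * poly_mean (p * P n)) *: P n.
Proof.
move=> /legendre_span[c ->]; apply: eq_bigr => m _; congr (_ *: _).
rewrite mulr_suml poly_mean_sum (bigD1 m)//= big1 ?addr0 => [|n nm].
  by rewrite -scalerAl poly_meanZ mulrCA legendre_norm mulr1.
by rewrite -scalerAl poly_meanZ poly_mean_legendreM ?mulr0.
Qed.

Lemma legendre_horner0_odd n : odd n -> (P n).[0] = 0.
Proof.
move=> on; have := legendre_hornerN n 0; rewrite oppr0 -signr_odd on expr1.
by move=> ?; lra.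
Qed.

Lemma legendre_deriv_horner0_even n : ~~ odd n -> (P n)^`().[0] = 0.
Proof.
move=> on; have : P n = P n \Po (- 'X).
  rewrite /legendre comp_polyZ derivn_comp_opp.
  have -> : (u ^+ n) \Po (- 'X) = u ^+ n.
    by rewrite rmorphXn /= rmorphB /= comp_Xn_poly rmorph1 sqrrN.
  by rewrite -signr_odd (negPf on) scale1r.
move=> /(congr1 (fun p => p^`().[0])).
rewrite deriv_comp hornerM horner_comp derivN derivX !hornerE oppr0.
by move=> ?; lra.
Qed.

(** The absolute value of P_(2k) at 0, of order k^(-1/2). *)
Definition central_binomial k : R := 'C(2 * k, k)%:R / 4 ^+ k.

Lemma central_binomialS k :
  central_binomial k.+1 = (2 * k%:R + 1) / (2 * k.+1%:R) * central_binomial k.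
Proof.
rewrite /central_binomial.
have e1 := congr1 (fun m => m%:R : R) (mul_bin_diag (2 * k).+2 k).
have e2 := congr1 (fun m => m%:R : R) (mul_bin_down (2 * k).+1 k).
have e3 : (2 * k.+1 = (2 * k).+2)%N by lia.
rewrite succnK in e2.
have e4 : ((2 * k).+1 - k = k.+1)%N by lia.
rewrite e4 in e2.
move: e1 e2; rewrite !natrM.
rewrite e3 succnK; set a := 'C(_, k.+1)%:R; set b := 'C(_.+1, k)%:R; set c := 'C(_, k)%:R => e1 e2.
have k0 : k.+1%:R != 0 :> R by rewrite pnatr_eq0.
have eb : b = (2 * k%:R + 1) * c / k.+1%:R.
  rewrite -[b](mulKf k0) -e2 -(natr1 (2 * k)) natrM; field.
  by rewrite addrC natr1 pnatr_eq0.
have -> : a = 2 * b by apply: (mulfI k0); rewrite -e1; ring.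
rewrite eb exprS -(natr1 k); field.
by rewrite natr1 pnatr_eq0 andbT expf_neq0.
Qed.

(** The right side is nondecreasing in k and equals 1 at k = 1. This lower bound fixes the amplitude
    of the oscillator below. *)
Lemma central_binomial_ge k : (0 < k)%N -> 1 <= 4 * k%:R * central_binomial k ^+ 2.
Proof.
case: k => // k _; elim: k => [|k ih].
  by rewrite central_binomialS /central_binomial bin0 expr0; lra.
apply: (le_trans ih).
rewrite [central_binomial k.+2]central_binomialS [(_ * central_binomial _) ^+ 2]exprMn; set b := central_binomial _.
have b0 := sqr_ge0 b.
have -> : 4 * k.+2%:R * (((2 * k.+1%:R + 1) / (2 * k.+2%:R)) ^+ 2 * b ^+ 2) =
  (2 * k.+1%:R + 1) ^+ 2 / k.+2%:R * b ^+ 2.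
  have : k.+2%:R != 0 :> R by rewrite pnatr_eq0.
  by move: k.+2%:R => K K0; field.
apply: ler_wpM2r => //; rewrite ler_pdivlMr ?ltr0n// -(natr1 k.+1).
by nra.
Qed.

Lemma coef_rodrigues n i : (i <= n)%N ->
  (u ^+ n)`_(2 * i) = (-1) ^+ (n - i) * 'C(n, i)%:R.
Proof.
move=> le_in; rewrite addrC exprDn coef_sum.
have lin : (i < n.+1)%N by [].
rewrite (bigD1 (Ordinal lin))//= big1 ?addr0 => [|j /eqP/val_eqP /= ji].
  by rewrite -exprM -polyCN -polyC_exp coefMn coefCM coefXn eqxx mulr1 mulr_natr.
by rewrite -exprM -polyCN -polyC_exp coefMn coefCM coefXn eqn_pmul2l// eq_sym (negPf ji) mulr0 mul0rn.
Qed.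

(** At 0 only the coefficient of X^(2k) in (X^2 - 1)^(2k) survives; squaring discards its sign. *)
Lemma legendre_horner0_even k : (P (2 * k)).[0] ^+ 2 = central_binomial k ^+ 2.
Proof.
have f0 : (2 * k)`!%:R != 0 :> R by rewrite pnatr_eq0 gtn_eqF// fact_gt0.
rewrite horner_coef0 /legendre coefZ coef_derivn addn0 ffactnn coef_rodrigues; last lia.
set e := (-1) ^+ _; have e2 : e ^+ 2 = 1 by rewrite /e sqrr_sign.
rewrite [X in X ^+ 2](_ : _ = e * central_binomial k) ?exprMn ?e2 ?mul1r//.
rewrite /central_binomial -[_ *+ (2 * k)`!]mulr_natr exprM (_ : 2 ^+ 2 = 4); last by ring.
by field; rewrite f0 expf_neq0.
Qed.

Lemma legendre_deriv_horner0_odd k :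
  (P (2 * k).+1)^`().[0] ^+ 2 = ((2 * k).+2%:R * central_binomial k.+1) ^+ 2.
Proof.
have f0 : (2 * k).+1`!%:R != 0 :> R by rewrite pnatr_eq0 gtn_eqF// fact_gt0.
rewrite horner_coef0 coef_deriv /legendre coefZ coef_derivn addn1.
rewrite (_ : (2 * k).+2 = 2 * k.+1)%N; last lia.
rewrite coef_rodrigues; last lia.
have ff : ((2 * k.+1) ^_ (2 * k).+1 = (2 * k.+1) * (2 * k).+1`!)%N.
  rewrite -[LHS]muln1 -[X in (_ * X)%N](_ : (2 * k.+1 - (2 * k).+1)`! = 1)%N.
    by rewrite ffact_fact; [rewrite (_ : 2 * k.+1 = (2 * k).+2)%N; [rewrite factS|lia]|lia].
  by rewrite (_ : _ - _ = 1)%N//; lia.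
have fb : ('C(2 * k.+1, k.+1) = 2 * 'C((2 * k).+1, k.+1))%N.
  rewrite (_ : 2 * k.+1 = (2 * k).+2)%N; last lia.
  rewrite binS -[X in (_ + X)%N]bin_sub; last lia.
  by rewrite (_ : _ - _ = k.+1)%N; lia.
set e := (-1) ^+ _; have e2 : e ^+ 2 = 1 by rewrite /e sqrr_sign.
rewrite [X in X ^+ 2](_ : _ = e * ((2 * k.+1)%:R * central_binomial k.+1));
  last first.
  move: f0 ff; move: _`! => F f0 ff.
  rewrite mulr1n ff /central_binomial fb -[_ *+ (_ * F)]mulr_natr !natrM.
  rewrite exprS exprM (_ : 2 ^+ 2 = 4); last by ring.
  by rewrite [4 ^+ k.+1]exprS; field; rewrite f0 expf_neq0.
by rewrite exprMn e2 mul1r.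
Qed.

End legendre.

(** * Rotations preserve volume *)

Section preserves.
Context d (T : measurableType d) {R : realType}.
Implicit Types m : {measure set T -> \bar R}.

Definition preserves (m : set T -> \bar R) (phi : T -> T) :=
  measurable_fun setT phi /\
  forall A, measurable A -> m (phi @^-1` A) = m A.

Lemma measurable_preimageT d' (T' : measurableType d') (phi : T -> T') A :
  measurable_fun setT phi -> measurable A -> measurable (phi @^-1` A).
Proof. by move=> mphi mA; rewrite -[X in measurable X]setTI; exact: mphi. Qed.

Lemma preserves_id m : preserves m id.
Proof. by split. Qed.

Lemma preserves_comp m phi psi :
  preserves m phi -> preserves m psi -> preserves m (phi \o psi).
Proof.
move=> [mphi pphi] [mpsi ppsi]; split; first exact: measurableT_comp.
move=> A mA; rewrite -(pphi A mA) -(ppsi (phi @^-1` A))//.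
exact: measurable_preimageT.
Qed.

End preserves.

Section fibers.
Context d1 d2 (T1 : measurableType d1) (T2 : measurableType d2) {R : realType}.
Variable m1 : {sigma_finite_measure set T1 -> \bar R}.
Variable m2 : {sigma_finite_measure set T2 -> \bar R}.

Lemma product_measure12 A : measurable A -> (m1 \x m2)%E A = (m1 \x^ m2)%E A.
Proof.
by move=> mA; apply: product_measure_unique => //= *; rewrite product_measure2E.
Qed.

(** Cavalieri's principle: the section of the preimage over x is the preimage of the section over
    x. *)
Lemma preserves_fiber2 (phi : T1 * T2 -> T2) :
  measurable_fun setT phi ->
  (forall x, preserves m2 (fun y => phi (x, y))) ->
  preserves (m1 \x m2)%E (fun z => (z.1, phi z)).
Proof.
move=> mphi pphi; split.
  by apply: measurable_fun_pair => //; exact: measurable_fst.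
move=> A mA; apply: eq_integral => x _ /=.
rewrite -((pphi x).2 (xsection A x)); last exact: measurable_xsection.
by congr (m2 _); apply/seteqP; split => y /=; rewrite /xsection/= !inE/=.
Qed.

Lemma preserves_fiber1 (phi : T1 * T2 -> T1) :
  measurable_fun setT phi ->
  (forall y, preserves m1 (fun x => phi (x, y))) ->
  preserves (m1 \x m2)%E (fun z => (phi z, z.2)).
Proof.
move=> mphi pphi.
have mPhi : measurable_fun setT (fun z => (phi z, z.2)).
  by apply: measurable_fun_pair => //; exact: measurable_snd.
split=> // A mA; rewrite !product_measure12//; last exact: measurable_preimageT.
apply: eq_integral => y _ /=.
rewrite -((pphi y).2 (ysection A y)); last exact: measurable_ysection.
by congr (m1 _); apply/seteqP; split => x /=; rewrite /ysection/= !inE/=.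
Qed.

End fibers.

Section lebesgue_shears.
Context {R : realType}.
Notation la := (@lebesgue_measure R).
Notation T := (measurableTypeR R).

(** Lebesgue measure is determined by the lengths of half-open intervals. Every shear below is a
    translation on each fiber. *)
Lemma preserves_translation (t : R) : preserves la (fun x : T => x + t).
Proof.
have mt : measurable_fun setT (fun x : T => (x + t : T)) by exact: measurable_funD.
split=> // A mA.
pose m := pushforward la (fun x : T => x + t : T).
have -> : la ((fun x : T => x + t) @^-1` A) = m A by [].
apply/esym.
have := @lebesgue_measure_unique R (measure_function_pushforward__canonical__measure_function_Measure la mt).
apply => //.
move=> _ [[a b] _ <-] /=; rewrite /pushforward.
rewrite (_ : _ @^-1` _ = `]a - t, b - t]%classic).
  by rewrite !lebesgue_measure_itv/= !lte_fin ltrD2r; case: ifP => // _; congr EFin; ring.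
apply/seteqP; split => x /=; rewrite !in_itv/=; by lra.
Qed.

Definition shear2 (a : R) (p : T * T) : T * T := (p.1, p.2 + a * p.1).
Definition shear1 (a : R) (p : T * T) : T * T := (p.1 + a * p.2, p.2).
Definition translation2 (a b : R) (p : T * T) : T * T := (p.1 + a, p.2 + b).

Lemma preserves_shear2 a : preserves (la \x la)%E (shear2 a).
Proof.
apply: (@preserves_fiber2 _ _ _ _ R _ _ (fun z : T * T => (z.2 + a * z.1 : T))) => [|x].
  apply: measurable_funD; first exact: measurable_snd.
  by apply: measurable_funM => //; exact: measurable_fst.
exact: (preserves_translation (a * x)).
Qed.

Lemma preserves_shear1 a : preserves (la \x la)%E (shear1 a).
Proof.
apply: (@preserves_fiber1 _ _ _ _ R _ _ (fun z : T * T => (z.1 + a * z.2 : T))) => [|x].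
  apply: measurable_funD; first exact: measurable_fst.
  by apply: measurable_funM => //; exact: measurable_snd.
exact: (preserves_translation (a * x)).
Qed.

Lemma preserves_translation2 a b : preserves (la \x la)%E (translation2 a b).
Proof.
rewrite (_ : translation2 a b = (fun p => (p.1 + a, p.2)) \o (fun p => (p.1, p.2 + b)))//.
apply: preserves_comp.
  apply: (@preserves_fiber1 _ _ _ _ R _ _ (fun z : T * T => (z.1 + a : T))) => [|x].
    by apply: measurable_funD => //; exact: measurable_fst.
  exact: (preserves_translation a).
apply: (@preserves_fiber2 _ _ _ _ R _ _ (fun z : T * T => (z.2 + b : T))) => [|x].
  by apply: measurable_funD => //; exact: measurable_snd.
exact: (preserves_translation b).
Qed.

Lemma measurable_coord11 : measurable_fun setT (fun x : space3 R => x.1.1 : R).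
Proof. by apply: measurableT_comp => //; exact: measurable_fst. Qed.

Lemma measurable_coord12 : measurable_fun setT (fun x : space3 R => x.1.2 : R).
Proof. by apply: measurableT_comp => //; exact: measurable_fst. Qed.

Lemma measurable_coord2 : measurable_fun setT (fun x : space3 R => x.2 : R).
Proof. exact: measurable_snd. Qed.

#[local] Hint Resolve measurable_coord11 measurable_coord12 measurable_coord2 : core.

Lemma measurable_linear3 (a b c : R) :
  measurable_fun setT (fun x : space3 R => a * x.1.1 + b * x.1.2 + c * x.2 : R).
Proof.
by apply: measurable_funD; [apply: measurable_funD|]; apply: measurable_funM.
Qed.

(** Named so that it can carry a sigma-finite structure: [volume3] is then a product of two
    sigma-finite measures and the fiber lemmas apply to it. *)
Definition area : set (T * T)%type -> \bar R := (la \x la)%E.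

HB.instance Definition _ := Measure.on area.

Lemma area_sigma_finite : sigma_finite setT area.
Proof.
pose F (n : nat) : set T := `[- n%:R, n%:R]%classic.
exists (fun n => F n `*` F n) => [|n].
  apply/seteqP; split=> // -[x y] _.
  have [n nE] : exists n : nat, Num.max `|x| `|y| <= n%:R.
    by exists (Num.truncn (Num.max `|x| `|y|)).+1; apply/ltW/truncnS_gt.
  exists n => //; rewrite /F /= !in_itv/= -!ler_norml.
  by move: nE; rewrite ge_max => /andP[-> ->].
split; first by apply: measurableX; exact: measurable_itv.
have mF : measurable (F n) by exact: measurable_itv.
have laF : (la (F n) < +oo)%E.
  by rewrite /F lebesgue_measure_itv/=; case: ifP => _; rewrite -?EFinD ltry.
rewrite /area product_measure1E//; apply: lte_mul_pinfty => //.
by rewrite ge0_fin_numE.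
Qed.

HB.instance Definition _ := Measure_isSigmaFinite.Build _ _ _ area area_sigma_finite.

Lemma preserves_shear3 a b :
  preserves (@volume3 R) (fun x => (x.1, x.2 + (a * x.1.1 + b * x.1.2))).
Proof.
apply: (@preserves_fiber2 _ _ _ _ R area la
  (fun x : space3 R => x.2 + (a * x.1.1 + b * x.1.2) : R)) => [|x].
  rewrite (_ : (fun z : space3 R => _) = (fun x : space3 R => a * x.1.1 + b * x.1.2 + 1 * x.2 : R)).
    exact: measurable_linear3.
  by apply/funext => z; rewrite mul1r addrC.
exact: (preserves_translation (a * x.1 + b * x.2)).
Qed.

Lemma preserves_shear12 a b :
  preserves (@volume3 R) (fun x => (translation2 (a * x.2) (b * x.2) x.1, x.2)).
Proof.
apply: (@preserves_fiber1 _ _ _ _ R area la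
  (fun z : space3 R => translation2 (a * z.2) (b * z.2) z.1)) => [|x].
  apply: measurable_fun_pair.
    rewrite (_ : (fun z : space3 R => _) = (fun x : space3 R => 1 * x.1.1 + 0 * x.1.2 + a * x.2 : R)).
      exact: measurable_linear3.
    by apply/funext => z; rewrite mul1r mul0r addr0.
  rewrite (_ : (fun z : space3 R => _) = (fun x : space3 R => 0 * x.1.1 + 1 * x.1.2 + b * x.2 : R)).
    exact: measurable_linear3.
  by apply/funext => z; rewrite mul1r mul0r add0r.
exact: (preserves_translation2 (a * x) (b * x)).
Qed.

Lemma preserves_plane phi : preserves (la \x la)%E phi ->
  preserves (@volume3 R) (fun x => (phi x.1, x.2)).
Proof.
move=> pphi.
apply: (@preserves_fiber1 _ _ _ _ R area la (fun z : space3 R => phi z.1)) => [|x].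
  by apply: measurableT_comp; [exact: pphi.1|exact: measurable_fst].
exact: pphi.
Qed.

End lebesgue_shears.

(** * Coordinate rotations as products of shears *)

Section rotations.
Context {R : realType}.
Implicit Types (x y z : space3 R) (c s : R).

Definition scale3 (a : R) x : space3 R := (a * x.1.1, a * x.1.2, a * x.2).

(** Exactly what the invariance of [surface] requires; commutation with scalings is there because
    [radial] is a scaling. *)
Definition rotation (M : space3 R -> space3 R) :=
  [/\ preserves (@volume3 R) M,
      forall x y, dot (M x) (M y) = dot x y &
      forall a x, M (scale3 a x) = scale3 a (M x)].

Lemma rotation_comp M N : rotation M -> rotation N -> rotation (M \o N).
Proof.
move=> [pM dM sM] [pN dN sN]; split.
- exact: preserves_comp.
- by move=> x y /=; rewrite dM dN.
- by move=> a x /=; rewrite sN sM.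
Qed.

Definition rot12 c s x : space3 R := (c * x.1.1 - s * x.1.2, s * x.1.1 + c * x.1.2, x.2).
Definition rot13 c s x : space3 R := (c * x.1.1 - s * x.2, x.1.2, s * x.1.1 + c * x.2).
Definition rot23 c s x : space3 R := (x.1.1, c * x.1.2 - s * x.2, s * x.1.2 + c * x.2).

Lemma space3_eq x y : x.1.1 = y.1.1 -> x.1.2 = y.1.2 -> x.2 = y.2 -> x = y.
Proof.
by case: x => [[x1 x2] x3]; case: y => [[y1 y2] y3] /= -> -> ->.
Qed.

(* A rotation by an angle outside {0, pi} is a product of three shears, and the
   rotation by pi is the square of the rotation by pi / 2. *)
Lemma preserves_rot (rot : R -> R -> space3 R -> space3 R) (U L : R -> space3 R -> space3 R) :
  (forall c s, c ^+ 2 + s ^+ 2 = 1 -> s != 0 ->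
    rot c s = U ((c - 1) / s) \o L s \o U ((c - 1) / s)) ->
  rot 1 0 = id -> rot (- 1) 0 = rot 0 1 \o rot 0 1 ->
  (forall a, preserves (@volume3 R) (U a)) ->
  (forall a, preserves (@volume3 R) (L a)) ->
  forall c s, c ^+ 2 + s ^+ 2 = 1 -> preserves (@volume3 R) (rot c s).
Proof.
move=> rotE rot1 rotN pU pL.
have rots c s : c ^+ 2 + s ^+ 2 = 1 -> s != 0 -> preserves (@volume3 R) (rot c s).
  by move=> cs s0; rewrite rotE//; do 2?apply: preserves_comp.
move=> c s cs; have [s0|s0] := eqVneq s 0; last exact: rots.
have : (c - 1) * (c + 1) = 0 by move: cs; rewrite s0; lra.
move=> /eqP; rewrite mulf_eq0 subr_eq0 addr_eq0 s0 => /orP[/eqP ->|/eqP ->].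
  by rewrite rot1; exact: preserves_id.
rewrite rotN; apply: preserves_comp; apply: rots; rewrite ?oner_neq0//; lra.
Qed.

Lemma rotation_rot12 c s : c ^+ 2 + s ^+ 2 = 1 -> rotation (rot12 c s).
Proof.
move=> cs; split.
- move: c s cs; apply: (preserves_rot
    (U := fun a x => (shear1 a x.1, x.2)) (L := fun a x => (shear2 a x.1, x.2))).
  + move=> c s cs s0; apply/funext => x; rewrite /rot12/=.
    have e : s ^+ 2 = 1 - c ^+ 2 by lra.
    by apply: space3_eq => //=; field: e.
  + by apply/funext => x; apply: space3_eq => //=; ring.
  + by apply/funext => x; apply: space3_eq => //=; ring.
  + by move=> a; apply: preserves_plane; exact: preserves_shear1.
  + by move=> a; apply: preserves_plane; exact: preserves_shear2.
- move=> x y; have e : s ^+ 2 = 1 - c ^+ 2 by lra.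
  by rewrite /dot /rot12/=; ring: e.
- by move=> a x; apply: space3_eq => //=; ring.
Qed.

Lemma rotation_rot13 c s : c ^+ 2 + s ^+ 2 = 1 -> rotation (rot13 c s).
Proof.
move=> cs; split.
- move: c s cs; apply: (preserves_rot
    (U := fun a x => (translation2 (a * x.2) (0 * x.2) x.1, x.2))
    (L := fun a x => (x.1, x.2 + (a * x.1.1 + 0 * x.1.2)))).
  + move=> c s cs s0; apply/funext => x.
    have e : s ^+ 2 = 1 - c ^+ 2 by lra.
    by apply: space3_eq => //=; field: e.
  + by apply/funext => x; apply: space3_eq => //=; ring.
  + by apply/funext => x; apply: space3_eq => //=; ring.
  + by move=> a; exact: preserves_shear12.
  + by move=> a; exact: preserves_shear3.
- move=> x y; have e : s ^+ 2 = 1 - c ^+ 2 by lra.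
  by rewrite /dot /rot13/=; ring: e.
- by move=> a x; apply: space3_eq => //=; ring.
Qed.

Lemma rotation_rot23 c s : c ^+ 2 + s ^+ 2 = 1 -> rotation (rot23 c s).
Proof.
move=> cs; split.
- move: c s cs; apply: (preserves_rot
    (U := fun a x => (translation2 (0 * x.2) (a * x.2) x.1, x.2))
    (L := fun a x => (x.1, x.2 + (0 * x.1.1 + a * x.1.2)))).
  + move=> c s cs s0; apply/funext => x.
    have e : s ^+ 2 = 1 - c ^+ 2 by lra.
    by apply: space3_eq => //=; field: e.
  + by apply/funext => x; apply: space3_eq => //=; ring.
  + by apply/funext => x; apply: space3_eq => //=; ring.
  + by move=> a; exact: preserves_shear12.
  + by move=> a; exact: preserves_shear3.
- move=> x y; have e : s ^+ 2 = 1 - c ^+ 2 by lra.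
  by rewrite /dot /rot23/=; ring: e.
- by move=> a x; apply: space3_eq => //=; ring.
Qed.

End rotations.

(** * Integrals of bounded functions *)

Section bounded_integration.
Context d (T : measurableType d) {R : realType}.
Variable m : {finite_measure set T -> \bar R}.
Variable D : set T.
Hypothesis mD : measurable D.
Implicit Types f g h : T -> R.

(** For a finite measure this class is integrable and closed under sums and products, so that one
    side condition covers every integral on the sphere. *)
Definition bounded_measurable (E : set T) g :=
  measurable_fun E g /\ exists M, forall x, E x -> `|g x| <= M.

Local Notation bm := (bounded_measurable D).

Lemma bounded_measurable_integrable g :
  bm g -> m.-integrable D (EFin \o g).
Proof.
move=> [mg [M gM]]; apply: measurable_bounded_integrable => //.
  by rewrite -ge0_fin_numE// fin_num_measure.
exists M; split; rewrite ?num_real// => x Mx t Dt /=.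
exact: le_trans (gM t Dt) (ltW Mx).
Qed.

Local Notation I := bounded_measurable_integrable.

Lemma bounded_measurable_cst (k : R) : bm (fun=> k).
Proof. by split; [exact: measurable_cst|exists `|k|]. Qed.

Lemma bounded_measurableD f g : bm f -> bm g -> bm (fun x => f x + g x).
Proof.
move=> [mf [Mf Bf]] [mg [Mg Bg]]; split; first exact: measurable_funD.
exists (Mf + Mg) => x Dx; apply: le_trans (ler_normD _ _) _.
by rewrite lerD ?Bf ?Bg.
Qed.

Lemma bounded_measurableM f g : bm f -> bm g -> bm (fun x => f x * g x).
Proof.
move=> [mf [Mf Bf]] [mg [Mg Bg]]; split; first exact: measurable_funM.
by exists (Mf * Mg) => x Dx; rewrite normrM ler_pM ?Bf ?Bg.
Qed.

Lemma bounded_measurableZ (k : R) f : bm f -> bm (fun x => k * f x).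
Proof. by move=> bf; apply: bounded_measurableM => //; exact: bounded_measurable_cst. Qed.

Lemma bounded_measurableB f g : bm f -> bm g -> bm (fun x => f x - g x).
Proof.
move=> bf bg; rewrite (_ : (fun x => _) = (fun x => f x + (-1) * g x)).
  by apply: bounded_measurableD => //; exact: bounded_measurableZ.
by apply/funext => x; rewrite mulN1r.
Qed.

Lemma bounded_measurable_norm f : bm f -> bm (fun x => `|f x|).
Proof.
move=> [mf [Mf Bf]]; split; first exact: measurableT_comp.
by exists Mf => x Dx; rewrite normr_id Bf.
Qed.

Lemma bounded_measurable_sum (J : Type) (r : seq J) (P : pred J) (F : J -> T -> R) :
  (forall j, P j -> bm (F j)) -> bm (fun x => \sum_(j <- r | P j) F j x).
Proof.
move=> bF; elim: r => [|j r ih].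
  rewrite (_ : (fun x => _) = fun=> 0); first exact: bounded_measurable_cst.
  by apply/funext => x; rewrite big_nil.
rewrite (_ : (fun x => _) = fun x => (if P j then F j x else 0) + \sum_(j <- r | P j) F j x).
  apply: bounded_measurableD => //; case E: (P j); first exact: bF.
  exact: bounded_measurable_cst.
by apply/funext => x; rewrite big_cons; case: ifP => _; rewrite ?add0r.
Qed.

Local Notation "'J' g" := (\int[m]_(x in D) g x) (at level 10, g at level 8).

Lemma Rintegral_bmD f g : bm f -> bm g ->
  \int[m]_(x in D) (f x + g x) = J f + J g.
Proof. by move=> bf bg; rewrite RintegralD//; exact: I. Qed.

Lemma Rintegral_bmB f g : bm f -> bm g ->
  \int[m]_(x in D) (f x - g x) = J f - J g.
Proof. by move=> bf bg; rewrite RintegralB//; exact: I. Qed.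

Lemma Rintegral_bmZ (k : R) f : bm f -> \int[m]_(x in D) (k * f x) = k * J f.
Proof. by move=> bf; rewrite RintegralZl//; exact: I. Qed.

Lemma Rintegral_bm_sum (K : Type) (r : seq K) (P : pred K) (F : K -> T -> R) :
  (forall j, P j -> bm (F j)) ->
  \int[m]_(x in D) (\sum_(j <- r | P j) F j x) = \sum_(j <- r | P j) J (F j).
Proof.
move=> bF; elim: r => [|j r ih].
  rewrite big_nil (@eq_Rintegral _ _ _ _ _ (fun=> 0)) ?Rintegral_cst ?mul0r//.
  by move=> x _; rewrite big_nil.
rewrite big_cons; case: ifPn => Pj.
  rewrite (@eq_Rintegral _ _ _ _ _ (fun x => F j x + \sum_(j <- r | P j) F j x)); last first.
    by move=> x _; rewrite big_cons Pj.
  by rewrite Rintegral_bmD ?ih; [|exact: bF|exact: bounded_measurable_sum].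
by rewrite -ih; apply: eq_Rintegral => x _; rewrite big_cons (negPf Pj).
Qed.

Lemma le_Rintegral_bm f g : bm f -> bm g -> (forall x, D x -> f x <= g x) -> J f <= J g.
Proof. by move=> bf bg fg; apply: le_Rintegral => //; exact: I. Qed.

Lemma normr_Rintegral_bm f (M : R) : bm f -> (forall x, D x -> `|f x| <= M) ->
  `|J f| <= M * fine (m D).
Proof.
move=> bf fM; rewrite -Rintegral_cst//; apply: le_trans (le_normr_Rintegral _ _) _ => //.
  exact: I.
by apply: le_Rintegral_bm => //; [exact: bounded_measurable_norm|exact: bounded_measurable_cst].
Qed.

(** The integral of (s f - t g)^2 is nonnegative for all s and t; the two cases are choices of (s,
    t). *)
Lemma cauchy_schwarz_Rintegral f g : bm f -> bm g ->
  (\int[m]_(x in D) (f x * g x)) ^+ 2 <=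
  (\int[m]_(x in D) (f x ^+ 2)) * (\int[m]_(x in D) (g x ^+ 2)).
Proof.
move=> bf bg.
have bff : bm (fun x => f x ^+ 2).
  by rewrite (_ : (fun x => _) = fun x => f x * f x) //; exact: bounded_measurableM.
have bgg : bm (fun x => g x ^+ 2).
  by rewrite (_ : (fun x => _) = fun x => g x * g x) //; exact: bounded_measurableM.
have bfg := bounded_measurableM bf bg.
set A := \int[m]_(x in D) (f x ^+ 2); set C := \int[m]_(x in D) (g x ^+ 2).
set B := \int[m]_(x in D) (f x * g x).
have key (t s : R) : 0 <= s ^+ 2 * A - 2 * (s * t) * B + t ^+ 2 * C.
  rewrite -!Rintegral_bmZ// -Rintegral_bmB -?Rintegral_bmD.
  - by apply: Rintegral_ge0 => x _; rewrite (_ : _ + _ = (s * f x - t * g x) ^+ 2) ?sqr_ge0//; ring.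
  - by apply: bounded_measurableB; exact: bounded_measurableZ.
  - exact: bounded_measurableZ.
  - exact: bounded_measurableZ.
  - exact: bounded_measurableZ.
have A0 : 0 <= A by apply: Rintegral_ge0 => x _; exact: sqr_ge0.
have C0 : 0 <= C by apply: Rintegral_ge0 => x _; exact: sqr_ge0.
have [eA|nA] := eqVneq A 0.
  have [eB|nB] := eqVneq B 0; first by rewrite eB expr0n /= mulr_ge0.
  (* If A = 0 and B is not, this choice makes the quadratic form equal to -1. *)
  have := key 1 ((C + 1) / (2 * B)); rewrite eA.
  have -> : 2 * ((C + 1) / (2 * B) * 1) * B = C + 1 by field.
  by move=> ?; lra.
(* With t = A and s = B the form becomes A (A C - B^2). *)
have := key A B; have : 0 < A by rewrite lt_def nA.
move=> Ap h.
have : 0 <= A * (A * C - B ^+ 2) by move: h; congr (_ <= _); ring.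
by rewrite pmulr_rge0// subr_ge0.
Qed.

End bounded_integration.

(** * Fubini's theorem for bounded functions on a product of two sets *)

Section bounded_fubini.
Context d1 d2 (T1 : measurableType d1) (T2 : measurableType d2) {R : realType}.
Variables (m1 : {finite_measure set T1 -> \bar R}) (m2 : {finite_measure set T2 -> \bar R}).
Variables (D1 : set T1) (D2 : set T2).
Hypotheses (mD1 : measurable D1) (mD2 : measurable D2).
Variable G : T1 * T2 -> R.
Hypothesis bG : bounded_measurable (D1 `*` D2) G.

(** Extension by zero, which reduces the statement on D1 x D2 to the whole product space. *)
Let G0 := G \_ (D1 `*` D2).

Let bG0 : bounded_measurable setT G0.
Proof.
have mX := measurableX mD1 mD2.
have [mG [M GM]] := bG; split.
  by apply/(measurable_restrict _ mX measurableT); rewrite setTI.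
exists `|M| => x _; rewrite /G0 patchE; case: ifPn => [xD|_]; last by rewrite normr0.
by apply: le_trans (GM _ _) (ler_norm _); exact: set_mem.
Qed.

Let iG0 : (m1 \x m2)%E.-integrable setT (EFin \o G0).
Proof.
have fin : ((m1 \x m2) (setT `*` setT) < +oo)%E.
  rewrite product_measure1E//; apply: lte_mul_pinfty => //.
  - exact: fin_num_measure.
  - by rewrite -ge0_fin_numE// fin_num_measure.
rewrite setXTT in fin.
have [mG [M GM]] := bG0; apply: measurable_bounded_integrable => //.
exists M; split; rewrite ?num_real// => x Mx t _ /=.
exact: le_trans (GM t I) (ltW Mx).
Qed.

Let Gsection1 x : D1 x -> \int[m2]_y G0 (x, y) = \int[m2]_(y in D2) G (x, y).
Proof.
move=> Dx; rewrite [RHS]Rintegral_mkcond; apply: eq_Rintegral => y _.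
by rewrite /G0 !patchE in_setX mem_set.
Qed.

Let Gsection2 y : D2 y -> \int[m1]_x G0 (x, y) = \int[m1]_(x in D1) G (x, y).
Proof.
move=> Dy; rewrite [RHS]Rintegral_mkcond; apply: eq_Rintegral => x _.
by rewrite /G0 !patchE in_setX (mem_set Dy) andbT.
Qed.

Lemma bounded_measurable_Rintegral2 :
  bounded_measurable D1 (fun x => \int[m2]_(y in D2) G (x, y)).
Proof.
have [mG [M GM]] := bG; split; last first.
  exists (M * fine (m2 D2)) => x Dx; apply: normr_Rintegral_bm => //.
    split; last by exists M => y Dy; apply: GM.
    move=> _ Y mY.
    have mDY : measurable (D1 `*` D2 `&` G @^-1` Y).
      by apply: mG => //; exact: measurableX.
    rewrite (_ : _ `&` _ = xsection (D1 `*` D2 `&` G @^-1` Y) x).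
      exact: measurable_xsection.
    apply/seteqP; split => y /=; rewrite /xsection/= inE/=.
      by move=> [? ?].
    by move=> [[_ ?] ?].
  by move=> y Dy; exact: GM.
apply: (eq_measurable_fun (fun x => \int[m2]_y G0 (x, y))).
  by move=> x xD; rewrite Gsection1//; exact: set_mem.
apply: measurable_funTS.
by apply: measurableT_comp => //; exact: measurable_fubini_F iG0.
Qed.

Lemma Rintegral_fubini :
  \int[m1]_(x in D1) (\int[m2]_(y in D2) G (x, y)) =
  \int[m2]_(y in D2) (\int[m1]_(x in D1) G (x, y)).
Proof.
transitivity (\int[m1]_x \int[m2]_y G0 (x, y)).
  rewrite Rintegral_mkcond; apply: eq_Rintegral => x _; rewrite patchE.
  case: ifPn => xD; first by rewrite Gsection1//; exact: set_mem.
  rewrite (@eq_Rintegral _ _ _ _ _ (fun=> 0)) ?Rintegral_cst ?mul0r// => y _.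
  by rewrite /G0 patchE in_setX (negPf xD).
transitivity (\int[m2]_y \int[m1]_x G0 (x, y)); last first.
  rewrite [RHS]Rintegral_mkcond; apply: eq_Rintegral => y _; rewrite patchE.
  case: ifPn => yD; first by rewrite Gsection2//; exact: set_mem.
  rewrite (@eq_Rintegral _ _ _ _ _ (fun=> 0)) ?Rintegral_cst ?mul0r// => x _.
  by rewrite /G0 patchE in_setX (negPf yD) andbF.
have sec1 x : bounded_measurable setT (fun y => G0 (x, y)).
  have [mG [M GM]] := bG0; split; last by exists M => y _; exact: GM.
  by apply: measurableT_comp => //; exact: measurable_pair1.
have sec2 y : bounded_measurable setT (fun x => G0 (x, y)).
  have [mG [M GM]] := bG0; split; last by exists M => x _; exact: GM.
  by apply: measurableT_comp => //; exact: measurable_pair2.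
rewrite /Rintegral; congr fine.
transitivity (\int[m1]_x (\int[m2]_y (G0 (x, y))%:E))%E.
  apply: eq_integral => x _; rewrite fineK//.
  by apply: integrable_fin_num => //; exact: bounded_measurable_integrable.
rewrite (Fubini iG0); apply: eq_integral => y _; rewrite fineK//.
by apply: integrable_fin_num => //; exact: bounded_measurable_integrable.
Qed.

End bounded_fubini.

(** * The surface measure *)

Section surface.
Context {R : realType}.
Notation la := (@lebesgue_measure R).
Implicit Types (x y z : space3 R).
Notation S2 := (@sphere R).

Lemma dot_ge0 x : 0 <= dot x x.
Proof. by rewrite /dot -!expr2 !addr_ge0// sqr_ge0. Qed.

Lemma enormE x : enorm x ^+ 2 = dot x x.
Proof. by rewrite /enorm sqr_sqrtr// dot_ge0. Qed.

Lemma sphereE x : S2 x <-> dot x x = 1.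
Proof.
rewrite /sphere/=; split=> [e|e]; first by rewrite -enormE e expr1n.
by rewrite /enorm e sqrtr1.
Qed.

Lemma ball3E x : ball3 x <-> dot x x <= 1.
Proof.
by rewrite /ball3/= /enorm -[X in _ <= X](sqrtr1 R) ler_sqrt.
Qed.

Lemma dotC x y : dot x y = dot y x.
Proof. by rewrite /dot; ring. Qed.

Lemma dot_sphere x y : S2 x -> S2 y -> `|dot x y| <= 1.
Proof.
move=> /sphereE; rewrite /dot => hx /sphereE; rewrite /dot => hy.
have a1 := sqr_ge0 (x.1.1 - y.1.1); have a2 := sqr_ge0 (x.1.2 - y.1.2).
have a3 := sqr_ge0 (x.2 - y.2).
have b1 := sqr_ge0 (x.1.1 + y.1.1); have b2 := sqr_ge0 (x.1.2 + y.1.2).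
have b3 := sqr_ge0 (x.2 + y.2).
by rewrite ler_norml; apply/andP; split; lra.
Qed.

Lemma measurable_sphere : measurable S2.
Proof.
have := @measurable_enorm R measurableT _ (measurable_set1 1).
by rewrite setTI.
Qed.

Lemma measurable_dotl x : measurable_fun setT (fun y => dot x y : R).
Proof. exact: (measurable_linear3 x.1.1 x.1.2 x.2). Qed.

Lemma measurable_dot2 :
  measurable_fun setT (fun p : space3 R * space3 R => dot p.1 p.2 : R).
Proof.
have m1 := @measurable_coord11 R; have m2 := @measurable_coord12 R.
have m3 := @measurable_coord2 R.
have p1 (f : space3 R -> R) : measurable_fun setT f ->
    measurable_fun setT (fun p : space3 R * space3 R => f p.1).
  by move=> mf; apply: measurableT_comp => //; exact: measurable_fst.
have p2 (f : space3 R -> R) : measurable_fun setT f ->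
    measurable_fun setT (fun p : space3 R * space3 R => f p.2).
  by move=> mf; apply: measurableT_comp => //; exact: measurable_snd.
apply: (measurable_funD (measurable_funD (measurable_funM (p1 _ m1) (p2 _ m1))
  (measurable_funM (p1 _ m2) (p2 _ m2))) (measurable_funM (p1 _ m3) (p2 _ m3))).
Qed.

Definition box (a : R) : set (space3 R) :=
  (`[- a, a]%classic `*` `[- a, a]%classic) `*` `[- a, a]%classic.

Lemma volume3_prod (A B C : set (measurableTypeR R)) :
  measurable A -> measurable B -> measurable C ->
  volume3 ((A `*` B) `*` C) = (la A * la B * la C)%E.
Proof.
move=> mA mB mC; have mAB := measurableX mA mB.
rewrite /volume3.
rewrite (product_measure1E (la \x la)%E la mAB mC).
by congr (_ * _)%E; exact: (product_measure1E la la mA mB).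
Qed.

Lemma volume3_box (a : R) : 0 < a -> volume3 (box a) = ((2 * a) ^+ 3)%:E.
Proof.
move=> a0; rewrite volume3_prod; [|exact: measurable_itv..].
rewrite lebesgue_measure_itv/= lte_fin.
rewrite (_ : (- a < a) = true); last by lra.
by rewrite -EFinB -!EFinM; congr EFin; ring.
Qed.

Lemma volume3_ball3_fin : (volume3 (@ball3 R) < +oo)%E.
Proof.
apply: (@le_lt_trans _ _ (volume3 (box 1))); last first.
  by rewrite volume3_box// ltry.
apply: le_measure; rewrite ?inE.
- exact: measurable_ball3.
- by do 2?apply: measurableX; exact: measurable_itv.
move=> x /ball3E; rewrite /dot => h; rewrite /box/= !in_itv/=.
have a1 := sqr_ge0 x.1.1; have a2 := sqr_ge0 x.1.2; have a3 := sqr_ge0 x.2.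
by repeat split; apply/andP; split; nra.
Qed.

Lemma volume3_ball3_gt0 : (0 < volume3 (@ball3 R))%E.
Proof.
apply: (@lt_le_trans _ _ (volume3 (box (1 / 2)))).
  by rewrite volume3_box ?lte_fin ?exprn_gt0//; lra.
apply: le_measure; rewrite ?inE.
- by do 2?apply: measurableX; exact: measurable_itv.
- exact: measurable_ball3.
move=> x; rewrite /box/= !in_itv/= => -[[h1 h2] h3]; apply/ball3E; rewrite /dot.
by nra.
Qed.

Lemma volume3_origin : volume3 [set ((0, 0, 0) : space3 R)] = 0%E.
Proof.
rewrite (_ : [set _] = ([set 0] `*` [set 0]) `*` [set 0]); last first.
  apply/seteqP; split => [x -> //|[[a b] c]] /=.
  by move=> [[-> ->] ->].
by rewrite volume3_prod// lebesgue_measure_set1 mule0.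
Qed.

Lemma surfaceE (A : set (space3 R)) : surface A =
  ((fine (volume3 (@ball3 R)))^-1%:E * volume3 (radial @^-1` A `&` ball3))%E.
Proof. by []. Qed.

Lemma surface_fin_setT : (@surface R setT : \bar R) \is a fin_num.
Proof.
rewrite surfaceE preimage_setT setTI fin_numM// ge0_fin_numE//.
exact: volume3_ball3_fin.
Qed.

Lemma surface_fin : fin_num_fun (@surface R).
Proof.
move=> A mA; rewrite ge0_fin_numE//.
apply: (@le_lt_trans _ _ (surface setT)); first by rewrite le_measure ?inE.
by rewrite -ge0_fin_numE// surface_fin_setT.
Qed.

HB.instance Definition _ := Measure_isFinite.Build _ _ _ (@surface R) surface_fin.

Lemma radial_scale x : radial x = scale3 (enorm x)^-1 x.
Proof. by rewrite /radial /scale3 ![(enorm x)^-1 * _]mulrC. Qed.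

Lemma dot_scale3 (a b : R) x y : dot (scale3 a x) (scale3 b y) = a * b * dot x y.
Proof. by rewrite /dot /scale3/=; ring. Qed.

Lemma dot_eq0 x : dot x x = 0 -> x = (0, 0, 0).
Proof.
rewrite /dot => h.
have a1 := sqr_ge0 x.1.1; have a2 := sqr_ge0 x.1.2; have a3 := sqr_ge0 x.2.
by apply: space3_eq => /=; apply/eqP; rewrite -sqrf_eq0 expr2; apply/eqP; lra.
Qed.

Lemma radial_sphere x : x <> (0, 0, 0) -> S2 (radial x).
Proof.
move=> x0; apply/sphereE; rewrite radial_scale dot_scale3 -enormE -expr2.
rewrite exprVn mulVf// sqrf_eq0; apply/eqP => e; apply: x0; apply: dot_eq0.
by rewrite -enormE e expr0n.
Qed.

(** [radial] sends every point of the ball except the origin, a null set, to the sphere. *)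
Lemma surface_sphere : surface S2 = 1%E.
Proof.
rewrite surfaceE (_ : volume3 (_ `&` _) = volume3 ball3); last first.
  apply/eqP; rewrite eq_le; apply/andP; split.
    apply: le_measure; rewrite ?inE; last by move=> ? [].
      apply: measurableI; last exact: measurable_ball3.
      apply: measurable_preimageT; first exact: measurable_radial.
      exact: measurable_sphere.
    exact: measurable_ball3.
  have mI : measurable (radial @^-1` S2 `&` ball3).
    apply: measurableI; last exact: measurable_ball3.
    apply: measurable_preimageT; first exact: measurable_radial.
    exact: measurable_sphere.
  have m0 : measurable [set ((0, 0, 0) : space3 R)].
    rewrite (_ : [set _] = ([set 0] `*` [set 0]) `*` [set 0]).
      by do 2?apply: measurableX.
    apply/seteqP; split => [x -> //|[[a b] c]] /=.
    by move=> [[-> ->] ->].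
  apply: (@le_trans _ _ (volume3 ((radial @^-1` S2 `&` ball3) `|` [set (0, 0, 0)]))).
    apply: le_measure; rewrite ?inE; [exact: measurable_ball3|exact: measurableU|].
    move=> x bx; have [->|x0] := pselect (x = (0, 0, 0)); first by right.
    by left; split => //; exact: radial_sphere.
  apply: le_trans (measureU2 _ _ _) _ => //.
  by rewrite [X in (_ + X)%E]volume3_origin adde0.
rewrite -[X in (_ * X)%E]fineK ?ge0_fin_numE ?volume3_ball3_fin//.
rewrite -EFinM mulVf// gt_eqF// fine_gt0// volume3_ball3_gt0 volume3_ball3_fin.
by [].
Qed.

Lemma rotation_enorm M : rotation M -> forall x, enorm (M x) = enorm x :> R.
Proof. by move=> [_ dM _] x; rewrite /enorm dM. Qed.

Lemma rotation_sphere M : rotation M -> M @^-1` S2 = S2.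
Proof.
move=> rM; apply/seteqP; split => x; rewrite /sphere/= rotation_enorm//.
Qed.

(** A rotation commutes with [radial] and keeps the ball, so the cone over a preimage is the
    preimage of the cone. *)
Lemma surface_rotation M (A : set (space3 R)) : rotation M -> measurable A ->
  surface (M @^-1` A) = surface A.
Proof.
move=> rM mA; have [pM dM sM] := rM; rewrite !surfaceE; congr (_ * _)%E.
have mI : measurable (radial @^-1` A `&` ball3).
  apply: measurableI; last exact: measurable_ball3.
  by apply: measurable_preimageT => //; exact: measurable_radial.
rewrite -(pM.2 _ mI); congr (volume3 _); apply/seteqP; split => x /=.
  by rewrite !radial_scale rotation_enorm// sM /ball3/= rotation_enorm.
by rewrite !radial_scale rotation_enorm// sM /ball3/= rotation_enorm.
Qed.

Lemma Rintegral_rotation M (g : space3 R -> R) : rotation M ->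
  measurable_fun setT g -> bounded_measurable S2 g ->
  \int[surface]_(x in S2) g (M x) = \int[surface]_(x in S2) g x.
Proof.
move=> rM mg bg; rewrite /Rintegral; congr fine.
have mM : measurable_fun setT M by have [[]] := rM.
have h := @integral_pushforward _ _ _ _ R _ mM surface S2 (EFin \o g).
rewrite (rotation_sphere rM) in h.
rewrite -[LHS]h.
- by apply: eq_measure_integral => /= A mA _; rewrite /pushforward; exact: surface_rotation.
- exact/measurable_EFinP.
- apply: bounded_measurable_integrable; first exact: measurable_sphere.
  split; first by apply: measurable_funTS; exact: measurableT_comp.
  have [_ [K gK]] := bg; exists K => x Sx; apply: gK.
  by rewrite -(rotation_sphere rM) in Sx.
- exact: measurable_sphere.
Qed.

Lemma plane_rotation (a b : R) : exists c s : R,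
  [/\ c ^+ 2 + s ^+ 2 = 1, c * a - s * b = 0 & 0 <= s * a + c * b].
Proof.
set r := Num.sqrt (a ^+ 2 + b ^+ 2).
have r2 : r ^+ 2 = a ^+ 2 + b ^+ 2 by rewrite sqr_sqrtr// addr_ge0// sqr_ge0.
have r0 : 0 <= r by exact: sqrtr_ge0.
have [rz|rn] := eqVneq r 0.
  exists 1, 0; have := sqr_ge0 a; have := sqr_ge0 b.
  rewrite rz in r2 => b2 a2.
  have -> : a = 0 by apply/eqP; rewrite -sqrf_eq0; apply/eqP; lra.
  have -> : b = 0 by apply/eqP; rewrite -sqrf_eq0; apply/eqP; lra.
  by split; lra.
exists (b / r), (a / r); split.
- by rewrite !expr_div_n -mulrDl r2 addrC divff// -r2 sqrf_eq0.
- by field.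
- have -> : a / r * a + b / r * b = r.
    by transitivity ((a ^+ 2 + b ^+ 2) / r); [by field|rewrite -r2; field].
  by [].
Qed.

(** Two coordinate rotations bring y to the north pole; a third one about the vertical axis, fixing
    the pole, brings z into the plane where the second coordinate is 0. *)
Lemma rotation_pair y z : S2 y -> S2 z -> exists M (s : R),
  [/\ rotation M, M y = (0, 0, 1), M z = (s, 0, dot y z) &
      s ^+ 2 + dot y z ^+ 2 = 1].
Proof.
move=> Sy Sz.
have [c1 [s1 [u1 e1 p1]]] := plane_rotation y.1.2 y.2.
set A := rot23 c1 s1; have rA : rotation A by exact: rotation_rot23.
have [c2 [s2 [u2 e2 p2]]] := plane_rotation (A y).1.1 (A y).2.
set B := rot13 c2 s2; have rB : rotation B by exact: rotation_rot13.
set w := B (A z).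
(* The coordinates are swapped because the second one is to be cancelled; this is why [C] uses -
   s3. *)
have [c3 [s3 [u3 e3 p3]]] := plane_rotation w.1.2 w.1.1.
have u3' : c3 ^+ 2 + (- s3) ^+ 2 = 1 by rewrite sqrrN.
set C := rot12 c3 (- s3); have rC : rotation C by exact: rotation_rot12.
have rBA := rotation_comp rB rA; have rM := rotation_comp rC rBA.
have yE : B (A y) = (0, 0, 1).
  have d : dot (B (A y)) (B (A y)) = 1.
    by have [_ dB _] := rBA; rewrite (dB y y); exact/sphereE.
  have x1 : (B (A y)).1.1 = 0 by [].
  have x2 : (B (A y)).1.2 = 0 by [].
  have x3 : 0 <= (B (A y)).2 by [].
  apply: space3_eq => //; move: d; rewrite /dot x1 x2 => d.
  by move: x3 d; set t := (B (A y)).2 => t0 d; rewrite /=; nra.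
have yE' : C (B (A y)) = (0, 0, 1).
  by rewrite yE /C /rot12; apply: space3_eq => /=; ring.
have d13 : dot (C (B (A y))) (C w) = dot y z by have [_ dM _] := rM; exact: (dM y z).
have d33 : dot (C w) (C w) = 1.
  by have [_ dM _] := rM; rewrite (dM z z); exact/sphereE.
have CE v : (C v).1.2 = c3 * v.1.2 - s3 * v.1.1 by rewrite /C /rot12/=; ring.
have w2 : (C w).1.2 = 0 by rewrite CE.
have w3 : (C w).2 = dot y z by rewrite -d13 yE' /dot/=; ring.
exists (C \o (B \o A)), (C w).1.1; split => //.
  exact: space3_eq.
have := d33; rewrite {1}/dot w2 w3; move: (C w).1.1 => t <-; ring.
Qed.

End surface.

(** * Archimedes' formula for the area of a cap *)

Section archimedes.
Context {R : realType}.
Notation la := (@lebesgue_measure R).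
Notation T := (measurableTypeR R).
Notation S2 := (@sphere R).
Implicit Types (x y : space3 R) (p q : {poly R}).

Lemma integral_horner p q (a b : R) : q^`() = p -> a < b ->
  (\int[la]_(x in `[a, b]) (p.[x])%:E = (q.[b] - q.[a])%:E)%E.
Proof.
move=> qp ab; rewrite EFinB; apply: continuous_FTC2 => //.
- exact/continuous_subspaceT/continuous_horner.
- split.
  + by move=> x _; exact: derivable_horner.
  + by apply: cvg_at_right_filter; exact: continuous_horner.
  + by apply: cvg_at_left_filter; exact: continuous_horner.
- by move=> x _; rewrite -qp derivE.
Qed.

Lemma lebesgue_measure_homothety (r : R) (A : set T) : 0 < r -> measurable A ->
  la ((fun x : T => r * x : T) @^-1` A) = (r^-1%:E * la A)%E.
Proof.
move=> r0 mA.
have mr : measurable_fun setT (fun x : T => (r * x : T)) by exact: measurable_funM.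
pose m1 := measure_function_pushforward__canonical__measure_function_Measure la mr.
pose m2 := mscale (NngNum (ltW r0)) m1.
have e : la A = m2 A.
  apply: lebesgue_measure_unique mA => _ [[a b] _ <-] /=.
  rewrite /mscale/= /pushforward.
  rewrite (_ : _ @^-1` _ = `]a / r, b / r]%classic).
    rewrite !lebesgue_measure_itv/= !lte_fin ltr_pM2r ?invr_gt0//.
    by case: ifP => _; rewrite ?mule0// -EFinB -EFinM; congr EFin; field; rewrite gt_eqF.
  apply/seteqP; split => x /=; rewrite !in_itv/= ltr_pdivrMr// ler_pdivlMr//;
  by rewrite [r * x]mulrC.
rewrite e /m2 /mscale/= muleA -EFinM mulVf ?mul1e// gt_eqF//.
Qed.

Lemma area_homothety (r : R) (A : set (T * T)) : 0 < r -> measurable A ->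
  area ((fun p : T * T => (r * p.1, r * p.2) : T * T) @^-1` A) =
  ((r^-1 ^+ 2)%:E * area A)%E.
Proof.
move=> r0 mA.
have m1 : measurable_fun setT (fun p : T * T => (r * p.1 : R)).
  by apply: measurable_funM => //; exact: measurable_fst.
have m2 : measurable_fun setT (fun p : T * T => (r * p.2 : R)).
  by apply: measurable_funM => //; exact: measurable_snd.
have mf : measurable_fun setT (fun p : T * T => (p.1, r * p.2) : T * T).
  by apply: measurable_fun_pair => //; exact: measurable_fst.
have mg : measurable_fun setT (fun p : T * T => (r * p.1, p.2) : T * T).
  by apply: measurable_fun_pair => //; exact: measurable_snd.
pose f (p : T * T) : T * T := (p.1, r * p.2).
pose g (p : T * T) : T * T := (r * p.1, p.2).
have ri : 0 <= r^-1 by rewrite invr_ge0 ltW.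
have sf (B : set (T * T)) : measurable B -> area (f @^-1` B) = (r^-1%:E * area B)%E.
  move=> mB; rewrite /area /product_measure1 -ge0_integralZl_EFin//; last first.
    exact: measurable_fun_xsection.
  apply: eq_integral => x _ /=.
  rewrite -(lebesgue_measure_homothety r0); last exact: measurable_xsection.
  by congr (la _); apply/seteqP; split => y /=; rewrite /xsection/= !inE/=.
have sg (B : set (T * T)) : measurable B -> area (g @^-1` B) = (r^-1%:E * area B)%E.
  move=> mB; have mgB : measurable (g @^-1` B) by exact: measurable_preimageT.
  have := @product_measure12 _ _ _ _ R la la _ mB.
  have := @product_measure12 _ _ _ _ R la la _ mgB.
  rewrite /area => -> ->.
  rewrite /product_measure2 -ge0_integralZl_EFin//; last first.
    exact: measurable_fun_ysection.
  apply: eq_integral => y _ /=.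
  rewrite -(lebesgue_measure_homothety r0); last exact: measurable_ysection.
  by congr (la _); apply/seteqP; split => x /=; rewrite /ysection/= !inE/=.
have mfA : measurable (f @^-1` A) by exact: measurable_preimageT.
rewrite (_ : _ @^-1` A = g @^-1` (f @^-1` A))// sg// sf// muleA -EFinM.
by rewrite expr2.
Qed.

(** The parameter is the squared radius: the area is linear in it, and horizontal slices of balls
    and cones need no square roots. *)
Definition disc (rho : R) : set (T * T) := [set p | p.1 ^+ 2 + p.2 ^+ 2 <= rho].

Lemma measurable_disc rho : measurable (disc rho).
Proof.
have m : measurable_fun setT (fun p : T * T => (p.1 ^+ 2 + p.2 ^+ 2 : R)).
  apply: measurable_funD; apply: measurable_funX; first exact: measurable_fst.
  exact: measurable_snd.
by have := m measurableT _ (measurable_itv `]-oo, rho]); rewrite setTI.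
Qed.

(* Equal to pi, but the value is irrelevant: it cancels in [surface]. *)
Definition disc_const : R := fine (area (disc 1)).

Lemma area_disc1 : area (disc 1) = disc_const%:E.
Proof.
rewrite fineK// ge0_fin_numE//.
have mI : measurable `[-1, (1 : R)]%classic by exact: measurable_itv.
apply: (@le_lt_trans _ _ (area (`[-1, 1]%classic `*` `[-1, 1]%classic))).
  apply: le_measure; rewrite ?inE; [exact: measurable_disc|exact: measurableX|].
  by move=> p; rewrite /disc/= !in_itv/= => h; split; apply/andP; split; nra.
have laI : (la `[(-1)%R, 1%R] < +oo)%E.
  by rewrite lebesgue_measure_itv/=; case: ifP => _; rewrite -?EFinB ltry.
by rewrite /area product_measure1E//; apply: lte_mul_pinfty; rewrite ?ge0_fin_numE.
Qed.

Lemma area_disc rho : 0 <= rho -> area (disc rho) = (disc_const * rho)%:E.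
Proof.
have pos (t : R) : 0 < t -> area (disc t) = (disc_const * t)%:E.
  move=> t0; set r := (Num.sqrt t)^-1.
  have r0 : 0 < r by rewrite invr_gt0 sqrtr_gt0.
  have rt : r ^+ 2 = t^-1 by rewrite /r exprVn sqr_sqrtr// ltW.
  rewrite (_ : disc t = (fun p : T * T => (r * p.1, r * p.2) : T * T) @^-1` (disc 1)).
    rewrite area_homothety//; last exact: measurable_disc.
    by rewrite area_disc1 -EFinM exprVn rt invrK mulrC.
  apply/seteqP; split => p; rewrite /disc/= !exprMn -mulrDr rt mulrC ler_pdivrMr// mul1r.
    by [].
  by [].
rewrite le_eqVlt => /predU1P[<-|/pos//]; rewrite mulr0.
apply/eqP; rewrite eq_le measure_ge0 andbT.
apply/lee_addgt0Pr => e e0; rewrite add0e.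
have k0 : 0 <= disc_const by rewrite fine_ge0.
have k1 : 0 < disc_const + 1 by lra.
(* At this point [disc_const] is only known to be nonnegative; the added 1 makes the quotient
   safe. *)
apply: (@le_trans _ _ (area (disc (e / (disc_const + 1))))).
  apply: le_measure; rewrite ?inE; [exact: measurable_disc..|].
  by move=> p /= h; apply: le_trans h _; rewrite divr_ge0// ltW.
rewrite pos ?divr_gt0// lee_fin mulrA ler_pdivrMr//; nra.
Qed.

Lemma disc0 rho : rho < 0 -> disc rho = set0.
Proof.
move=> r0; apply/seteqP; split => // p; rewrite /disc/=.
by rewrite leNgt (lt_le_trans r0)// addr_ge0// sqr_ge0.
Qed.

Lemma volume3_slices (A : set (space3 R)) : measurable A ->
  volume3 A = (\int[la]_z area (ysection A z))%E.
Proof. exact: (@product_measure12 _ _ _ _ R area la A). Qed.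

Lemma volume3_ball3E : volume3 (@ball3 R) = (disc_const * (4 / 3))%:E.
Proof.
rewrite volume3_slices; last exact: measurable_ball3.
have sec z : ysection (@ball3 R) z = disc (1 - z ^+ 2).
  apply/seteqP; split => p; rewrite /ysection/= inE/=.
    by move/ball3E; rewrite /dot/= /disc/= => ?; lra.
  by rewrite /disc/= => h; apply/ball3E; rewrite /dot/=; lra.
transitivity (\int[la]_(z in `[(-1)%R, 1%R]) (disc_const%:P * (1 - 'X^2)).[z]%:E)%E.
  rewrite [RHS]integral_mkcond; apply: eq_integral => z _.
  rewrite sec patchE mem_setE in_itv/=; case: ifPn => h.
    by rewrite area_disc; [rewrite !hornerE|move/andP: h => [h1 h2]; nra].
  rewrite disc0 ?measure0//; move: h; rewrite negb_and -!ltNge => /orP[]; nra.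
rewrite (@integral_horner _ (disc_const%:P * ('X - 3^-1 *: 'X^3)))//; last first.
  rewrite derivM derivC mul0r add0r derivB derivX derivZ derivXn/=.
  by rewrite -['X^2 *+ 3]scaler_nat scalerA mulVf ?scale1r ?pnatr_eq0.
by rewrite !(hornerM, hornerD, hornerN, hornerC, hornerZ, hornerXn, hornerX); congr EFin; field.
Qed.

Lemma measurable_upper_cap (c : R) : measurable (S2 `&` [set x : space3 R | c <= x.2]).
Proof.
apply: measurableI; first exact: measurable_sphere.
have := @measurable_coord2 R measurableT _ (measurable_itv `[c, +oo[).
rewrite setTI; congr measurable; apply/seteqP; split => x /=; rewrite in_itv/= ?andbT//.
Qed.

(** At height z the ball bounds the squared radius by 1 - z^2, and the cone condition c |x| <= z
    bounds it by z^2 (c^(-2) - 1). *)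
Lemma sector_slice (c z : R) : 0 < c ->
  ysection (radial @^-1` (S2 `&` [set x : space3 R | c <= x.2]) `&` ball3) z =
  if 0 < z then disc (Num.min (1 - z ^+ 2) (z ^+ 2 * (c ^- 2 - 1))) else set0.
Proof.
move=> c0; apply/seteqP; split => p.
  rewrite /ysection/= inE/= => -[[Sx cx]].
  have [z0|z0] := ltP 0 z; last first.
    move: cx; rewrite leNgt (le_lt_trans _ c0)//.
    by rewrite mulr_le0_ge0// invr_ge0 sqrtr_ge0.
  move=> /ball3E; rewrite /dot/= => h.
  have d0 : 0 < dot (p, z) (p, z) by rewrite /dot/=; nra.
  have e0 : 0 < enorm (p, z) by rewrite /enorm sqrtr_gt0.
  move: cx; rewrite ler_pdivlMr// => cx.
  have : (c * enorm (p, z)) ^+ 2 <= z ^+ 2.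
    by rewrite ler_sqr// nnegrE; [rewrite mulr_ge0// ltW|exact: ltW].
  rewrite exprMn enormE /dot/= -ler_pdivlMl ?exprn_gt0// => h2.
  by rewrite /disc/= le_min; apply/andP; split; lra.
case: ifPn => // z0; rewrite /disc/= le_min => /andP[h1 h2].
rewrite /ysection/= inE/=.
have d0 : 0 < dot (p, z) (p, z) by rewrite /dot/=; nra.
have e0 : 0 < enorm (p, z) by rewrite /enorm sqrtr_gt0.
split; last by apply/ball3E; rewrite /dot/=; lra.
split.
  apply: radial_sphere => pz; move: d0; rewrite pz /dot/=; lra.
rewrite /= ler_pdivlMr// -ler_sqr ?nnegrE; [|by rewrite mulr_ge0// ltW|exact: ltW].
rewrite exprMn enormE /dot/= -ler_pdivlMl ?exprn_gt0//; lra.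
Qed.

(** The sector is a solid cone up to height c and a segment of the ball above it: the two bounds of
    [sector_slice] cross at z = c. Summing both integrals leaves a multiple of 1 - c, and
    [disc_const] cancels against the volume of the ball. *)
Lemma surface_upper_cap_pos (c : R) : 0 < c <= 1 ->
  surface (S2 `&` [set x : space3 R | c <= x.2]) = ((1 - c) / 2)%:E.
Proof.
move=> /andP[c0 c1].
have k0 : 0 < disc_const.
  have := volume3_ball3_gt0 (R := R); rewrite volume3_ball3E lte_fin; lra.
rewrite surfaceE volume3_ball3E/= volume3_slices; last first.
  apply: measurableI; last exact: measurable_ball3.
  apply: measurable_preimageT; first exact: measurable_radial.
  exact: measurable_upper_cap.
set t := c ^- 2 - 1.
have t0 : 0 <= t by rewrite subr_ge0 invr_ge1 ?unitfE ?exprn_gt0// ?gt_eqF ?exprn_gt0// exprn_ile1// ltW.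
have ct : c ^+ 2 * t = 1 - c ^+ 2 by rewrite /t mulrBr mulr1 divff// gt_eqF// exprn_gt0.
pose g z := disc_const * Num.min (1 - z ^+ 2) (z ^+ 2 * t).
set Sec := (_ @^-1` _ `&` _).
have -> : (\int[la]_z area (ysection Sec z) = \int[la]_(z in `]0%R, 1%R]) (g z)%:E)%E.
  rewrite [RHS]integral_mkcond; apply: eq_integral => z _.
  rewrite sector_slice// patchE mem_setE in_itv/=; case: ifPn => //= z0; last first.
    by rewrite measure0.
  case: ifPn => z1.
    by rewrite area_disc -/t// le_min; apply/andP; split; nra.
  by rewrite disc0 ?measure0// gt_min; apply/orP; left; nra.
have I1 : (\int[la]_(z in `]0%R, c]) (g z)%:E = (disc_const * (t * c ^+ 3 / 3))%:E)%E.
  transitivity (\int[la]_(z in `]0%R, c]) ((disc_const * t)%:P * 'X^2).[z]%:E)%E.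
    apply: eq_integral => z; rewrite inE/= in_itv/= => /andP[z0 zc].
    rewrite /g min_r; first by rewrite hornerM hornerC hornerXn [z ^+ 2 * t]mulrC mulrA.
    have h : z ^+ 2 <= c ^+ 2 by nra.
    have t1 : 0 <= t + 1 by lra.
    by have := ler_wpM2r t1 h; lra.
  rewrite integral_itv_obnd_cbnd; last first.
    by apply/measurable_EFinP; apply: measurable_funTS; apply: continuous_measurable_fun; exact: continuous_horner.
  rewrite (@integral_horner _ ((disc_const * t)%:P * (3^-1 *: 'X^3)))//; last first.
    rewrite derivM derivC mul0r add0r derivZ derivXn/=.
    by rewrite -['X^2 *+ 3]scaler_nat scalerA mulVf ?scale1r ?pnatr_eq0.
  by rewrite !(hornerM, hornerD, hornerN, hornerC, hornerZ, hornerXn, hornerX); congr EFin; field.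
have I2 : (\int[la]_(z in `]c, 1%R]) (g z)%:E = (disc_const * (1 - 3^-1 - c + c ^+ 3 / 3))%:E)%E.
  transitivity (\int[la]_(z in `]c, 1%R]) (disc_const%:P * (1 - 'X^2)).[z]%:E)%E.
    apply: eq_integral => z; rewrite inE/= in_itv/= => /andP[z0 zc].
    rewrite /g min_l; first by rewrite !hornerE.
    have h : c ^+ 2 <= z ^+ 2 by nra.
    have t1 : 0 <= t + 1 by lra.
    by have := ler_wpM2r t1 h; lra.
  have [c1'|c1'] := ltP c 1; last first.
    have -> : c = 1 by lra.
    rewrite set_itv_ge ?bnd_simp ?ltxx// integral_set0; congr EFin; lra.
  rewrite integral_itv_obnd_cbnd; last first.
    by apply/measurable_EFinP; apply: measurable_funTS; apply: continuous_measurable_fun; exact: continuous_horner.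
  rewrite (@integral_horner _ (disc_const%:P * ('X - 3^-1 *: 'X^3)))//; last first.
    rewrite derivM derivC mul0r add0r derivB derivX derivZ derivXn/=.
    by rewrite -['X^2 *+ 3]scaler_nat scalerA mulVf ?scale1r ?pnatr_eq0.
  by rewrite !(hornerM, hornerD, hornerN, hornerC, hornerZ, hornerXn, hornerX); congr EFin; field.
rewrite (@itv_bndbnd_setU _ _ _ (BRight c)); last 2 first.
- by rewrite bnd_simp ltW.
- by rewrite bnd_simp.
rewrite ge0_integral_setU//=; last 3 first.
- apply/measurable_EFinP; apply: measurable_funTS; apply: measurable_funM => //.
  by apply: measurable_minr; [apply: measurable_funB|apply: measurable_funM] => //; exact: measurable_funX.
- move=> z; rewrite !in_itv/= => zz.
  have [z0 z1] : 0 < z /\ z <= 1 by case: zz => /andP[? ?]; split; lra.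
  rewrite lee_fin /g; apply: mulr_ge0; first exact: ltW.
  by rewrite le_min; apply/andP; split; nra.
- by apply/disj_setPS => z [/=]; rewrite !in_itv/=; lra.
rewrite I1 I2 -EFinD -EFinM; congr EFin.
have -> : t * c ^+ 3 = c * (1 - c ^+ 2) by rewrite -ct; ring.
by field; rewrite gt_eqF.
Qed.

(** For c <= 0 the complement of the cap is carried by a half turn onto the open cap [G] above
    height - c. Its measure is squeezed between those of closed caps, so the bounding circle is
    never measured. *)
Lemma surface_upper_cap (c : R) : -1 <= c <= 1 ->
  surface (S2 `&` [set x : space3 R | c <= x.2]) = ((1 - c) / 2)%:E.
Proof.
move=> /andP[c1 c2]; have [c0|c0] := ltP 0 c.
  by apply: surface_upper_cap_pos; rewrite c0.
pose F (c : R) := S2 `&` [set x : space3 R | c <= x.2].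
pose G := S2 `&` [set x : space3 R | - c < x.2].
have mF d : measurable (F d) by exact: measurable_upper_cap.
have mG : measurable G.
  apply: measurableI; first exact: measurable_sphere.
  have := @measurable_coord2 R measurableT _ (measurable_itv `]- c, +oo[).
  rewrite setTI; congr measurable; apply/seteqP; split => x /=; rewrite in_itv/= ?andbT//.
have rM : rotation (rot23 (-1) (0 : R)) by apply: rotation_rot23; ring.
have GE : S2 `\` F c = rot23 (-1) 0 @^-1` G.
  apply/seteqP; split => x.
    move=> [Sx nF]; split; first by rewrite -(rotation_sphere rM) in Sx.
    rewrite /= mul0r mulN1r add0r ltrN2 ltNge; apply/negP => h.
    by apply: nF.
  move=> [Sx h]; have Sx' : S2 x by rewrite -(rotation_sphere rM).
  split => // -[_ /=]; move: h => /=; lra.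
have eG : surface (F c) = (1 - surface G)%E.
  have sD : surface (S2 `\` F c) = (1 - surface (F c))%E.
    apply: etrans (measureD measurable_sphere (mF c) _) _.
      by rewrite [X in (X < _)%E]surface_sphere ltry.
    congr (_ - _)%E; first exact: surface_sphere.
    by congr (surface _); apply/setIidPr => ? [].
  rewrite GE (surface_rotation rM mG) in sD; rewrite sD.
  have : surface (F c) \is a fin_num by exact: fin_num_measure.
  case: (surface (F c)) => // r _.
  by rewrite -!EFinB; congr EFin; lra.
(* Closed caps at heights d slightly above - c lie inside [G]; letting d tend to - c gives [low]. *)
have up (d : R) : 0 < d <= 1 -> - c < d -> (((1 - d) / 2)%:E <= surface G)%E.
  move=> d1 cd; rewrite -surface_upper_cap_pos//; apply: le_measure; rewrite ?inE//.
    exact: mF.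
  by move=> x [Sx h]; split => //; exact: lt_le_trans cd h.
have Gfin : surface G \is a fin_num by exact: fin_num_measure.
set gamma := fine (surface G); have gE : surface G = gamma%:E by rewrite fineK.
have low : (1 + c) / 2 <= gamma.
  apply/ler_addgt0Pr => e e0.
  have [ce|ce] := leP (- c + e) 1.
    have := up (- c + e); rewrite gE lee_fin => /(_ _ _) h.
    have : (1 - (- c + e)) / 2 <= gamma by apply: h; lra.
    lra.
  have g0 : 0 <= gamma by rewrite fine_ge0.
  lra.
have high : gamma <= (1 + c) / 2.
  (* At c = 0 the closed cap at height - c escapes the positive case; there [G] lies in [F c], whose
     measure is 1 minus that of [G]. *)
  have [cz|cn] := eqVneq c 0.
    have : (surface G <= surface (F c))%E.
      by apply: le_measure; rewrite ?inE//; move=> x [Sx h]; split => //=; move: h; rewrite cz /=; lra.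
    rewrite eG gE -EFinB lee_fin cz; lra.
  have : (surface G <= surface (F (- c)%R))%E.
    by apply: le_measure; rewrite ?inE//; move=> x [Sx h]; split => //=; exact: ltW.
  rewrite surface_upper_cap_pos; last by apply/andP; split; [rewrite oppr_gt0 lt_neqAle cn|lra].
  rewrite gE lee_fin; lra.
rewrite -/(F c) eG gE -EFinB; congr EFin; lra.
Qed.

End archimedes.

(** * Zonal kernels and the Funk-Hecke formula *)

Section zonal_kernels.
Context {R : realType}.
Notation S2 := (@sphere R).
Implicit Types (x y w : space3 R) (f g : space3 R -> R) (p q r s : {poly R}) (k : R -> R).

Local Notation mS := (@measurable_sphere R).
Local Notation "'\oint_' w f" := (\int[surface]_(w in @sphere R) f)
  (at level 36, w at level 0, f at level 36).
Local Notation bm := (bounded_measurable S2).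

Let fs : {finite_measure set (space3 R) -> \bar R} := surface.

Lemma sphere_integrable f : bm f -> surface.-integrable S2 (EFin \o f).
Proof. exact: (bounded_measurable_integrable fs mS). Qed.

Lemma sphere_intD f g : bm f -> bm g ->
  \oint_w (f w + g w) = \oint_w (f w) + \oint_w (g w).
Proof. exact: (Rintegral_bmD fs mS). Qed.

Lemma sphere_intB f g : bm f -> bm g ->
  \oint_w (f w - g w) = \oint_w (f w) - \oint_w (g w).
Proof. exact: (Rintegral_bmB fs mS). Qed.

Lemma sphere_intZ (c : R) f : bm f -> \oint_w (c * f w) = c * \oint_w (f w).
Proof. exact: (Rintegral_bmZ fs mS). Qed.

Lemma sphere_int_sum (K : Type) (r : seq K) (P : pred K) (F : K -> space3 R -> R) :
  (forall j, P j -> bm (F j)) ->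
  \oint_w (\sum_(j <- r | P j) F j w) = \sum_(j <- r | P j) \oint_w (F j w).
Proof. exact: (Rintegral_bm_sum fs mS). Qed.

Lemma sphere_int_le f g : bm f -> bm g -> (forall x, S2 x -> f x <= g x) ->
  \oint_w (f w) <= \oint_w (g w).
Proof. exact: (le_Rintegral_bm fs mS). Qed.

Lemma sphere_cauchy_schwarz f g : bm f -> bm g ->
  (\oint_w (f w * g w)) ^+ 2 <= (\oint_w (f w ^+ 2)) * (\oint_w (g w ^+ 2)).
Proof. exact: (cauchy_schwarz_Rintegral fs mS). Qed.

Lemma sphere_fubini (G : space3 R * space3 R -> R) :
  bounded_measurable (S2 `*` S2) G ->
  \oint_x (\oint_y (G (x, y))) = \oint_y (\oint_x (G (x, y))).
Proof. exact: (Rintegral_fubini fs fs mS mS). Qed.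

Lemma sphere_fubini_bm (G : space3 R * space3 R -> R) :
  bounded_measurable (S2 `*` S2) G -> bm (fun x => \oint_y (G (x, y))).
Proof. exact: (bounded_measurable_Rintegral2 fs fs mS mS). Qed.

(** The bound is asked only on [-1, 1], the range of inner products on the sphere, so that
    polynomials qualify. *)
Definition zonal_kernel k := measurable_fun setT k /\
  exists M, forall t, -1 <= t <= 1 -> `|k t| <= M.

Lemma horner_bound p (t : R) : `|t| <= 1 -> `|p.[t]| <= \sum_(i < size p) `|p`_i|.
Proof.
move=> t1; rewrite horner_coef; apply: le_trans (ler_norm_sum _ _ _) _.
apply: ler_sum => i _; rewrite normrM normrX ler_piMr// exprn_ile1//.
Qed.

Lemma measurable_horner p : measurable_fun setT (fun t : R => p.[t]).
Proof. by apply: continuous_measurable_fun; exact: continuous_horner. Qed.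

Lemma kernel_horner p : zonal_kernel (horner p).
Proof.
split; first exact: measurable_horner.
exists (\sum_(i < size p) `|p`_i|) => t; rewrite -ler_norml => t1.
exact: horner_bound.
Qed.

Lemma kernelM k1 k2 : zonal_kernel k1 -> zonal_kernel k2 -> zonal_kernel (fun t => k1 t * k2 t).
Proof.
move=> [m1 [M1 b1]] [m2 [M2 b2]]; split; first exact: measurable_funM.
by exists (M1 * M2) => t t1; rewrite normrM ler_pM ?b1 ?b2.
Qed.

Definition upper (c t : R) : R := (c <= t)%R%:R.

Lemma kernel_upper c : zonal_kernel (upper c).
Proof.
have m : measurable_fun setT (upper c).
  rewrite (_ : upper c = \1_(`[c, +oo[%classic)); first exact: measurable_indic.
  by apply/funext => t; rewrite /upper indicE mem_setE in_itv/= andbT.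
split => //.
by exists 1 => t _; rewrite /upper; case: (c <= t); rewrite ?normr0 ?normr1.
Qed.

Lemma bm_kernel k x : zonal_kernel k -> S2 x -> bm (fun w => k (dot w x)).
Proof.
move=> [mk [M kM]] Sx; split.
  apply: measurable_funTS; apply: measurableT_comp => //.
  rewrite (_ : (fun w => _) = (fun w => dot x w)); first exact: measurable_dotl.
  by apply/funext => w; rewrite dotC.
exists M => w Sw; apply: kM; rewrite -ler_norml; exact: dot_sphere.
Qed.

Lemma measurable_kernel k x : zonal_kernel k -> measurable_fun setT (fun w => k (dot w x)).
Proof.
move=> [mk _]; apply: measurableT_comp => //.
rewrite (_ : (fun w => _) = (fun w => dot x w)); first exact: measurable_dotl.
by apply/funext => w; rewrite dotC.
Qed.

Lemma bm_kernel2 k : zonal_kernel k ->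
  bounded_measurable (S2 `*` S2) (fun z : space3 R * space3 R => k (dot z.1 z.2)).
Proof.
move=> [mk [M kM]]; split.
  apply: measurable_funTS; apply: measurableT_comp => //; exact: measurable_dot2.
by exists M => -[x y] [Sx Sy]; apply: kM; rewrite -ler_norml; exact: dot_sphere.
Qed.

Definition e3 : space3 R := (0, 0, 1).

Lemma sphere_e3 : S2 e3.
Proof. by apply/sphereE; rewrite /dot/=; ring. Qed.

Lemma dot_e3 w : dot w e3 = w.2.
Proof. by rewrite /dot/=; ring. Qed.

Lemma zonal_invariance k1 k2 M x y : zonal_kernel k1 -> zonal_kernel k2 -> rotation M ->
  S2 x -> S2 y ->
  \oint_w (k1 (dot w x) * k2 (dot w y)) = \oint_w (k1 (dot w (M x)) * k2 (dot w (M y))).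
Proof.
move=> h1 h2 rM Sx Sy; have [_ dM _] := rM.
have SM z : S2 z -> S2 (M z) by move=> Sz; rewrite -(rotation_sphere rM) in Sz.
rewrite -[RHS](Rintegral_rotation rM); last 2 first.
- by apply: measurable_funM; exact: measurable_kernel.
- by apply: bounded_measurableM; apply: bm_kernel => //; exact: SM.
by apply: eq_Rintegral => w _; rewrite !dM.
Qed.

Definition zonal_mean k := \oint_w k (w.2).

Lemma zonal_meanE k x : zonal_kernel k -> S2 x -> \oint_w k (dot w x) = zonal_mean k.
Proof.
move=> hk Sx; have [M [s [rM Mx _ _]]] := rotation_pair Sx Sx.
(* The constant kernel 1 occupies the second slot of [zonal_invariance]. *)
have h1 := kernel_horner 1.
have := zonal_invariance hk h1 rM Sx Sx; rewrite Mx => h.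
transitivity (\oint_w (k (dot w x) * (1 : {poly R}).[dot w x])).
  by apply: eq_Rintegral => w _; rewrite hornerE mulr1.
rewrite h; apply: eq_Rintegral => w _; rewrite hornerE mulr1.
by rewrite -/e3 dot_e3.
Qed.

Lemma kernel_e3 k : zonal_kernel k -> bm (fun w => k w.2).
Proof.
move=> hk; have := bm_kernel hk sphere_e3; congr bounded_measurable.
by apply/funext => w; rewrite dot_e3.
Qed.

Lemma sphere_coord2 w : S2 w -> `|w.2| <= 1.
Proof. by move=> Sw; rewrite -dot_e3; apply: dot_sphere => //; exact: sphere_e3. Qed.

(** Archimedes' theorem as a statement on the law of the height: it is uniform on [-1, 1]. *)
Lemma zonal_mean_upper c : -1 <= c <= 1 -> zonal_mean (upper c) = (1 - c) / 2.
Proof.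
move=> hc; rewrite /zonal_mean /Rintegral.
transitivity (fine (\int[surface]_(w in S2) (\1_[set x : space3 R | c <= x.2] w)%:E)).
  by congr fine; apply: eq_integral => w _; rewrite /upper indicE mem_setE.
rewrite integral_indic; [|exact: mS|].
  by rewrite setIC; exact: (congr1 fine (surface_upper_cap hc)).
have := @measurable_coord2 R measurableT _ (measurable_itv `[c, +oo[).
rewrite setTI; congr measurable; apply/seteqP; split => x /=; rewrite in_itv/= ?andbT//.
Qed.

(** Over n equal pieces the increments add up to at most L (b - a)^2 / n, which tends to 0. *)
Lemma quadratic_increment_constant (D : R -> R) (a b L : R) : a <= b ->
  (forall x y : R, a <= x -> x <= y -> y <= b -> `|D y - D x| <= L * (y - x) ^+ 2) ->
  D a = D b.
Proof.
move=> ab h; apply/eqP; rewrite eq_sym -subr_eq0 -normr_eq0 eq_le normr_ge0 andbT.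
have key n : (0 < n)%N -> `|D b - D a| <= L * (b - a) ^+ 2 / n%:R.
  move=> n0; have nr : 0 < n%:R :> R by rewrite ltr0n.
  pose t i := a + (b - a) * (i%:R / n%:R).
  have -> : D b - D a = \sum_(0 <= i < n) (D (t i.+1) - D (t i)).
    have tn : t n = b by rewrite /t divff ?gt_eqF// mulr1 addrC subrK.
    have t0 : t 0%N = a by rewrite /t mul0r mulr0 addr0.
    by rewrite telescope_sumr// tn t0.
  apply: le_trans (ler_norm_sum _ _ _) _.
  have -> : L * (b - a) ^+ 2 / n%:R = \sum_(0 <= i < n) (L * ((b - a) / n%:R) ^+ 2).
    by rewrite sumr_const_nat subn0 -mulr_natr; field; rewrite gt_eqF.
  rewrite !big_nat; apply: ler_sum => i /= iN.
  have -> : (b - a) / n%:R = t i.+1 - t i.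
    by rewrite /t -(natr1 i); field; rewrite gt_eqF.
  have ba : 0 <= b - a by rewrite subr_ge0.
  apply: h; rewrite /t.
  - by rewrite lerDl mulr_ge0// divr_ge0// ltW.
  - by rewrite lerD2l ler_wpM2l// ler_pM2r ?invr_gt0// ler_nat.
  - rewrite -lerBrDl ler_piMr// ler_pdivrMr// mul1r ler_nat//.
apply/ler_addgt0Pr => e e0; rewrite add0r.
set C := L * (b - a) ^+ 2 in key.
have [n nC] : exists n : nat, (0 < n)%N /\ `|C| / e <= n%:R.
  exists (Num.truncn (`|C| / e)).+1; split => //; exact/ltW/truncnS_gt.
apply: le_trans (key n nC.1) _.
rewrite ler_pdivrMr ?ltr0n ?nC.1//.
by have := nC.2; rewrite ler_pdivrMr// => h2; have := ler_norm C; lra.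
Qed.

Lemma horner_lipschitz p : exists2 L, 0 <= L & forall x y : R, -1 <= x -> x <= y -> y <= 1 ->
  `|p.[y] - p.[x]| <= L * (y - x).
Proof.
exists (\sum_(i < size p^`()) `|p^`()`_i|); first exact: sumr_ge0.
move=> x y x1 xy y1.
have dp z : z \in `]x, y[ -> is_derive z 1 (horner p) p^`().[z].
  by move=> _; exact: is_derive_poly.
have cp : {within `[x, y], continuous (horner p)}.
  exact/continuous_subspaceT/continuous_horner.
have [z] := MVT_segment xy dp cp; rewrite in_itv/= => /andP[xz zy] ->.
have yx : 0 <= y - x by rewrite subr_ge0.
rewrite normrM (ger0_norm yx) ler_wpM2r//; apply: horner_bound.
by rewrite ler_norml; apply/andP; split; lra.
Qed.

(* As functions of c, both sides vary by the same amount up to O(h^2) over an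
   interval of length h, because p is Lipschitz; so their difference is constant. *)
Lemma zonal_mean_upperM c p : -1 <= c <= 1 ->
  zonal_mean (fun t => upper c t * p.[t]) =
  ((primitive_poly p).[1] - (primitive_poly p).[c]) / 2.
Proof.
move=> /andP[c1 c2]; set Q := primitive_poly p.
have [L L0 pL] := horner_lipschitz p.
pose Psi d := zonal_mean (fun t => upper d t * p.[t]).
have ku d : zonal_kernel (fun t => upper d t * p.[t]).
  by apply: kernelM; [exact: kernel_upper|exact: kernel_horner].
have Psi1 : Psi 1 = 0.
  apply/eqP; rewrite -normr_eq0 eq_le normr_ge0 andbT.
  apply: (@le_trans _ _ (\oint_w ((\sum_(i < size p) `|p`_i|) * upper 1 w.2))).
    apply: le_trans (le_normr_Rintegral _ _) _ => //; first exact: mS.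
      by apply: sphere_integrable; exact: (kernel_e3 (ku 1)).
    apply: sphere_int_le.
    - by apply: bounded_measurable_norm; exact: (kernel_e3 (ku 1)).
    - by apply: bounded_measurableZ; exact: (kernel_e3 (kernel_upper 1)).
    move=> w Sw; rewrite normrM mulrC ler_pM//; first exact/horner_bound/sphere_coord2.
    by rewrite /upper; case: (1 <= w.2); rewrite ?normr0 ?normr1.
  rewrite sphere_intZ; last exact: (kernel_e3 (kernel_upper 1)).
  by have := @zonal_mean_upper 1; rewrite /zonal_mean => ->; lra.
have inc (x y : R) : -1 <= x -> x <= y -> y <= 1 ->
    `|(Psi y + Q.[y] / 2) - (Psi x + Q.[x] / 2)| <= L * (y - x) ^+ 2.
  move=> x1 xy y1; have yx : 0 <= y - x by rewrite subr_ge0.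
  have e1 : `|Psi y - Psi x + p.[x] * (y - x) / 2| <= L * (y - x) ^+ 2 / 2.
    have -> : Psi y - Psi x + p.[x] * (y - x) / 2 =
        \oint_w ((upper y w.2 - upper x w.2) * (p.[w.2] - p.[x])).
      have -> : p.[x] * (y - x) / 2 = p.[x] * (zonal_mean (upper x) - zonal_mean (upper y)).
        rewrite !zonal_mean_upper; first by field.
        - by apply/andP; split; lra.
        - by apply/andP; split; lra.
      rewrite /Psi /zonal_mean.
      rewrite -sphere_intB; [|exact: (kernel_e3 (ku _))..].
      rewrite -sphere_intB; [|exact: (kernel_e3 (kernel_upper _))..].
      have bxy : bm (fun w => upper x w.2 - upper y w.2).
        by apply: bounded_measurableB; exact: (kernel_e3 (kernel_upper _)).
      rewrite -sphere_intZ// -sphere_intD.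
      - by apply: eq_Rintegral => w _; ring.
      - by apply: bounded_measurableB; exact: (kernel_e3 (ku _)).
      - exact: bounded_measurableZ.
    have bxy : bm (fun w => upper x w.2 - upper y w.2).
      by apply: bounded_measurableB; exact: (kernel_e3 (kernel_upper _)).
    have byx : bm (fun w => (upper y w.2 - upper x w.2) * (p.[w.2] - p.[x])).
      apply: bounded_measurableM; apply: bounded_measurableB.
      - exact: (kernel_e3 (kernel_upper _)).
      - exact: (kernel_e3 (kernel_upper _)).
      - exact: (kernel_e3 (kernel_horner _)).
      - exact: bounded_measurable_cst.
    apply: le_trans (le_normr_Rintegral _ _) _ => //; first exact: mS.
      exact: sphere_integrable.
    apply: (@le_trans _ _ (\oint_w ((L * (y - x)) * (upper x w.2 - upper y w.2)))).
      apply: sphere_int_le.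
      - exact: bounded_measurable_norm.
      - exact: bounded_measurableZ.
      move=> w Sw; rewrite normrM /upper.
      have [xw|wx] := leP x w.2; have [yw|wy] := leP y w.2 => /=.
      - by rewrite subrr normr0 mul0r mulr0.
      - rewrite sub0r subr0 normrN normr1 mul1r mulr1.
        apply: le_trans (pL _ _ x1 xw _) _; first by lra.
        by apply: ler_wpM2l => //; lra.
      - by lra.
      - by rewrite subrr normr0 mul0r mulr0.
    rewrite sphere_intZ// sphere_intB; [|exact: (kernel_e3 (kernel_upper _))..].
    have ex : zonal_mean (upper x) = (1 - x) / 2.
      by apply: zonal_mean_upper; apply/andP; split; lra.
    have ey : zonal_mean (upper y) = (1 - y) / 2.
      by apply: zonal_mean_upper; apply/andP; split; lra.
    rewrite -/(zonal_mean (upper x)) -/(zonal_mean (upper y)) ex ey.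
    by lra.
  have e2 : `|Q.[y] - Q.[x] - p.[x] * (y - x)| <= L * (y - x) ^+ 2.
    have dQ z : z \in `]x, y[ -> is_derive z 1 (horner Q) p.[z].
      by move=> _; rewrite -(deriv_primitive p); exact: is_derive_poly.
    have cQ : {within `[x, y], continuous (horner Q)}.
      exact/continuous_subspaceT/continuous_horner.
    have [z] := MVT_segment xy dQ cQ; rewrite in_itv/= => /andP[xz zy] ->.
    rewrite -mulrBl normrM (ger0_norm yx) expr2 mulrA ler_wpM2r//.
    apply: le_trans (pL _ _ x1 xz _) _; first by lra.
    by apply: ler_wpM2l => //; lra.
  have -> : Psi y + Q.[y] / 2 - (Psi x + Q.[x] / 2) =
    (Psi y - Psi x + p.[x] * (y - x) / 2) + (Q.[y] - Q.[x] - p.[x] * (y - x)) / 2 by field.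
  apply: le_trans (ler_normD _ _) _; rewrite [X in _ + X]normrM.
  rewrite [`|2^-1|]ger0_norm; last by lra.
  by lra.
have := @quadratic_increment_constant (fun d => Psi d + Q.[d] / 2) c 1 L c2.
rewrite Psi1 add0r -/(Psi c) => h.
have : Psi c + Q.[c] / 2 = Q.[1] / 2.
  by apply: h => x y cx xy y1; apply: inc => //; lra.
by lra.
Qed.

(** The case c = -1 of [zonal_mean_upperM], where the cap is the whole sphere. It is the bridge
    between surface integrals and the formal mean. *)
Lemma zonal_mean_horner p : zonal_mean (fun t => p.[t]) = poly_mean p.
Proof.
rewrite /poly_mean -zonal_mean_upperM; last by apply/andP; split; lra.
apply: eq_Rintegral => w; rewrite inE => Sw; rewrite /upper.
by have := sphere_coord2 Sw; rewrite ler_norml => /andP[-> _]; rewrite mul1r.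
Qed.

End zonal_kernels.

Section funk_hecke.
Context {R : realType}.
Notation S2 := (@sphere R).
Implicit Types (x y w : space3 R) (f g : space3 R -> R) (p q r s : {poly R}) (k : R -> R).

Local Notation mS := (@measurable_sphere R).
Local Notation "'\oint_' w f" := (\int[surface]_(w in @sphere R) f)
  (at level 36, w at level 0, f at level 36).
Local Notation bm := (bounded_measurable S2).

Lemma bm_fst f : bm f -> bounded_measurable (S2 `*` S2) (fun z => f z.1).
Proof.
move=> [mf [M fM]]; split; last by exists M => z [Sz _]; exact: fM.
apply: (measurable_comp mS) mf _.
  by move=> _ [z [Sz _] <-].
by apply: measurable_funTS; exact: measurable_fst.
Qed.

Lemma bm_snd f : bm f -> bounded_measurable (S2 `*` S2) (fun z => f z.2).
Proof.
move=> [mf [M fM]]; split; last by exists M => z [_ Sz]; exact: fM.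
apply: (measurable_comp mS) mf _.
  by move=> _ [z [_ Sz] <-].
by apply: measurable_funTS; exact: measurable_snd.
Qed.

Lemma bm_coord11 : bm (fun w => w.1.1).
Proof.
split; first by apply: measurable_funTS; exact: measurable_coord11.
exists 1 => w /sphereE; rewrite /dot => h; rewrite ler_norml.
by apply/andP; split; nra.
Qed.

Lemma bm_exp f n : bm f -> bm (fun w => f w ^+ n).
Proof.
move=> bf; elim: n => [|n ih]; first exact: bounded_measurable_cst.
rewrite (_ : (fun w => _) = fun w => f w * f w ^+ n).
  exact: bounded_measurableM.
by apply/funext => w; rewrite exprS.
Qed.

Definition azimuthal_moment k (a b : nat) : R :=
  \oint_w (k w.2 * (w.1.1 ^+ a * w.2 ^+ b)).

Lemma bm_azimuthal k a b : zonal_kernel k -> bm (fun w => k w.2 * (w.1.1 ^+ a * w.2 ^+ b)).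
Proof.
move=> hk; apply: bounded_measurableM; first exact: kernel_e3.
apply: bounded_measurableM; apply: bm_exp; first exact: bm_coord11.
have := kernel_e3 (kernel_horner ('X : {poly R})).
by congr bounded_measurable; apply/funext => w; rewrite hornerX.
Qed.

(** A half turn about the vertical axis changes the sign of the first coordinate and fixes the
    height. *)
Lemma azimuthal_moment_odd k a b : zonal_kernel k -> odd a -> azimuthal_moment k a b = 0.
Proof.
move=> hk oa.
have rM : rotation (rot12 (-1) (0 : R)) by apply: rotation_rot12; ring.
have mk : measurable_fun setT (fun w : space3 R => k w.2 * (w.1.1 ^+ a * w.2 ^+ b)).
  apply: measurable_funM; first by apply: measurableT_comp hk.1 _; exact: measurable_coord2.
  apply: measurable_funM; apply: measurable_funX; first exact: measurable_coord11.
  exact: measurable_coord2.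
have := Rintegral_rotation rM mk (bm_azimuthal a b hk).
have -> : \oint_x (k (rot12 (-1) 0 x).2 * ((rot12 (-1) 0 x).1.1 ^+ a * (rot12 (-1) 0 x).2 ^+ b))
    = - azimuthal_moment k a b.
  transitivity (\oint_w (-1 * (k w.2 * (w.1.1 ^+ a * w.2 ^+ b)))); last first.
    by rewrite (sphere_intZ (-1) (bm_azimuthal a b hk)) mulN1r.
  apply: eq_Rintegral => w _ /=; rewrite mul0r subr0 [-1 * w.1.1]mulN1r exprNn -signr_odd oa expr1.
  by ring.
by rewrite -/(azimuthal_moment k a b); move: (azimuthal_moment k a b) => t ?; lra.
Qed.

(* In coordinates where x = (0, 0, 1) and y = (s, 0, c), expand p (c w3 + s w1): the
   odd powers of w1 integrate to 0, so only even powers of s, that is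
   powers of 1 - c^2, remain. *)
Lemma zonal_convolution k p : zonal_kernel k -> exists2 r : {poly R}, (size r <= size p)%N &
  forall x y, S2 x -> S2 y -> \oint_w (k (dot w x) * p.[dot w y]) = r.[dot x y].
Proof.
move=> hk.
pose term j i : {poly R} := (p`_j * 'C(j, i)%:R * azimuthal_moment k i (j - i)) *:
  ('X^(j - i) * (1 - 'X^2) ^+ i./2).
exists (\sum_(j < size p) \sum_(i < j.+1 | ~~ odd i) term j i).
  apply: (big_ind (fun q : {poly R} => (size q <= size p)%N)).
  - by rewrite size_poly0.
  - by move=> q1 q2 h1 h2; rewrite (leq_trans (size_polyD _ _))// geq_max h1.
  move=> j _; apply: (big_ind (fun q : {poly R} => (size q <= size p)%N)).
  - by rewrite size_poly0.
  - by move=> q1 q2 h1 h2; rewrite (leq_trans (size_polyD _ _))// geq_max h1.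
  move=> i oi; apply: leq_trans (size_scale_leq _ _) _.
  apply: leq_trans (size_polyMleq _ _) _; rewrite size_polyXn /=.
  have h3 : (size ((1 - 'X^2 : {poly R}) ^+ i./2)%R <= i.+1)%N.
    apply: leq_trans (size_poly_exp_leq _ _) _.
    have -> : size (1 - 'X^2 : {poly R}) = 3%N.
      by rewrite -opprB size_polyN size_XnsubC.
    by have := odd_double_half i; rewrite (negPf oi) /=; lia.
  have ij := ltn_ord i; have jp := ltn_ord j.
  apply: (@leq_trans (j - i + i.+1)); first by rewrite leq_add2l.
  by rewrite addnS subnK.
move=> x y Sx Sy; have [M [s [rM Mx My su]]] := rotation_pair Sx Sy.
rewrite (zonal_invariance hk (kernel_horner p) rM Sx Sy) Mx My.
set c := dot x y; rewrite -/e3.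
have s2 : s ^+ 2 = 1 - c ^+ 2 by rewrite -su /c; ring.
have bt j i : bm (fun w => (p`_j * 'C(j, i)%:R * (c ^+ (j - i) * s ^+ i)) *
     (k w.2 * (w.1.1 ^+ i * w.2 ^+ (j - i)))).
  by apply: bounded_measurableZ; exact: bm_azimuthal.
transitivity (\oint_w (\sum_(j < size p) \sum_(i < j.+1)
    (p`_j * 'C(j, i)%:R * (c ^+ (j - i) * s ^+ i)) *
     (k w.2 * (w.1.1 ^+ i * w.2 ^+ (j - i))))).
  apply: eq_Rintegral => w _; rewrite dot_e3 horner_coef mulr_sumr.
  apply: eq_bigr => j _.
  have -> : dot w (s, 0, c) = c * w.2 + s * w.1.1 by rewrite /dot/=; ring.
  rewrite exprDn mulr_sumr mulr_sumr; apply: eq_bigr => i _.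
  by rewrite !exprMn -mulr_natr; ring.
rewrite sphere_int_sum; last first.
  by move=> j _; apply: bounded_measurable_sum => i _; exact: bt.
rewrite horner_sum; apply: eq_bigr => j _.
rewrite sphere_int_sum; last by move=> i _; exact: bt.
rewrite horner_sum [RHS]big_mkcond /=; apply: eq_bigr => i _.
rewrite sphere_intZ; last exact: bm_azimuthal.
rewrite -/(azimuthal_moment k i (j - i)).
case: ifPn => [oi|]; last by rewrite negbK => oi; rewrite azimuthal_moment_odd// mulr0.
have -> : s ^+ i = (1 - c ^+ 2) ^+ i./2.
  by rewrite -s2 -exprM mul2n even_halfK.
rewrite /term hornerZ hornerM hornerXn horner_exp hornerD hornerN hornerXn hornerC.
by ring.
Qed.

(* The left side is a polynomial in the inner product, of degree at most n, and it is
   orthogonal to all polynomials of smaller degree since P_n is. *)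
Lemma funk_hecke k n x y : zonal_kernel k -> S2 x -> S2 y ->
  \oint_w (k (dot w x) * (legendre n).[dot w y]) =
  zonal_mean (fun t => k t * (legendre n).[t]) * (legendre n).[dot x y].
Proof.
move=> hk Sx Sy; set P := legendre n.
have [r rsz rE] := zonal_convolution P hk.
have Se := @sphere_e3 R.
have rn : (size r <= n.+1)%N by apply: leq_trans rsz _; exact: size_legendre_le.
have ortho s : (size s <= n)%N -> poly_mean (r * s) = 0.
  move=> sn; have [r' rsz' rE'] := zonal_convolution s hk.
  rewrite -zonal_mean_horner -(zonal_meanE (kernel_horner _) Se).
  (* Fubini moves the kernel from P to s; its convolution with s is a polynomial [r'] of size at
     most that of s, hence orthogonal to P. *)
  transitivity (\oint_x (\oint_w (k (dot w x) * P.[dot w e3] * s.[dot x e3]))).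
    apply: eq_Rintegral => z; rewrite inE => Sz; rewrite hornerM -rE//.
    rewrite mulrC -sphere_intZ.
      by apply: eq_Rintegral => w _; ring.
    by apply: bounded_measurableM; apply: bm_kernel => //; exact: kernel_horner.
  have bG : bounded_measurable (S2 `*` S2) (fun z : space3 R * space3 R =>
      k (dot z.2 z.1) * P.[dot z.2 e3] * s.[dot z.1 e3]).
    apply: bounded_measurableM; last first.
      by apply: (@bm_fst (fun x => s.[dot x e3])); exact: bm_kernel (kernel_horner _) Se.
    apply: bounded_measurableM; last first.
      by apply: (@bm_snd (fun x => P.[dot x e3])); exact: bm_kernel (kernel_horner _) Se.
    have := bm_kernel2 hk; congr bounded_measurable.
    by apply/funext => z; rewrite dotC.
  rewrite (sphere_fubini bG) /=.
  transitivity (\oint_w (P * r').[dot w e3]).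
    apply: eq_Rintegral => w; rewrite inE => Sw; rewrite hornerM -rE'// -sphere_intZ.
      by apply: eq_Rintegral => z _; rewrite [dot z w]dotC; ring.
    by apply: bounded_measurableM; apply: bm_kernel => //; exact: kernel_horner.
  rewrite (zonal_meanE (kernel_horner _) Se) zonal_mean_horner.
  by apply: legendre_orthogonal; exact: leq_trans rsz' sn.
rewrite rE// (legendre_unique rn ortho) hornerZ; congr (_ * _).
(* The constant is found by putting both points at the pole, where the inner product is 1. *)
have := rE _ _ Se Se; rewrite [dot e3 e3](_ : _ = 1); last by rewrite dot_e3.
by move=> <-; apply: eq_Rintegral => w _; rewrite dot_e3.
Qed.

Lemma zonal_reproducing m n x y : S2 x -> S2 y ->
  \oint_w ((legendre m).[dot w x] * (legendre n).[dot w y]) =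
  poly_mean (legendre m * legendre n) * (legendre n).[dot x y].
Proof.
move=> Sx Sy; rewrite (funk_hecke n (kernel_horner _) Sx Sy); congr (_ * _).
rewrite -zonal_mean_horner; apply: eq_Rintegral => w _.
by rewrite hornerM.
Qed.

Lemma legendre_norm_gt0 n : 0 < poly_mean (legendre n * legendre n : {poly R}).
Proof.
have := legendre_norm n; set a := poly_mean _ => h.
have n0 : 0 < 2 * n%:R + 1 :> R by rewrite ltr_pwDr// mulr_ge0.
by rewrite -(pmulr_rgt0 _ n0) h.
Qed.

(** In the reproducing identity bound the product by half the sum of the squares; both squares
    integrate to [poly_mean] of P_n^2, which cancels. *)
Lemma legendre_le1 n x y : S2 x -> S2 y -> `|(legendre n).[dot x y]| <= 1.
Proof.
move=> Sx Sy; set P := legendre n.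
have a0 := legendre_norm_gt0 n; have bP z := bm_kernel (kernel_horner P) (x := z).
have bPP z : S2 z -> bm (fun w => P.[dot w z] ^+ 2) by move=> Sz; apply: bm_exp; exact: bP.
rewrite -(ler_pM2l a0) mulr1 -{1}(ger0_norm (ltW a0)) -normrM -zonal_reproducing//.
have e z : S2 z -> \oint_w (P.[dot w z] ^+ 2) = poly_mean (P * P).
  move=> Sz; rewrite -zonal_mean_horner -(zonal_meanE (kernel_horner _) Sz).
  by apply: eq_Rintegral => w _; rewrite hornerM expr2.
apply: le_trans (le_normr_Rintegral _ _) _; first exact: mS.
  by apply: sphere_integrable; apply: bounded_measurableM; exact: bP.
apply: (@le_trans _ _ (\oint_w (2^-1 * (P.[dot w x] ^+ 2 + P.[dot w y] ^+ 2)))).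
  apply: sphere_int_le.
  - by apply: bounded_measurable_norm; apply: bounded_measurableM; exact: bP.
  - by apply: bounded_measurableZ; apply: bounded_measurableD; exact: bPP.
  move=> w _; rewrite normrM; set a := P.[_]; set b := P.[_].
  rewrite -(real_normK (num_real a)) -(real_normK (num_real b)).
  by have := sqr_ge0 (`|a| - `|b|); rewrite sqrrB; lra.
rewrite sphere_intZ; last by apply: bounded_measurableD; exact: bPP.
by rewrite sphere_intD ?e//; [lra|exact: bPP|exact: bPP].
Qed.

(* The eigenvalue on degree n of the integration over caps of radius theta. *)
Definition cap_multiplier n (theta : R) : R :=
  zonal_mean (fun t => upper (cos theta) t * (legendre n).[t]).

Lemma cap_multiplierE n theta : cap_multiplier n theta =
  ((primitive_poly (legendre n)).[1] - (primitive_poly (legendre n)).[cos theta]) / 2.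
Proof. by rewrite /cap_multiplier zonal_mean_upperM// cos_geN1 cos_le1. Qed.

End funk_hecke.

(** * Approximation by harmonic components *)

Section continuous_on_space3.
Context {R : realType}.
Implicit Types (F : space3 R -> R).
Notation S2 := (@sphere R).
Notation T := (measurableTypeR R).

Let gidx (k : nat) (x : T) : int := Num.floor (k.+1%:R * x : R).
Let gpt (k : nat) (i : int) : T := i%:~R / k.+1%:R.
Let grid (k : nat) (x : T) : T := gpt k (gidx k x).

Let floorB (y : R) : (Num.floor y)%:~R <= y < (Num.floor y)%:~R + 1.
Proof. by have := real_floor_itv (num_real y); rewrite intrD. Qed.

Let gridB k (x : T) : `|grid k x - x| <= k.+1%:R^-1 :> R.
Proof.
have k0 : 0 < k.+1%:R :> R by rewrite ltr0n.
have -> : grid k x - x = ((Num.floor (k.+1%:R * x : R))%:~R - k.+1%:R * x) / k.+1%:R.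
  by rewrite /grid /gpt /gidx; field; rewrite gt_eqF.
have /andP[h1 h2] := floorB (k.+1%:R * x).
rewrite normrM [`|_^-1|]gtr0_norm ?invr_gt0// ler_piMl ?invr_ge0 1?ltW//.
by rewrite ltr_norml; apply/andP; split; lra.
Qed.

Let grid_cvg (t : T) : grid k t @[k --> \oo] --> t.
Proof.
apply/cvgrPdist_le => e e0; near=> k.
rewrite distrC; apply: le_trans (gridB k t) _.
near: k; have := @near_infty_natSinv_lt R (PosNum e0).
by apply: filterS => k /ltW.
Unshelve. all: by end_near. Qed.

Let grid_cell k (i : int) : set T := [set x : T | gidx k x = i].

Let measurable_grid_cell k i : measurable (grid_cell k i).
Proof.
have k0 : 0 < k.+1%:R :> R by rewrite ltr0n.
rewrite (_ : grid_cell k i = `[i%:~R / k.+1%:R, (i%:~R + 1) / k.+1%:R[%classic).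
  exact: measurable_itv.
apply/seteqP; split => x; rewrite /grid_cell /gidx/= in_itv/=.
  move=> <-; have := floorB (k.+1%:R * x).
  by rewrite ler_pdivrMr// ltr_pdivlMr// [x * _]mulrC.
rewrite ler_pdivrMr// ltr_pdivlMr// [x * _]mulrC => h.
by apply/floor_def; rewrite intrD.
Qed.

(* [space3 R] carries a product sigma-algebra, so the Borel measurability of
   continuous functions is obtained by discretizing the coordinates. *)
Lemma continuous_measurable3 F : continuous F -> measurable_fun setT F.
Proof.
move=> cF.
pose q k (x : space3 R) : space3 R := (grid k x.1.1, grid k x.1.2, grid k x.2).
apply: (@measurable_fun_cvg _ _ R setT (fun k => F \o q k)) => [k|x _]; last first.
  apply: (cvg_comp (fun k => q k x) F); last exact: cF.
  case: x => [[a b] c].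
  apply: (@cvg_pair _ _ _ _ (nbhs ((a, b) : T * T)) (nbhs (c : T))); last exact: grid_cvg.
  by apply: (@cvg_pair _ _ _ _ (nbhs (a : T)) (nbhs (b : T))); exact: grid_cvg.
move=> _ Y mY; rewrite setTI.
pose pt (z : int * int * int) : space3 R :=
  (gpt k z.1.1, gpt k z.1.2, gpt k z.2).
pose cell (z : int * int * int) : set (space3 R) :=
  (grid_cell k z.1.1 `*` grid_cell k z.1.2) `*` grid_cell k z.2.
rewrite (_ : _ @^-1` Y = \bigcup_n
    (if unpickle n is Some z then (if `[< Y (F (pt z)) >] then cell z else set0)
     else set0)).
  apply: bigcupT_measurable => n; case: unpickle => // z; case: ifP => // _.
  by do 2?apply: measurableX; exact: measurable_grid_cell.
apply/seteqP; split => x.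
  move=> YF; have YF' : Y (F (q k x)) := YF.
  pose z := (gidx k x.1.1, gidx k x.1.2, gidx k x.2).
  exists (pickle z); first exact: I.
  rewrite pickleK.
  have YFz : Y (F (pt z)) by exact: YF'.
  by rewrite (asboolT YFz).
move=> [n _] /=; case: unpickle => // z; case: ifP => // /asboolP YF [[e1 e2] e3].
by rewrite /q /grid e1 e2 e3.
Qed.

Lemma continuous_sphere_bounded F : continuous F -> exists M, forall x, S2 x -> `|F x| <= M.
Proof.
move=> cF.
have cb : compact (@box R 1).
  by apply: compact_setX; [apply: compact_setX|]; exact: segment_compact.
have : compact (F @` box 1) by apply: continuous_compact => //; exact: continuous_subspaceT.
move=> /compact_bounded[M [_ hM]].
exists (M + 1) => x /sphereE; rewrite /dot => hx; apply: hM; first by lra.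
exists x => //; rewrite /box/= !in_itv/=.
by repeat split; apply/andP; split; nra.
Qed.

End continuous_on_space3.

(** * Harmonic components, zonal operators and a polynomial approximate identity *)

Section projections.
Context {R : realType}.
Notation S2 := (@sphere R).
Implicit Types (x y w : space3 R) (u f g : space3 R -> R) (p q : {poly R}) (k : R -> R).

Local Notation mS := (@measurable_sphere R).
Local Notation "'\oint_' w f" := (\int[surface]_(w in @sphere R) f)
  (at level 36, w at level 0, f at level 36).
Local Notation bm := (bounded_measurable S2).

Definition zonal_transform k u x := \oint_y (k (dot x y) * u y).

(** The counterpart of [harmonic_proj] for real functions, to which [harmonic_projE] reduces the
    complex one. *)
Definition harmonic_part u n x := zonal_transform (zonal n) u x.

Lemma kernelZ k (a : R) : zonal_kernel k -> zonal_kernel (fun t => a * k t).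
Proof.
move=> [mk [M kM]]; split; first exact: measurable_funM.
by exists (`|a| * M) => t t1; rewrite normrM ler_wpM2l// kM.
Qed.

Lemma kernel_zonal n : zonal_kernel (zonal n : R -> R).
Proof. exact: kernelZ (kernel_horner _). Qed.

Lemma bm_kernelM k u : zonal_kernel k -> bm u ->
  bounded_measurable (S2 `*` S2) (fun z : space3 R * space3 R => k (dot z.1 z.2) * u z.2).
Proof.
by move=> hk bu; apply: bounded_measurableM; [exact: bm_kernel2|exact: bm_snd].
Qed.

Lemma bm_zonal_transform k u : zonal_kernel k -> bm u -> bm (zonal_transform k u).
Proof. by move=> hk bu; exact: (sphere_fubini_bm (bm_kernelM hk bu)). Qed.

Lemma bm_harmonic_part u n : bm u -> bm (harmonic_part u n).
Proof. exact: bm_zonal_transform (kernel_zonal n). Qed.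

Lemma bm_kernel_dotl k x : zonal_kernel k -> S2 x -> bm (fun y => k (dot x y)).
Proof.
move=> hk Sx; have := bm_kernel hk Sx; congr bounded_measurable.
by apply/funext => y; rewrite dotC.
Qed.

(** Fubini brings the two kernels together and the Funk-Hecke formula evaluates their convolution: a
    zonal operator acts on degree n as a scalar. *)
Lemma zonal_transform_harmonic_part k u n y : zonal_kernel k -> bm u -> S2 y ->
  zonal_transform k (harmonic_part u n) y =
  zonal_mean (fun t => k t * (legendre n).[t]) * harmonic_part u n y.
Proof.
move=> hk bu Sy; rewrite /zonal_transform /harmonic_part.
transitivity (\oint_x (\oint_z (k (dot y x) * (zonal n (dot x z) * u z)))).
  apply: eq_Rintegral => x; rewrite inE => Sx; rewrite -sphere_intZ//.
  apply: bounded_measurableM => //; apply: bm_kernel_dotl => //.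
  exact: kernel_zonal.
have bG : bounded_measurable (S2 `*` S2) (fun z : space3 R * space3 R =>
    k (dot y z.1) * (zonal n (dot z.1 z.2) * u z.2)).
  apply: bounded_measurableM; last exact: bm_kernelM (kernel_zonal n) bu.
  by apply: (@bm_fst _ (fun x => k (dot y x))); exact: bm_kernel_dotl.
rewrite (sphere_fubini bG) /= -sphere_intZ; last first.
  by apply: bounded_measurableM => //; apply: bm_kernel_dotl => //; exact: kernel_zonal.
apply: eq_Rintegral => z; rewrite inE => Sz.
transitivity (\oint_x ((2 * n%:R + 1) * u z * (k (dot x y) * (legendre n).[dot x z]))).
  by apply: eq_Rintegral => x _; rewrite /zonal [dot y x]dotC; ring.
rewrite sphere_intZ; last first.
  by apply: bounded_measurableM; apply: bm_kernel => //; exact: kernel_horner.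
by rewrite funk_hecke// /zonal; ring.
Qed.

(** By Fubini the integral pairs u with the operator of kernel [zonal m] applied to the component of
    degree n, and that operator has the eigenvalue (2 m + 1) times the mean of P_m P_n, which is
    0. *)
Lemma harmonic_part_orthogonal u m n : bm u -> m != n ->
  \oint_x (harmonic_part u m x * harmonic_part u n x) = 0.
Proof.
move=> bu mn; have bn := bm_harmonic_part n bu.
transitivity (\oint_x (\oint_y (zonal m (dot x y) * u y * harmonic_part u n x))).
  apply: eq_Rintegral => x; rewrite inE => Sx; rewrite mulrC -sphere_intZ.
    by apply: eq_Rintegral => y _; ring.
  by apply: bounded_measurableM => //; apply: bm_kernel_dotl => //; exact: kernel_zonal.
have bG : bounded_measurable (S2 `*` S2) (fun z : space3 R * space3 R =>
    zonal m (dot z.1 z.2) * u z.2 * harmonic_part u n z.1).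
  apply: bounded_measurableM; last exact: (@bm_fst _ (harmonic_part u n)).
  exact: bm_kernelM (kernel_zonal m) bu.
rewrite (sphere_fubini bG) /=.
transitivity (\oint_y (0 * u y)); last by rewrite sphere_intZ// mul0r.
apply: eq_Rintegral => y; rewrite inE => Sy.
transitivity (u y * zonal_transform (zonal m) (harmonic_part u n) y).
  rewrite -sphere_intZ; last first.
    by apply: bounded_measurableM => //; apply: bm_kernel_dotl => //; exact: kernel_zonal.
  by apply: eq_Rintegral => x _; rewrite [dot y x]dotC; ring.
rewrite zonal_transform_harmonic_part//; last exact: kernel_zonal.
rewrite [zonal_mean _](_ : _ = 0) ?mul0r ?mulr0//.
transitivity (zonal_mean (horner ((2 * m%:R + 1) *: (legendre m * legendre n : {poly R})))).
  by apply: eq_Rintegral => w _; rewrite /zonal hornerZ hornerM; ring.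
by rewrite zonal_mean_horner poly_meanZ poly_mean_legendreM ?mulr0.
Qed.

Definition energy u n := \oint_x (harmonic_part u n x ^+ 2).

Lemma energy_ge0 u n : 0 <= energy u n.
Proof. by apply: Rintegral_ge0 => x _; exact: sqr_ge0. Qed.

Lemma energy_combination u (c : nat -> R) N : bm u ->
  \oint_x ((\sum_(n < N) c n * harmonic_part u n x) ^+ 2) = \sum_(n < N) c n ^+ 2 * energy u n.
Proof.
move=> bu; have bp n := bm_harmonic_part n bu.
have bt m n : bm (fun x => (c m * c n) * (harmonic_part u m x * harmonic_part u n x)).
  by apply: bounded_measurableZ; exact: bounded_measurableM.
transitivity (\oint_x (\sum_(m < N) \sum_(n < N) (c m * c n) * (harmonic_part u m x * harmonic_part u n x))).
  apply: eq_Rintegral => x _; rewrite expr2 mulr_suml; apply: eq_bigr => m _.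
  by rewrite mulr_sumr; apply: eq_bigr => n _; ring.
rewrite sphere_int_sum => [|m _]; last by apply: bounded_measurable_sum => n _.
apply: eq_bigr => m _; rewrite sphere_int_sum => [|n _]; last exact: bt.
rewrite (bigD1 m)//= big1 ?addr0 => [|n nm]; rewrite sphere_intZ.
- by rewrite -expr2.
- exact: bounded_measurableM.
- by rewrite harmonic_part_orthogonal ?mulr0// eq_sym.
- exact: bounded_measurableM.
Qed.

(* Normalized multiples of ((1 + t) / 2)^N, an approximate identity at t = 1. *)
Definition peak N : {poly R} := (N.+1%:R / 2 ^+ N) *: ('X + 1) ^+ N.

Lemma size_peak N : (size (peak N) <= N.+1)%N.
Proof.
apply: leq_trans (size_scale_leq _ _) _.
have -> : 'X + 1 = 'X - (-1)%:P :> {poly R} by rewrite polyCN opprK.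
by rewrite size_exp_XsubC.
Qed.

Lemma poly_mean_Xadd1 N : poly_mean (('X + 1) ^+ N : {poly R}) = 2 ^+ N / N.+1%:R.
Proof.
have n0 : N.+1%:R != 0 :> R by rewrite pnatr_eq0.
have -> : ('X + 1) ^+ N = (N.+1%:R^-1 *: ('X + 1) ^+ N.+1)^`() :> {poly R}.
  rewrite derivZ deriv_exp derivD derivX derivC addr0 mul1r /= -[_ ^+ N *+ _]scaler_nat scalerA.
  by rewrite mulVf// scale1r.
rewrite poly_mean_deriv !hornerZ !horner_exp !hornerD !hornerX !hornerC.
by rewrite addNr [0 ^+ _]expr0n/= mulr0 subr0 exprS; field.
Qed.

Lemma poly_mean_peak N : poly_mean (peak N) = 1.
Proof.
have n0 : N.+1%:R != 0 :> R by rewrite pnatr_eq0.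
have n2 : 2 ^+ N != 0 :> R by rewrite expf_neq0.
rewrite poly_meanZ poly_mean_Xadd1.
by move: (N.+1%:R : R) n0 (2 ^+ N : R) n2 => a a0 b b0; field; rewrite a0 b0.
Qed.

(** Writing 1 - X = 2 - (X + 1) leaves only powers of X + 1. The value tends to 0, which expresses
    concentration at t = 1. *)
Lemma poly_mean_peak_deviation N : poly_mean (peak N * (1 - 'X)) = 2 / N.+2%:R.
Proof.
have n1 : N.+1%:R != 0 :> R by rewrite pnatr_eq0.
have n0 : N.+2%:R != 0 :> R by rewrite pnatr_eq0.
have n2 : 2 ^+ N != 0 :> R by rewrite expf_neq0.
have -> : peak N * (1 - 'X) = 2 *: peak N - (N.+1%:R / 2 ^+ N) *: ('X + 1) ^+ N.+1.
  rewrite /peak exprS; move: (_ / _) => a; rewrite -!mul_polyC.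
  have -> : (2 : R)%:P = 2 :> {poly R} by rewrite rmorph_nat.
  by ring.
rewrite poly_meanB [poly_mean (2 *: _)]poly_meanZ poly_mean_peak poly_meanZ.
rewrite poly_mean_Xadd1 exprS.
have -> : N.+1%:R = N.+2%:R - 1 :> R by rewrite -(natr1 N.+1) addrK.
by move: (N.+2%:R : R) n0 (2 ^+ N : R) n2 => a a0 b b0; field; rewrite a0 b0.
Qed.

Lemma peak_ge0 N (t : R) : -1 <= t -> 0 <= (peak N).[t].
Proof.
move=> t1; rewrite hornerZ horner_exp hornerD hornerX hornerC.
apply: mulr_ge0; first by rewrite divr_ge0// exprn_ge0.
by rewrite exprn_ge0//; lra.
Qed.

Definition peak_weight N n : R := poly_mean (peak N * legendre n).

Lemma dot_geN1 x y : S2 x -> S2 y -> -1 <= dot x y.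
Proof. by move=> Sx Sy; have := dot_sphere Sx Sy; rewrite ler_norml => /andP[]. Qed.

(** The peak is nonnegative with mean 1 and P_n is bounded by 1. This keeps the final estimates
    uniform in N. *)
Lemma peak_weight_le1 N n : `|peak_weight N n| <= 1.
Proof.
have Se := @sphere_e3 R.
rewrite /peak_weight -zonal_mean_horner -(zonal_meanE (kernel_horner _) Se).
apply: le_trans (le_normr_Rintegral _ _) _; first exact: mS.
  by apply: sphere_integrable; apply: bm_kernel => //; exact: kernel_horner.
rewrite -(poly_mean_peak N) -zonal_mean_horner -(zonal_meanE (kernel_horner _) Se).
apply: sphere_int_le.
- by apply: bounded_measurable_norm; apply: bm_kernel => //; exact: kernel_horner.
- by apply: bm_kernel => //; exact: kernel_horner.
move=> w Sw; rewrite hornerM normrM.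
have p0 := peak_ge0 N (dot_geN1 Sw Se).
by rewrite (ger0_norm p0) ler_piMr// legendre_le1.
Qed.

Definition smoothing u N := zonal_transform (horner (peak N)) u.

Lemma smoothingE u N y : bm u -> S2 y ->
  smoothing u N y = \sum_(n < N.+1) peak_weight N n * harmonic_part u n y.
Proof.
move=> bu Sy.
have bz n : bm (fun x => zonal n (dot y x) * u x).
  by apply: bounded_measurableM => //; apply: bm_kernel_dotl => //; exact: kernel_zonal.
transitivity (\oint_x (\sum_(n < N.+1) peak_weight N n * (zonal n (dot y x) * u x))).
  apply: eq_Rintegral => x _.
  rewrite [peak N in LHS](legendre_expansion (size_peak N)) horner_sum mulr_suml.
  by apply: eq_bigr => n _; rewrite hornerZ /peak_weight /zonal; ring.
rewrite sphere_int_sum => [|n _]; last exact: bounded_measurableZ.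
by apply: eq_bigr => n _; rewrite sphere_intZ.
Qed.

Lemma smoothing_bound u N y (M : R) : bm u -> S2 y ->
  (forall x, S2 x -> `|u x| <= M) -> `|smoothing u N y| <= M.
Proof.
move=> bu Sy uM.
have bp : bm (fun x => (peak N).[dot y x]).
  by apply: bm_kernel_dotl => //; exact: kernel_horner.
apply: le_trans (le_normr_Rintegral _ _) _; first exact: mS.
  by apply: sphere_integrable; exact: bounded_measurableM.
apply: (@le_trans _ _ (\oint_x (M * (peak N).[dot y x]))).
  apply: sphere_int_le.
  - by apply: bounded_measurable_norm; exact: bounded_measurableM.
  - exact: bounded_measurableZ.
  move=> x Sx; rewrite normrM (ger0_norm (peak_ge0 N (dot_geN1 Sy Sx))) mulrC.
  by rewrite ler_wpM2r ?uM// peak_ge0// dot_geN1.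
rewrite sphere_intZ//.
have -> : \oint_x (peak N).[dot y x] = 1; last by rewrite mulr1.
rewrite -(poly_mean_peak N) -zonal_mean_horner -(zonal_meanE (kernel_horner _) Sy).
by apply: eq_Rintegral => x _; rewrite dotC.
Qed.

(** Chebyshev's argument: the oscillation of u about y is at most e / 2 near y and at most a
    multiple of 1 - x.y far from it, and the mean of the latter against the peak tends to 0. *)
Lemma smoothing_cvg u y : bm u -> S2 y -> {for y, continuous u} ->
  smoothing u N y @[N --> \oo] --> u y.
Proof.
move=> bu Sy cu; have [mu [M uM]] := bu.
have M0 : 0 <= M by apply: le_trans (uM y Sy); exact: normr_ge0.
apply/cvgrPdist_le => e e0.
have e2 : 0 < e / 2 by lra.
have /cvgrPdist_le/(_ _ e2) := cu.
rewrite -nbhs_nearE => /nbhs_ballP[d /= d0 yd].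
have C0 : 0 <= 2 * M * (2 / d ^+ 2).
  apply: mulr_ge0; first by rewrite mulr_ge0.
  by rewrite divr_ge0// sqr_ge0.
have dist x : S2 x -> `|u x - u y| <= e / 2 + 2 * M * (2 / d ^+ 2) * (1 - dot y x).
  move=> Sx; have [b|nb] := pselect (ball y d x).
    have := yd _ b; rewrite distrC => h; apply: le_trans h _.
    rewrite lerDl; apply: mulr_ge0 => //.
    by have := dot_sphere Sy Sx; rewrite ler_norml => /andP[_ h2]; lra.
  (* On the sphere 2 (1 - x.y) is the squared Euclidean distance, while [ball] refers to the sup
     norm: outside it some coordinate already differs by d. *)
  have far : d ^+ 2 <= 2 * (1 - dot y x).
    have -> : 2 * (1 - dot y x) = (y.1.1 - x.1.1) ^+ 2 + (y.1.2 - x.1.2) ^+ 2 + (y.2 - x.2) ^+ 2.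
      by move/sphereE: Sx; move/sphereE: Sy; rewrite /dot; lra.
    rewrite leNgt; apply/negP => h; apply: nb.
    have a1 := sqr_ge0 (y.1.1 - x.1.1); have a2 := sqr_ge0 (y.1.2 - x.1.2).
    have a3 := sqr_ge0 (y.2 - x.2).
    by repeat split; rewrite /ball/=; rewrite -[_ < d]ltr_sqr ?nnegrE// ?(ltW d0)// real_normK ?num_real//; lra.
  apply: (@le_trans _ _ (2 * M)).
    by apply: le_trans (ler_normB _ _) _; have := uM x Sx; have := uM y Sy; lra.
  have d2 : 0 < d ^+ 2 by rewrite exprn_gt0.
  have : 1 <= 2 / d ^+ 2 * (1 - dot y x).
    by rewrite mulrAC ler_pdivlMr// mul1r.
  move=> h; have := ler_wpM2l (_ : 0 <= 2 * M) h; rewrite mulr1 => h2.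
  by apply: le_trans (h2 _) _; [lra|lra].
pose C := 2 * M * (2 / d ^+ 2).
have bound N : `|smoothing u N y - u y| <= e / 2 + C * (2 / N.+2%:R).
  have bp : bm (fun x => (peak N).[dot y x]).
    by apply: bm_kernel_dotl => //; exact: kernel_horner.
  have b1 : bm (fun x => (peak N * (1 - 'X)).[dot y x]).
    by apply: bm_kernel_dotl => //; exact: kernel_horner.
  have m1 p : \oint_x p.[dot y x] = poly_mean p.
    rewrite -zonal_mean_horner -(zonal_meanE (kernel_horner _) Sy).
    by apply: eq_Rintegral => x _; rewrite dotC.
  have bpu : bm (fun x => (peak N).[dot y x] * (u x - u y)).
    apply: bounded_measurableM => //; apply: bounded_measurableB => //.
    exact: bounded_measurable_cst.
  have -> : smoothing u N y - u y = \oint_x ((peak N).[dot y x] * (u x - u y)).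
    transitivity (\oint_x ((peak N).[dot y x] * u x - u y * (peak N).[dot y x])).
      rewrite sphere_intB; [|exact: bounded_measurableM|exact: bounded_measurableZ].
      by rewrite sphere_intZ// m1 poly_mean_peak mulr1.
    by apply: eq_Rintegral => x _; ring.
  apply: le_trans (le_normr_Rintegral _ _) _; first exact: mS.
    exact: sphere_integrable.
  apply: (@le_trans _ _ (\oint_x (e / 2 * (peak N).[dot y x] + C * (peak N * (1 - 'X)).[dot y x]))).
    apply: sphere_int_le.
    - exact: bounded_measurable_norm.
    - by apply: bounded_measurableD; exact: bounded_measurableZ.
    move=> x Sx; have p0 := peak_ge0 N (dot_geN1 Sy Sx).
    have -> : (peak N * (1 - 'X)).[dot y x] = (peak N).[dot y x] * (1 - dot y x).
      by rewrite hornerM hornerD hornerN hornerX hornerC.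
    rewrite normrM (ger0_norm p0); have := ler_wpM2l p0 (dist x Sx).
    by rewrite -/C; move: (peak N).[_] => a; lra.
  rewrite sphere_intD; [|exact: bounded_measurableZ..].
  by rewrite !sphere_intZ// !m1 poly_mean_peak poly_mean_peak_deviation mulr1.
near=> N; rewrite distrC; apply: le_trans (bound N) _.
have : `|C| * 4 / e <= N%:R by near: N; exact: nbhs_infty_ger.
rewrite [`|C|](ger0_norm C0) -/C ler_pdivrMr// => h.
have n2 : 0 < N.+2%:R :> R by rewrite ltr0n.
have : C * (2 / N.+2%:R) <= e / 2.
  rewrite mulrA ler_pdivrMr//.
  have : N%:R <= N.+2%:R :> R by rewrite ler_nat; lia.
  move=> h2; have := ler_wpM2r (ltW e0) h2; lra.
by move=> hC; rewrite [leRHS]splitr lerD2l.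
Unshelve. all: by end_near. Qed.

End projections.

(** * Pairing with charges *)

Section charges.
Context {R : realType}.
Notation S2 := (@sphere R).
Implicit Types (x y w : space3 R) (u f g h : space3 R -> R) (k : R -> R).
Implicit Types (rho : {charge set (space3 R) -> \bar R}) (Omega : set (space3 R)).

Local Notation mS := (@measurable_sphere R).
Local Notation "'\oint_' w f" := (\int[surface]_(w in @sphere R) f)
  (at level 36, w at level 0, f at level 36).
Local Notation bm := (bounded_measurable S2).

Let fs : {finite_measure set (space3 R) -> \bar R} := surface.

(** Hides the chosen Hahn decomposition: every fact about charges is then a difference of two facts
    about finite measures. *)
Lemma charge_RintegralE rho :
  exists m1 m2 : {finite_measure set (space3 R) -> \bar R},
    (forall D f, charge_Rintegral rho D f = \int[m1]_(x in D) f x - \int[m2]_(x in D) f x) /\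
    (forall A, measurable A -> fine (rho A) = fine (m1 A) - fine (m2 A)).
Proof.
rewrite /charge_Rintegral; case: cid => P exN; case: cid => N nuPN.
exists (jordan_pos nuPN), (jordan_neg nuPN); split => // A mA.
rewrite (jordan_decomp nuPN mA) /cadd /= cscaleN1.
by rewrite -fineB// fin_num_measure.
Qed.

Definition charge_on_cap rho Omega (theta : R) x := fine (rho (cap x theta `&` Omega)).

Lemma measurable_cap x theta : measurable (cap x theta).
Proof.
apply: measurableI; first exact: mS.
have := measurable_dotl x measurableT (measurable_itv `[cos theta, +oo[).
rewrite setTI; congr measurable; apply/seteqP; split => y /=; rewrite in_itv/= ?andbT//.
Qed.

Lemma bounded_measurableS d (T : measurableType d) (D E : set T) (f : T -> R) :
  measurable E -> D `<=` E -> bounded_measurable E f -> bounded_measurable D f.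
Proof.
move=> mE DE [mf [M fM]]; split; first exact: measurable_funS mf.
by exists M => x /DE; exact: fM.
Qed.

Section one_measure.
Variables (m : {finite_measure set (space3 R) -> \bar R}) (Omega : set (space3 R)).
Hypotheses (mO : measurable Omega) (OS : Omega `<=` S2).

Let bG theta h : bm h -> bounded_measurable (Omega `*` S2)
  (fun z : space3 R * space3 R => upper (cos theta) (dot z.1 z.2) * h z.2).
Proof.
move=> bh; apply: (@bounded_measurableS _ _ _ (S2 `*` S2)).
- by apply: measurableX; exact: mS.
- by move=> [y x] [/OS Sy Sx].
- exact: bm_kernelM (kernel_upper _) bh.
Qed.

Let section_cap theta (c : R) x : S2 x ->
  \int[m]_(y in Omega) (upper (cos theta) (dot y x) * c) = c * fine (m (cap x theta `&` Omega)).
Proof.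
move=> Sx.
transitivity (\int[m]_(y in Omega) (c * \1_(cap x theta) y)).
  apply: eq_Rintegral => y; rewrite inE => /OS Sy; rewrite mulrC /upper indicE; congr (_ * (nat_of_bool _)%:R).
  apply/idP/idP; first by move=> h; rewrite mem_set//; split => //; rewrite dotC.
  by rewrite inE => -[_]; rewrite dotC.
rewrite RintegralZl//.
  by rewrite /Rintegral integral_indic//; exact: measurable_cap.
apply: bounded_measurable_integrable => //; split.
  by apply: measurable_funTS; apply: measurable_indic; exact: measurable_cap.
by exists 1 => y _; rewrite indicE; case: (_ \in _); rewrite ?normr0 ?normr1.
Qed.

(** Fubini together with the symmetry of caps: y lies in the cap about x exactly when x lies in the
    cap about y. *)
Lemma measure_cap_pairing theta h : bm h ->
  \int[m]_(y in Omega) zonal_transform (upper (cos theta)) h y =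
  \oint_x (h x * fine (m (cap x theta `&` Omega))).
Proof.
move=> bh; have := Rintegral_fubini m fs mO mS (bG theta bh) => /= e.
rewrite /zonal_transform e; apply: eq_Rintegral => x; rewrite inE => Sx.
exact: section_cap.
Qed.

(** The mass of a moving cap is a partial integral of the indicator of proximity, so Fubini gives
    measurability; the factor 1 puts it in the form of [bm_kernelM]. *)
Lemma bm_measure_cap theta : bm (fun x => fine (m (cap x theta `&` Omega))).
Proof.
have b1 : bm (fun=> 1 : R) by exact: (bounded_measurable_cst _ (1 : R)).
have bG' : bounded_measurable (S2 `*` Omega)
    (fun z : space3 R * space3 R => upper (cos theta) (dot z.1 z.2) * 1).
  apply: (@bounded_measurableS _ _ _ (S2 `*` S2)).
  - by apply: measurableX; exact: mS.
  - by move=> [x y] [Sx /OS Sy].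
  - exact: bm_kernelM (kernel_upper _) b1.
have [mF [M FM]] := bounded_measurable_Rintegral2 fs m mS mO bG'.
have e x : S2 x -> \int[m]_(y in Omega) (upper (cos theta) (dot x y) * 1) =
    fine (m (cap x theta `&` Omega)).
  move=> Sx; rewrite -[RHS]mul1r -section_cap//.
  by apply: eq_Rintegral => y _; rewrite dotC.
split; last by exists M => x Sx; rewrite -e//; exact: FM.
by apply: (eq_measurable_fun _ _ mF) => x; rewrite inE => /e.
Qed.

(** Dominated convergence: every smoothing obeys the same sup bound as u. *)
Lemma Rintegral_smoothing_cvg u : bm u -> (forall y, S2 y -> {for y, continuous u}) ->
  \int[m]_(y in Omega) smoothing u N y @[N --> \oo] --> \int[m]_(y in Omega) u y.
Proof.
move=> bu cu; have [mu [M uM]] := bu.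
have bO f : bm f -> bounded_measurable Omega f.
  by apply: bounded_measurableS => //; exact: mS.
have bs N : bm (smoothing u N) by exact: bm_zonal_transform (kernel_horner _) bu.
have bMO : bounded_measurable Omega (fun=> M) by exact: bounded_measurable_cst.
have ms N : measurable_fun Omega (fun y => (smoothing u N y)%:E).
  by apply/measurable_EFinP; exact: (bO _ (bs N)).1.
have mu' : measurable_fun Omega (fun y => (u y)%:E) by apply/measurable_EFinP; exact: (bO _ bu).1.
have cv : {ae m, forall y, Omega y -> (smoothing u N y)%:E @[N --> \oo] --> (u y)%:E}.
  apply: aeW => y /OS Sy; apply: cvg_EFin; first exact: nearW.
  exact: (smoothing_cvg bu Sy (cu _ Sy)).
have dom : {ae m, forall y N, Omega y -> (`|(smoothing u N y)%:E| <= M%:E)%E}.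
  by apply: aeW => y N Oy; rewrite lee_fin; apply: smoothing_bound => //; exact: OS.
have iM : m.-integrable Omega (fun=> M%:E) by exact: (bounded_measurable_integrable m mO bMO).
have [_ _ dc] := dominated_convergence mO ms mu' cv iM dom.
have fin f : bm f -> (\int[m]_(y in Omega) (f y)%:E)%E \is a fin_num.
  by move=> bf; apply: integrable_fin_num => //; exact: (bounded_measurable_integrable m mO (bO _ bf)).
by apply: fine_cvg; rewrite fineK//; exact: fin.
Qed.

End one_measure.

Section one_charge.
Variables (rho : {charge set (space3 R) -> \bar R}) (Omega : set (space3 R)).
Hypotheses (mO : measurable Omega) (OS : Omega `<=` S2).

Lemma bm_charge_on_cap theta : bm (charge_on_cap rho Omega theta).
Proof.
have [m1 [m2 [_ rhoE]]] := charge_RintegralE rho.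
have := bounded_measurableB (bm_measure_cap m1 mO OS theta) (bm_measure_cap m2 mO OS theta).
congr bounded_measurable; apply/funext => x; rewrite /charge_on_cap rhoE//.
by apply: measurableI => //; exact: measurable_cap.
Qed.

Lemma charge_cap_pairing theta h : bm h ->
  charge_Rintegral rho Omega (zonal_transform (upper (cos theta)) h) =
  \oint_x (h x * charge_on_cap rho Omega theta x).
Proof.
move=> bh; have [m1 [m2 [-> rhoE]]] := charge_RintegralE rho.
rewrite !measure_cap_pairing// -sphere_intB.
- apply: eq_Rintegral => x _; rewrite -mulrBr /charge_on_cap rhoE//.
  by apply: measurableI => //; exact: measurable_cap.
- by apply: bounded_measurableM => //; exact: bm_measure_cap.
- by apply: bounded_measurableM => //; exact: bm_measure_cap.
Qed.

Lemma eq_charge_Rintegral f g : {in Omega, f =1 g} ->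
  charge_Rintegral rho Omega f = charge_Rintegral rho Omega g.
Proof.
have [m1 [m2 [rE _]]] := charge_RintegralE rho => fg.
by rewrite !rE; congr (_ - _); exact: eq_Rintegral.
Qed.

Lemma charge_RintegralD f g : bm f -> bm g ->
  charge_Rintegral rho Omega (fun x => f x + g x) =
  charge_Rintegral rho Omega f + charge_Rintegral rho Omega g.
Proof.
have [m1 [m2 [rE _]]] := charge_RintegralE rho => bf bg; rewrite !rE.
have bO h : bm h -> bounded_measurable Omega h.
  by apply: bounded_measurableS => //; exact: mS.
by rewrite !Rintegral_bmD//; [ring|exact: bO..].
Qed.

Lemma charge_smoothing_cvg u : bm u -> (forall y, S2 y -> {for y, continuous u}) ->
  charge_Rintegral rho Omega (smoothing u N) @[N --> \oo] --> charge_Rintegral rho Omega u.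
Proof.
have [m1 [m2 [rE _]]] := charge_RintegralE rho => bu cu; rewrite rE.
under eq_fun do rewrite rE.
by apply: cvgB; exact: Rintegral_smoothing_cvg.
Qed.

Definition cap_L2 theta := \oint_x (charge_on_cap rho Omega theta x ^+ 2).

Lemma zonal_transform_combination k u (c : nat -> R) N y : zonal_kernel k -> bm u -> S2 y ->
  zonal_transform k (fun x => \sum_(n < N) c n * harmonic_part u n x) y =
  \sum_(n < N) c n * zonal_mean (fun t => k t * (legendre n).[t]) * harmonic_part u n y.
Proof.
move=> hk bu Sy; have bp n := bm_harmonic_part n bu; have bk := bm_kernel_dotl hk Sy.
transitivity (\oint_x (\sum_(n < N) c n * (k (dot y x) * harmonic_part u n x))).
  apply: eq_Rintegral => x _; rewrite mulr_sumr; apply: eq_bigr => n _; ring.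
rewrite sphere_int_sum => [|n _]; last first.
  by apply: bounded_measurableZ; exact: bounded_measurableM.
apply: eq_bigr => n _; rewrite sphere_intZ; last exact: bounded_measurableM.
by rewrite -mulrA -zonal_transform_harmonic_part.
Qed.

(** After [charge_cap_pairing], Cauchy-Schwarz separates the caps from the combination of
    components, whose norm orthogonality turns into a weighted sum of energies. *)
Lemma pairing_estimate theta u (c W : nat -> R) (A : R) N : bm u -> 0 <= A ->
  (forall n, 0 <= W n) -> (forall n, c n ^+ 2 <= A ^+ 2 * W n) ->
  `|charge_Rintegral rho Omega (zonal_transform (upper (cos theta))
       (fun x => \sum_(n < N) c n * harmonic_part u n x))| <=
  A * Num.sqrt (\sum_(n < N) W n * energy u n) * Num.sqrt (cap_L2 theta).
Proof.
move=> bu A0 W0 cW; have bp n := bm_harmonic_part n bu.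
have bh : bm (fun x => \sum_(n < N) c n * harmonic_part u n x).
  by apply: bounded_measurable_sum => n _; exact: bounded_measurableZ.
rewrite charge_cap_pairing//.
set I := \oint_x _.
have I2 : I ^+ 2 <= A ^+ 2 * (\sum_(n < N) W n * energy u n) * cap_L2 theta.
  apply: le_trans (sphere_cauchy_schwarz bh (bm_charge_on_cap theta)) _.
  rewrite energy_combination//; apply: ler_wpM2r.
    by apply: Rintegral_ge0 => x _; exact: sqr_ge0.
  rewrite mulr_sumr; apply: ler_sum => n _.
  by rewrite mulrA ler_wpM2r// energy_ge0.
have E0 : 0 <= \sum_(n < N) W n * energy u n.
  by apply: sumr_ge0 => n _; rewrite mulr_ge0// energy_ge0.
have C0 : 0 <= cap_L2 theta by apply: Rintegral_ge0 => x _; exact: sqr_ge0.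
rewrite -sqrtr_sqr -[A in X in _ <= X](ger0_norm A0) -(sqrtr_sqr A).
rewrite -sqrtrM ?sqr_ge0// -sqrtrM ?mulr_ge0 ?sqr_ge0//.
by rewrite ler_wsqrtr.
Qed.

(** In each degree c1 and c2 share the reconstruction between two radii, so that both parts of the
    theorem are instances: (1) takes c2 = 0, while in (2) one of the two vanishes in each degree. *)
Lemma smoothing_estimate theta1 theta2 u (c1 c2 W : nat -> R) (A : R) N :
  bm u -> 0 <= A -> (forall n, 0 <= W n) ->
  (forall n, c1 n ^+ 2 <= A ^+ 2 * W n) -> (forall n, c2 n ^+ 2 <= A ^+ 2 * W n) ->
  (forall n, c1 n * cap_multiplier n theta1 + c2 n * cap_multiplier n theta2 = 1) ->
  `|charge_Rintegral rho Omega (smoothing u N)| <=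
  A * Num.sqrt (\sum_(n < N.+1) W n * energy u n) *
    (Num.sqrt (cap_L2 theta1) + Num.sqrt (cap_L2 theta2)).
Proof.
move=> bu A0 W0 cW1 cW2 c12; have bp n := bm_harmonic_part n bu.
pose h (c : nat -> R) x := \sum_(n < N.+1) (peak_weight N n * c n) * harmonic_part u n x.
have bh c : bm (h c).
  by apply: bounded_measurable_sum => n _; exact: bounded_measurableZ.
have bT theta c : bm (zonal_transform (upper (cos theta)) (h c)).
  exact: bm_zonal_transform (kernel_upper _) (bh c).
rewrite (@eq_charge_Rintegral _ (fun y => zonal_transform (upper (cos theta1)) (h c1) y +
   zonal_transform (upper (cos theta2)) (h c2) y)); last first.
  move=> y; rewrite inE => /OS Sy; rewrite smoothingE//.
  rewrite !(zonal_transform_combination (fun n => peak_weight N n * _ n))//; last 2 first.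
  - exact: kernel_upper.
  - exact: kernel_upper.
  rewrite -big_split/=; apply: eq_bigr => n _.
  have := c12 n; rewrite /cap_multiplier; set a := zonal_mean _; set b := zonal_mean _ => e.
  by rewrite -[peak_weight N n in LHS]mulr1 -e; ring.
rewrite charge_RintegralD//; apply: le_trans (ler_normD _ _) _; rewrite mulrDr.
have wc c n : c n ^+ 2 <= A ^+ 2 * W n -> (peak_weight N n * c n) ^+ 2 <= A ^+ 2 * W n.
  apply: le_trans; rewrite exprMn ler_piMl ?sqr_ge0//.
  by have := peak_weight_le1 N n (R := R); rewrite -real_normK ?num_real// => h1; rewrite exprn_ile1.
apply: lerD.
  exact: (pairing_estimate theta1 N.+1 bu A0 W0 (fun n => wc c1 n (cW1 n))).
exact: (pairing_estimate theta2 N.+1 bu A0 W0 (fun n => wc c2 n (cW2 n))).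
Qed.

(** The finite estimates pass to the limit N to infinity, their sums being dominated by the full
    series. *)
Lemma real_estimate theta1 theta2 u (c1 c2 W : nat -> R) (A : R) :
  bm u -> (forall y, S2 y -> {for y, continuous u}) -> 0 < A -> (forall n, 0 <= W n) ->
  (forall n, c1 n ^+ 2 <= A ^+ 2 * W n) -> (forall n, c2 n ^+ 2 <= A ^+ 2 * W n) ->
  (forall n, c1 n * cap_multiplier n theta1 + c2 n * cap_multiplier n theta2 = 1) ->
  (`|charge_Rintegral rho Omega u|%:E <=
  A%:E * sqrte (\sum_(0 <= n <oo) (W n)%:E * (energy u n)%:E) *
    (sqrte (cap_L2 theta1)%:E + sqrte (cap_L2 theta2)%:E))%E.
Proof.
move=> bu cu A0 W0 cW1 cW2 c12.
have est N := smoothing_estimate N bu (ltW A0) W0 cW1 cW2 c12.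
have cv : `|charge_Rintegral rho Omega (smoothing u N)| @[N --> \oo] -->
    `|charge_Rintegral rho Omega u|.
  by apply: cvg_norm; exact: charge_smoothing_cvg.
set C := _ + _ in est; rewrite -[X in (_ <= _ * X)%E]/(C%:E).
have C0 : 0 <= C by rewrite addr_ge0.
have t0 n : (0 <= (W n)%:E * (energy u n)%:E)%E by rewrite mule_ge0// lee_fin// energy_ge0.
(* Since 0 * +oo = 0 in the extended reals, vanishing cap norms must force a vanishing pairing even
   if the series diverges; this follows from the finite estimates. *)
have [Cz|Cn] := eqVneq C 0.
  rewrite Cz mule0 lee_fin; apply: (ler_cvg_to cv (cvg_cst _)).
  by apply: nearW => N; have := est N; rewrite Cz mulr0.
have Cp : 0 < C by rewrite lt_neqAle eq_sym Cn.
set S := (\sum_(0 <= n <oo) _)%E.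
have S0 : (0 <= S)%E by apply: nneseries_ge0 => n _ _; exact: t0.
have part N : ((\sum_(n < N) W n * energy u n)%:E <= S)%E.
  rewrite -sumEFin -(big_mkord xpredT (fun n => (W n * energy u n)%:E)).
  under eq_bigr do rewrite EFinM.
  by apply: nneseries_lim_ge => n _ _; exact: t0.
case: S S0 part => [s| |] //= S0 part; last first.
  by rewrite gt0_muley ?lte_fin// gt0_mulye ?lte_fin// leey.
rewrite -!EFinM lee_fin; apply: (ler_cvg_to cv (cvg_cst _)).
apply: nearW => N; apply: le_trans (est N) _.
apply: ler_wpM2r => //; apply: ler_wpM2l; first exact: ltW.
by apply: ler_wsqrtr; have := part N.+1; rewrite lee_fin.
Qed.

End one_charge.
End charges.

(** * A perturbed harmonic oscillator *)

Section mvt.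
Context {R : realType}.

Lemma mvt_itv (f df : R -> R) (x y : R) : x <= y ->
  (forall z, x <= z <= y -> is_derive z 1 f (df z)) ->
  exists2 z, x <= z <= y & f y - f x = df z * (y - x).
Proof.
move=> xy hf.
have [||z] := @MVT_segment R f df x y xy.
- by move=> z; rewrite in_itv/= => /andP[xz zy]; apply: hf; rewrite !ltW.
- apply: derivable_within_continuous => z; rewrite in_itv/= => zxy.
  by have [] := hf z zxy.
by rewrite in_itv/= => zxy e; exists z.
Qed.

Lemma mvt_bound (f df : R -> R) (a b M x y : R) :
  (forall z, a <= z <= b -> is_derive z 1 f (df z)) ->
  (forall z, a <= z <= b -> `|df z| <= M) ->
  a <= x <= b -> a <= y <= b -> `|f y - f x| <= M * `|y - x|.
Proof.
move=> hf hM; wlog xy : x y / x <= y.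
  move=> h ax ay; have [xy|yx] := leP x y; first exact: h.
  by rewrite distrC [`|y - x|]distrC; apply: h => //; exact: ltW.
move=> /andP[ax xb] /andP[ay yb].
have [|z /andP[xz zy] ->] := @mvt_itv f df x y xy.
  move=> z /andP[xz zy]; apply: hf; apply/andP; split; lra.
by rewrite normrM ler_wpM2r// hM//; apply/andP; split; lra.
Qed.

Lemma mvt_nondecreasing (f df : R -> R) (a b x y : R) :
  (forall z, a <= z <= b -> is_derive z 1 f (df z)) ->
  (forall z, a <= z <= b -> 0 <= df z) ->
  a <= x -> x <= y -> y <= b -> f x <= f y.
Proof.
move=> hf hM ax xy yb.
have [|z /andP[xz zy] e] := @mvt_itv f df x y xy.
  move=> z /andP[xz zy]; apply: hf; apply/andP; split; lra.
rewrite -subr_ge0 e mulr_ge0 ?subr_ge0//; apply: hM; apply/andP; split; lra.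
Qed.

Lemma is_derive_mul (f g : R -> R) (x df dg : R) :
  is_derive x 1 f df -> is_derive x 1 g dg ->
  is_derive x 1 (fun t => f t * g t) (df * g x + f x * dg).
Proof.
move=> hf hg; have h := is_deriveM hf hg.
by apply: (is_derive_eq h); rewrite /GRing.scale /=; ring.
Qed.

Lemma is_derive_add (f g : R -> R) (x df dg : R) :
  is_derive x 1 f df -> is_derive x 1 g dg ->
  is_derive x 1 (fun t => f t + g t) (df + dg).
Proof. by move=> hf hg; exact: is_deriveD. Qed.

Lemma is_derive_scale (f : R -> R) (k x df : R) :
  is_derive x 1 f df -> is_derive x 1 (fun t => k * f t) (k * df).
Proof. by move=> hf; exact: (is_deriveZ k hf). Qed.

Lemma is_derive_compose (f g : R -> R) (x df dg : R) :
  is_derive (g x) 1 f df -> is_derive x 1 g dg ->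
  is_derive x 1 (fun t => f (g t)) (dg * df).
Proof. by move=> hf hg; apply: (is_derive_eq (is_derive1_comp hf hg)); rewrite mulrC. Qed.

End mvt.

Section oscillator.
Context {R : realType}.
Variables (a b t0 m K : R) (W W1 q : R -> R).
Hypothesis t0ab : a <= t0 <= b.
Hypothesis ab2 : forall t, a <= t <= b -> `|t - t0| <= 2.
Hypothesis m1 : 1 <= m.
Hypothesis K0 : 0 <= K.
Hypothesis Km : 4 * K <= m.
Hypothesis dW : forall t, a <= t <= b -> is_derive t 1 W (W1 t).
Hypothesis dW1 : forall t, a <= t <= b -> is_derive t 1 W1 (- (m ^+ 2 - q t) * W t).
Hypothesis qK : forall t, a <= t <= b -> 0 <= q t <= K.

Definition osc_energy t := W t ^+ 2 + (W1 t / m) ^+ 2.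

Let m0 : 0 < m. Proof. exact: lt_le_trans ltr01 m1. Qed.
Let mn0 : m != 0. Proof. by rewrite gt_eqF. Qed.

Let E := osc_energy.
(** The unperturbed oscillator conserves the energy, so only q contributes. *)
Let dE t := 2 * (W1 t / m) * (q t / m * W t).

Let derE t : a <= t <= b -> is_derive t 1 E (dE t).
Proof.
move=> tab.
have h1 := is_derive_mul (dW tab) (dW tab).
have h2 := is_derive_mul (is_derive_scale m^-1 (dW1 tab)) (is_derive_scale m^-1 (dW1 tab)).
have h := is_derive_add h1 h2.
have -> : E = fun t => W t * W t + m^-1 * W1 t * (m^-1 * W1 t).
  by apply/funext => u; rewrite /E /osc_energy; ring.
by apply: (is_derive_eq h); rewrite /dE; field.
Qed.

Let E0 t : 0 <= E t.
Proof. by rewrite addr_ge0// sqr_ge0. Qed.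

Let dE_bound t : a <= t <= b -> `|dE t| <= K / m * E t.
Proof.
move=> tab; have /andP[q0 qk] := qK tab.
have -> : dE t = q t / m * (2 * (W1 t / m) * W t) by rewrite /dE; ring.
have qm : 0 <= q t / m by rewrite divr_ge0// ltW.
rewrite normrM (ger0_norm qm); apply: ler_pM => //.
  by rewrite ler_wpM2r// invr_ge0 ltW.
rewrite /E /osc_energy ler_norml.
have := sqr_ge0 (W t + W1 t / m); have := sqr_ge0 (W t - W1 t / m).
move: (W1 t / m) => w1; rewrite !expr2 => h1 h2.
by apply/andP; split; lra.
Qed.

(** Both halves of Gronwall's inequality at once: for sg = 1 the energy times exp(K t / m) does not
    decrease, for sg = -1 the energy times exp(- K t / m) does not increase. *)
Let gronwall (sg : R) x y : sg = 1 \/ sg = -1 -> a <= x -> x <= y -> y <= b ->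
  sg * (E x * expR (sg * (K / m) * x)) <= sg * (E y * expR (sg * (K / m) * y)).
Proof.
move=> hs ax xy yb.
pose k := sg * (K / m).
have dF t : a <= t <= b -> is_derive t 1 (fun u => sg * (E u * expR (k * u)))
    (sg * (dE t * expR (k * t) + E t * (k * 1 * expR (k * t)))).
  move=> tab; apply: is_derive_scale; apply: is_derive_mul; first exact: derE.
  apply: (@is_derive_compose _ expR (fun u => k * u)).
apply: (mvt_nondecreasing dF _ ax xy yb) => t tab.
have := dE_bound tab; rewrite ler_norml => /andP[h1 h2].
have -> : sg * (dE t * expR (k * t) + E t * (k * 1 * expR (k * t))) =
  (sg * dE t + sg ^+ 2 * (K / m * E t)) * expR (k * t) by rewrite /k; ring.
apply: mulr_ge0; last exact: expR_ge0.
by case: hs => ->; lra.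
Qed.

(** Here 4 K <= m and the length 2 meet: the exponent is at most 1/2, and exp(-x) >= 1 - x. *)
Let half_exp t : 0 <= t -> t <= 2 -> 1 / 2 <= expR (- (K / m * t)).
Proof.
move=> u0 u2; have := @expR_ge1Dx R (- (K / m * t)).
have : K / m * t <= 1 / 2.
  apply: (@le_trans _ _ (1 / 4 * 2)); last by lra.
  apply: ler_pM => //; first by rewrite divr_ge0// ltW.
  by rewrite ler_pdivrMr//; move: Km; lra.
by lra.
Qed.

Lemma osc_energy_bounds t : a <= t <= b -> E t0 / 2 <= E t /\ E t <= 2 * E t0.
Proof.
move=> tab; have := ab2 tab; have /andP[at' tb] := tab; have /andP[a0 b0] := t0ab.
have key x y : a <= x -> x <= y -> y <= b -> y - x <= 2 -> E x / 2 <= E y /\ E y <= 2 * E x.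
  move=> ax xy yb yx2; have yx : 0 <= y - x by rewrite subr_ge0.
  have h := half_exp yx yx2; set e := expR _ in h.
  have up := gronwall (or_introl (erefl 1)) ax xy yb.
  have dn := gronwall (or_intror (erefl (-1))) ax xy yb.
  rewrite !mul1r in up; rewrite !mulN1r lerN2 in dn.
  have eup : expR (K / m * x) = e * expR (K / m * y).
    by rewrite /e -expRD; congr expR; ring.
  have edn : expR (- (K / m) * y) = e * expR (- (K / m) * x).
    by rewrite /e -expRD; congr expR; ring.
  rewrite eup mulrA ler_pM2r ?expR_gt0// in up.
  rewrite edn mulrA ler_pM2r ?expR_gt0// in dn.
  have := E0 x; have := E0 y => Ey Ex.
  have := ler_wpM2l Ex h; have := ler_wpM2l Ey h => i1 i2.
  by split; lra.
have [t0t|tt0] := leP t0 t.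
  by rewrite ger0_norm ?subr_ge0// => h; exact: key.
rewrite ltr0_norm ?subr_lt0// => h.
have [] := key t t0 at' (ltW tt0) b0 _; first by lra.
by lra.
Qed.

Let r0 := Num.sqrt (E t0).

Let r0E : r0 ^+ 2 = E t0. Proof. by rewrite sqr_sqrtr. Qed.
Let r00 : 0 <= r0. Proof. exact: sqrtr_ge0. Qed.

Let W_le t : a <= t <= b -> `|W t| <= 2 * r0.
Proof.
move=> tab; have [_ h] := osc_energy_bounds tab.
rewrite -ler_sqr ?nnegrE ?mulr_ge0// real_normK ?num_real// exprMn r0E.
have := sqr_ge0 (W1 t / m); have := E0 t0.
by move: h; rewrite /E /osc_energy; lra.
Qed.

Let phi t := m * (t - t0).
(* [W] and [W1 / m] in the frame rotating with the unperturbed oscillator, where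
   they would be constant. *)
Let X t := W t * cos (phi t) - W1 t / m * sin (phi t).
Let Y t := W t * sin (phi t) + W1 t / m * cos (phi t).

Let dphi (t : R) : is_derive t (1 : R) phi m.
Proof.
have -> : phi = fun t => m * t + (- (m * t0)) by apply/funext => u; rewrite /phi; ring.
have h := is_derive_add (is_derive_scale m (is_derive_id t (1 : R))) (is_derive_cst (- (m * t0)) t (1 : R)).
by apply: (is_derive_eq h); rewrite mulr1 addr0.
Qed.

Let dcos (t : R) : is_derive t (1 : R) (fun u => cos (phi u)) (m * - sin (phi t)).
Proof. exact: is_derive_compose (is_derive_cos _) (dphi t). Qed.

Let dsin (t : R) : is_derive t (1 : R) (fun u => sin (phi u)) (m * cos (phi t)).
Proof. exact: is_derive_compose (is_derive_sin _) (dphi t). Qed.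

Let dX t : a <= t <= b -> is_derive t 1 X (- (q t / m * W t * sin (phi t))).
Proof.
move=> tab.
have h1 := is_derive_mul (dW tab) (dcos t).
have h2 := is_derive_scale (- m^-1) (is_derive_mul (dW1 tab) (dsin t)).
have h := is_derive_add h1 h2.
have -> : X = fun t => W t * cos (phi t) + - m^-1 * (W1 t * sin (phi t)).
  by apply/funext => u; rewrite /X; ring.
by apply: (is_derive_eq h); field.
Qed.

Let dY t : a <= t <= b -> is_derive t 1 Y (q t / m * W t * cos (phi t)).
Proof.
move=> tab.
have h1 := is_derive_mul (dW tab) (dsin t).
have h2 := is_derive_scale m^-1 (is_derive_mul (dW1 tab) (dcos t)).
have h := is_derive_add h1 h2.
have -> : Y = fun t => W t * sin (phi t) + m^-1 * (W1 t * cos (phi t)).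
  by apply/funext => u; rewrite /Y; ring.
by apply: (is_derive_eq h); field.
Qed.

Let qW_bound t : a <= t <= b -> `|q t / m * W t| <= 2 * (K / m) * r0.
Proof.
move=> tab; have /andP[q0 qk] := qK tab.
have qm : 0 <= q t / m by rewrite divr_ge0// ltW.
rewrite normrM (ger0_norm qm) [leRHS](_ : _ = K / m * (2 * r0)); last by ring.
apply: ler_pM => //; first by rewrite ler_wpM2r// invr_ge0 ltW.
exact: W_le.
Qed.

(** Variation of constants: [X] and [Y] move with speed at most (K / m) |W| <= 2 (K / m) r0. The 8
    is this 2, times the length 2, times two components. *)
Lemma osc_asymptotics t : a <= t <= b ->
  `|W t - (W t0 * cos (phi t) + W1 t0 / m * sin (phi t))| <= 8 * (K / m) * r0.
Proof.
move=> tab.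
have M0 : 0 <= 2 * (K / m) * r0 by apply: mulr_ge0 r00; apply: mulr_ge0 => //; exact: divr_ge0 K0 (ltW m0).
have sc1 u : `|sin u : R| <= 1 by rewrite ler_norml sin_geN1 sin_le1.
have cc1 u : `|cos u : R| <= 1 by rewrite ler_norml cos_geN1 cos_le1.
have hX : `|X t - X t0| <= 2 * (K / m) * r0 * `|t - t0|.
  apply: (mvt_bound dX) => // z zab; rewrite normrN normrM.
  by apply: le_trans (qW_bound zab); rewrite ler_piMr.
have hY : `|Y t - Y t0| <= 2 * (K / m) * r0 * `|t - t0|.
  apply: (mvt_bound dY) => // z zab; rewrite normrM.
  by apply: le_trans (qW_bound zab); rewrite ler_piMr.
have t2 := ler_wpM2l M0 (ab2 tab).
have X0 : X t0 = W t0 by rewrite /X /phi subrr mulr0 cos0 sin0; ring.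
have Y0 : Y t0 = W1 t0 / m by rewrite /Y /phi subrr mulr0 cos0 sin0; ring.
have WXY : W t = X t * cos (phi t) + Y t * sin (phi t).
  have := cos2Dsin2 (phi t); rewrite /X /Y => cs.
  transitivity (W t * (cos (phi t) ^+ 2 + sin (phi t) ^+ 2)); last by ring.
  by rewrite cs mulr1.
rewrite -X0 -Y0 WXY.
have -> : X t * cos (phi t) + Y t * sin (phi t) - (X t0 * cos (phi t) + Y t0 * sin (phi t)) =
  (X t - X t0) * cos (phi t) + (Y t - Y t0) * sin (phi t) by ring.
apply: le_trans (ler_normD _ _) _; rewrite !normrM.
have := ler_wpM2l (normr_ge0 (X t - X t0)) (cc1 (phi t)).
have := ler_wpM2l (normr_ge0 (Y t - Y t0)) (sc1 (phi t)).
by lra.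
Qed.

(* Where W is small its derivative is not, since the energy is bounded below. *)
Lemma osc_sublevel (eps x y : R) : eps <= 1 / 4 -> 0 < r0 -> a <= x <= b -> a <= y <= b ->
  `|y - x| <= (8 * m)^-1 -> `|W x| <= eps * r0 -> `|W y| <= eps * r0 ->
  `|y - x| <= 8 * eps / m.
Proof.
move=> e4 r0p; wlog xy : x y / x <= y.
  move=> h xab yab d hx hy; have [xy|yx] := leP x y; first exact: h.
  by rewrite distrC; apply: h => //; [exact: ltW|rewrite distrC].
move=> xab yab; have yx : 0 <= y - x by rewrite subr_ge0.
rewrite (ger0_norm yx) => d hx hy.
have e0 : 0 <= eps.
  by rewrite -(pmulr_lge0 _ r0p); apply: le_trans (normr_ge0 _) hx.
have [lo _] := osc_energy_bounds xab.
(* The energy at x is at least r0^2 / 2 and W^2 takes at most r0^2 / 16 of it, so more than r0^2 / 4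
   is left for (W1 / m)^2. *)
have W1x : m * r0 / 2 <= `|W1 x|.
  have Wx2 : W x ^+ 2 <= r0 ^+ 2 / 16.
    rewrite -[W x ^+ 2]real_normK ?num_real//.
    have : `|W x| <= r0 / 4 by apply: le_trans hx _; have := ler_wpM2r r00 e4; lra.
    move=> h; have := ler_pM (normr_ge0 _) (normr_ge0 _) h h.
    by rewrite -expr2 => h2; lra.
  have mr0 : 0 <= m * r0 / 2 by rewrite divr_ge0// mulr_ge0// ltW.
  rewrite -ler_sqr ?nnegrE//.
  rewrite real_normK ?num_real//.
  move: lo; rewrite /E -/E -r0E /osc_energy /E /osc_energy expr_div_n => lo.
  have m2 : 0 < m ^+ 2 by rewrite exprn_gt0.
  have : r0 ^+ 2 / 4 <= W1 x ^+ 2 / m ^+ 2.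
    by have := sqr_ge0 r0; lra.
  by rewrite ler_pdivlMr// => h; lra.
(* The slope of W1 is at most 2 m^2 r0, so over a length 1 / (8 m) at most half of the lower bound
   at x is lost. The mean value theorem then gives m r0 / 4 |y - x| <= 2 eps r0. *)
have W1z z : x <= z <= y -> m * r0 / 4 <= `|W1 z|.
  move=> /andP[xz zy].
  have zab : a <= z <= b by move: xab yab => /andP[? ?] /andP[? ?]; apply/andP; split; lra.
  have h : `|W1 z - W1 x| <= (2 * m ^+ 2 * r0) * `|z - x|.
    apply: (mvt_bound dW1) => // u uab; rewrite normrM normrN.
    have /andP[q0 qk] := qK uab.
    have Km2 : K <= m ^+ 2.
      have mm : m <= m ^+ 2 by rewrite expr2 ler_peMl// ltW.
      by move: Km K0 mm; lra.
    have mq : 0 <= m ^+ 2 - q u by lra.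
    rewrite (ger0_norm mq).
    apply: (@le_trans _ _ (m ^+ 2 * (2 * r0))); last by lra.
    by apply: ler_pM => //; [lra|exact: W_le].
  rewrite (ger0_norm (_ : 0 <= z - x)) ?subr_ge0// in h.
  have : 2 * m ^+ 2 * r0 * (z - x) <= m * r0 / 4.
    have : z - x <= (8 * m)^-1 by lra.
    have M0 : 0 <= 2 * m ^+ 2 * r0 by apply: mulr_ge0 r00; apply: mulr_ge0 => //; exact: sqr_ge0.
    move=> hz; have := ler_wpM2l M0 hz.
    have -> : 2 * m ^+ 2 * r0 * (8 * m)^-1 = m * r0 / 4 by field.
    by [].
  have := ler_normB (W1 z) (W1 z - W1 x).
  by rewrite opprB addrC subrK; lra.
have [|z zxy e] := mvt_itv xy (f := W) (df := W1).
  move=> z /andP[xz zy]; apply: dW.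
  by move: xab yab => /andP[? ?] /andP[? ?]; apply/andP; split; lra.
have h1 : `|W y - W x| <= 2 * (eps * r0).
  by apply: le_trans (ler_normB _ _) _; lra.
rewrite e normrM (ger0_norm yx) in h1.
have := ler_wpM2r yx (W1z z zxy) => h2.
have h3 : r0 * (m / 4 * (y - x)) <= r0 * (2 * eps) by lra.
rewrite ler_pM2l// in h3.
by rewrite ler_pdivlMr//; lra.
Qed.

End oscillator.

Lemma sinD_natpi (R : realType) k (x : R) : sin (x + k%:R * pi) = (-1) ^+ k * sin x.
Proof. by rewrite mulr_natl alternatingn// => u; exact: sinDpi. Qed.

(** * The cap multipliers as solutions of an oscillator equation *)

Section legendre_oscillator.
Context {R : realType}.
Variable n : nat.
Hypothesis n0 : (0 < n)%N.
Local Notation P := (legendre n : {poly R}).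
Local Notation P' := (P^`()).

Let N : R := n%:R * (n%:R + 1).
Let m : R := n%:R + 1 / 2.

Let n1 : 1 <= n%:R :> R. Proof. by rewrite ler1n. Qed.
Let N0 : 0 < N. Proof. by apply: mulr_gt0; move: n1; lra. Qed.
Let odd_eq : odd n -> exists k, n = (2 * k).+1.
Proof. by move=> on; exists n./2; have := odd_double_half n; rewrite on; lia. Qed.
Let even_eq : ~~ odd n -> exists k, n = (2 * k)%N.
Proof. by move=> en; exists n./2; have := odd_double_half n; rewrite (negbTE en); lia. Qed.
Let m0 : 0 < m. Proof. by rewrite /m; move: n1; lra. Qed.

Let ode c : (1 - c ^+ 2) * P'^`().[c] = 2 * c * P'.[c] - N * P.[c].
Proof.
have := congr1 (fun p : {poly R} => p.[c]) (legendre_ode n).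
rewrite derivM derivB derivXn derivC !hornerE /= natrM -[in n.+1%:R]addn1 natrD.
by rewrite /N !mulr_natl => h; rewrite expr2 in h *; move: h; lra.
Qed.

(** By the Legendre equation [F] has derivative 0, so n (n + 1) times the primitive of P_n equals -
    (1 - X^2) P_n' up to a constant, and the latter vanishes at 1. *)
Lemma cap_multiplier_deriv t :
  2 * N * cap_multiplier n t = sin t ^+ 2 * P'.[cos t].
Proof.
pose F : {poly R} := N *: primitive_poly P + (1 - 'X^2) * P'.
have F0 : F^`() = 0.
  rewrite /F derivD derivZ deriv_primitive legendre_ode natrM -[in n.+1%:R]addn1 natrD.
  by rewrite -scalerDl /N subrr scale0r.
have F1 c : F.[c] = F.[1] by rewrite (deriv_eq0_const F0) !hornerC.
have h := F1 (cos t); rewrite /F !hornerE /= in h.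
have s2 : sin t ^+ 2 = 1 - cos t ^+ 2 by rewrite -(cos2Dsin2 t); ring.
rewrite s2 cap_multiplierE.
set Q1 := (primitive_poly P).[1] in h *; set Qc := (primitive_poly P).[cos t] in h *.
transitivity (N * Q1 - N * Qc); first by field.
by rewrite expr1n subrr mul0r addr0 in h; rewrite -h; ring.
Qed.

(* The Liouville normal form of the Legendre equation: [W] is [sin^2 P'(cos)]
   divided by [sqrt sin], and [W1] is its derivative. *)
Let G (t : R) : R := (Num.sqrt (sin t))^-1.
Let W (t : R) : R := sin t ^+ 2 * P'.[cos t] * G t.
Let W1 (t : R) : R := (N * sin t * P.[cos t] - 1 / 2 * cos t * sin t * P'.[cos t]) * G t.
Let q (t : R) : R := 3 / (4 * sin t ^+ 2).

Let dG (t : R) : 0 < sin t -> is_derive t (1 : R) G (- (1 / 2) * (cos t / sin t) * G t).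
Proof.
move=> s0; rewrite /G.
have r0 : Num.sqrt (sin t) != 0 by rewrite gt_eqF// sqrtr_gt0.
have h1 := is_derive_compose (is_derive1_sqrt s0) (is_derive_sin t).
apply: (is_derive_eq (@is_deriveV R (fun u => Num.sqrt (sin u)) t _ 1 r0 h1)).
have -> : cos t / sin t = cos t / Num.sqrt (sin t) ^+ 2 by rewrite sqr_sqrtr// ltW.
rewrite /GRing.scale /=.
by field.
Qed.

Let dpc (p : {poly R}) (t : R) : is_derive t (1 : R) (fun u => p.[cos u]) (- sin t * p^`().[cos t]).
Proof. exact: is_derive_compose (is_derive_poly p (cos t)) (is_derive_cos t). Qed.

Let dW (t : R) : 0 < sin t -> is_derive t (1 : R) W (W1 t).
Proof.
move=> s0; have sn0 : sin t != 0 by rewrite gt_eqF.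
have h1 := is_derive_mul (is_derive_sin t) (is_derive_sin t).
have h := is_derive_mul (is_derive_mul h1 (dpc P' t)) (dG s0).
have -> : W = fun u => sin u * sin u * P'.[cos u] * G u.
  by apply/funext => u; rewrite /W expr2.
apply: (is_derive_eq h); rewrite /W1.
have o := ode (cos t); have cs := cos2Dsin2 t.
have s2 : sin t ^+ 2 = 1 - cos t ^+ 2 by rewrite -cs; ring.
rewrite -s2 in o.
apply: (@eq_trans _ _ ((2 * sin t * cos t * P'.[cos t] - sin t * (sin t ^+ 2 * P'^`().[cos t])
   - 1 / 2 * cos t * sin t * P'.[cos t]) * G t)); first by field.
by rewrite o; ring.
Qed.

Let dW1 (t : R) : 0 < sin t -> is_derive t (1 : R) W1 (- (m ^+ 2 - q t) * W t).
Proof.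
move=> s0; have sn0 : sin t != 0 by rewrite gt_eqF.
have h1 := is_derive_scale N (is_derive_mul (is_derive_sin t) (dpc P t)).
have h2 := is_derive_scale (- (1 / 2)) (is_derive_mul
  (is_derive_mul (is_derive_cos t) (is_derive_sin t)) (dpc P' t)).
have h := is_derive_mul (is_derive_add h1 h2) (dG s0).
have -> : W1 = fun u => (N * (sin u * P.[cos u]) +
    - (1 / 2) * (cos u * sin u * P'.[cos u])) * G u.
  by apply/funext => u; rewrite /W1; ring.
apply: (is_derive_eq h); rewrite /W /q.
have o := ode (cos t); have cs := cos2Dsin2 t.
have s2 : sin t ^+ 2 = 1 - cos t ^+ 2 by rewrite -cs; ring.
rewrite -s2 in o.
(* Removing the first-order term adds 1/4 to n (n + 1), which completes the square: this is why the
   frequency is n + 1/2. *)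
have mN : m ^+ 2 = N + 1 / 4 by rewrite /m /N; field.
rewrite mN.
apply: (@eq_trans _ _ ((N * cos t * P.[cos t] - N * sin t ^+ 2 * P'.[cos t]
   - 1 / 2 * (cos t ^+ 2 - sin t ^+ 2) * P'.[cos t]
   + 1 / 2 * cos t * (sin t ^+ 2 * P'^`().[cos t])
   - 1 / 2 * cos t * (N * P.[cos t] - 1 / 2 * cos t * P'.[cos t])) * G t)); first by field.
rewrite o.
apply: (@eq_trans _ _ (- ((N + 1 / 4) * sin t ^+ 2 - 3 / 4) * P'.[cos t] * G t)); last by field.
by rewrite s2; field.
Qed.

Let W_multiplier t : 0 < sin t -> W t ^+ 2 * sin t = 4 * N ^+ 2 * cap_multiplier n t ^+ 2.
Proof.
move=> s0; rewrite /W -cap_multiplier_deriv /G exprMn exprVn sqr_sqrtr ?(ltW s0)//.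
by field; rewrite gt_eqF.
Qed.

(** The squared amplitude, taken at the equator because P_n and P_n' are explicit at 0. *)
Let r2 : R := osc_energy m W W1 (pi / 2).

Let Gpihalf : G (pi / 2) = 1. Proof. by rewrite /G sin_pihalf sqrtr1 invr1. Qed.

Let W_pihalf : W (pi / 2) = P'.[0].
Proof. by rewrite /W Gpihalf sin_pihalf cos_pihalf; ring. Qed.

Let W1_pihalf : W1 (pi / 2) = N * P.[0].
Proof. by rewrite /W1 Gpihalf sin_pihalf cos_pihalf; ring. Qed.

(** By parity one of P_n(0) and P_n'(0) vanishes and the other is given by a central binomial
    coefficient. So r2 is at least of order n, which through [W_multiplier] makes n^(-3) the scale
    of a_n^2. *)
Let r2_lower : 4 * N ^+ 2 <= 8 * (n%:R + 1) ^+ 3 * r2.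
Proof.
rewrite /r2 /osc_energy W_pihalf W1_pihalf.
have [on|en] := boolP (odd n).
  have [k nk] : exists k, n = (2 * k).+1 by exact: odd_eq.
  rewrite legendre_horner0_odd// mulr0 mul0r expr0n addr0.
  have -> : P'.[0] ^+ 2 = ((2 * k).+2%:R * @central_binomial R k.+1) ^+ 2.
    by rewrite nk legendre_deriv_horner0_odd.
  have := central_binomial_ge (R := R) (ltn0Sn k).
  set b := central_binomial _; set x := k.+1%:R.
  have nx : n%:R + 1 = 2 * x :> R by rewrite /x nk -natr1 -natr1 natrM -natr1; ring.
  have -> : (2 * k).+2%:R = n%:R + 1 :> R by rewrite nk -natr1.
  rewrite [(_ * b) ^+ 2]exprMn => hb.
  have n10 : 0 <= (n%:R + 1) ^+ 4 :> R by rewrite exprn_ge0//; move: n1; lra.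
  have := ler_wpM2l n10 hb.
  have -> : (n%:R + 1) ^+ 4 * (4 * x * b ^+ 2) = (n%:R + 1) ^+ 4 * (2 * (n%:R + 1) * b ^+ 2).
    by rewrite nx; ring.
  move=> h.
  have : N ^+ 2 <= (n%:R + 1) ^+ 4.
    have -> : (n%:R + 1 : R) ^+ 4 = ((n%:R + 1) * (n%:R + 1)) ^+ 2 by ring.
    rewrite ler_sqr ?nnegrE ?(ltW N0)//.
    by rewrite /N; move: n1; nra.
  by move: h; lra.
have [k nk] : exists k, n = (2 * k)%N by exact: even_eq.
rewrite legendre_deriv_horner0_even// expr0n add0r.
have k0 : (0 < k)%N by lia.
rewrite expr_div_n [(N * _) ^+ 2]exprMn.
have := central_binomial_ge (R := R) k0.
have -> : P.[0] ^+ 2 = @central_binomial R k ^+ 2 by rewrite nk legendre_horner0_even.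
set b := central_binomial _ => hb.
have nx : 2 * k%:R = n%:R :> R by rewrite nk natrM.
rewrite [leRHS]mulrA ler_pdivlMr ?exprn_gt0//.
have N20 : 0 <= 4 * N ^+ 2 by rewrite mulr_ge0// sqr_ge0.
have b0 := sqr_ge0 b.
have : m ^+ 2 <= 2 * (n%:R + 1) ^+ 3 * b ^+ 2.
  apply: (@le_trans _ _ ((n%:R + 1) ^+ 2 * (2 * n%:R * b ^+ 2))).
    rewrite -nx; apply: (@le_trans _ _ ((n%:R + 1) ^+ 2 * 1)).
      by rewrite mulr1 ler_sqr ?nnegrE; rewrite /m; move: n1; lra.
    rewrite nx; apply: ler_wpM2l; first exact: sqr_ge0.
    by rewrite -nx; lra.
  have -> : 2 * (n%:R + 1) ^+ 3 * b ^+ 2 = (n%:R + 1) ^+ 2 * (2 * (n%:R + 1) * b ^+ 2) :> R by ring.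
  by apply: ler_wpM2l; [exact: sqr_ge0|apply: ler_wpM2r => //; lra].
move=> h; have := ler_wpM2l N20 h.
by lra.
Qed.

Let r2_gt0 : 0 < r2.
Proof.
have n3 : 0 < 8 * (n%:R + 1) ^+ 3 :> R by rewrite mulr_gt0// exprn_gt0//; move: n1; lra.
rewrite -(pmulr_rgt0 _ n3); apply: lt_le_trans r2_lower.
by rewrite mulr_gt0// exprn_gt0.
Qed.

Variable delta : R.
Hypothesis delta0 : 0 < delta.
Hypothesis delta1 : delta <= pi / 2.

Lemma sin_ge_sin_delta t : delta <= t <= pi - delta -> sin delta <= sin t.
Proof.
have p0 := pi_gt0 R.
have key u : delta <= u <= pi / 2 -> sin delta <= sin u.
  move=> /andP[du up].
  rewrite -(cosBpihalf u) -(cosBpihalf delta) -(cosN (u - _)) -(cosN (delta - _)).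
  have iu : - (u - pi / 2) \in `[0, pi] by rewrite in_itv/=; move: delta0; lra.
  have id : - (delta - pi / 2) \in `[0, pi] by rewrite in_itv/=; move: delta0 delta1; lra.
  by rewrite leNgt ltr_cos// -leNgt; lra.
move=> /andP[dt tp]; have [tp2|tp2] := leP t (pi / 2); first by apply: key; rewrite dt.
have -> : sin t = sin (pi - t) by rewrite sinB sinpi cospi; ring.
by apply: key; lra.
Qed.

Let K : R := 3 / (4 * sin delta ^+ 2).

Let sd0 : 0 < sin delta.
Proof. by apply: sin_gt0_pi; have := pi_gt0 R; move: delta0 delta1; lra. Qed.

Let st0 t : delta <= t <= pi - delta -> 0 < sin t.
Proof. by move=> /sin_ge_sin_delta; apply: lt_le_trans. Qed.

Let K0 : 0 <= K. Proof. by rewrite divr_ge0// mulr_ge0// sqr_ge0. Qed.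

Let qK t : delta <= t <= pi - delta -> 0 <= q t <= K.
Proof.
move=> tab; have st := st0 tab; apply/andP; split.
  by rewrite divr_ge0// mulr_ge0// sqr_ge0.
rewrite /q /K ler_pM2l// lef_pV2 ?posrE ?mulr_gt0 ?exprn_gt0//.
by rewrite ler_pM2l// ler_sqr ?nnegrE ?(ltW st) ?(ltW sd0)// sin_ge_sin_delta.
Qed.

Let t0ab : delta <= pi / 2 <= pi - delta.
Proof. by move: delta1; lra. Qed.

Let ab2 t : delta <= t <= pi - delta -> `|t - pi / 2| <= 2.
Proof.
move=> /andP[dt tp]; rewrite ler_norml; have := pihalf_lt2 R; move: delta0 => d0 p2.
by apply/andP; split; lra.
Qed.

Let m1 : 1 <= m. Proof. by rewrite /m; move: n1; lra. Qed.

(** This is [osc_sublevel] for [W]: by [r2_lower] a small multiplier makes [W] small relative to its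
    amplitude. The first hypothesis says 4 K <= m. *)
Lemma cap_multiplier_sublevel eps x y : 3 <= m * sin delta ^+ 2 -> 0 <= eps <= 1 / 4 ->
  delta <= x <= pi - delta -> delta <= y <= pi - delta ->
  8 * (n%:R + 1) ^+ 3 * cap_multiplier n x ^+ 2 <= eps ^+ 2 * sin delta ->
  8 * (n%:R + 1) ^+ 3 * cap_multiplier n y ^+ 2 <= eps ^+ 2 * sin delta ->
  `|y - x| <= (8 * m)^-1 -> `|y - x| <= 8 * eps / m.
Proof.
move=> hm /andP[e0 e4] xab yab hx hy d.
have Km : 4 * K <= m.
  have -> : 4 * K = 3 / sin delta ^+ 2 by rewrite /K; field; rewrite gt_eqF.
  by rewrite ler_pdivrMr// exprn_gt0.
have small t : delta <= t <= pi - delta ->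
    8 * (n%:R + 1) ^+ 3 * cap_multiplier n t ^+ 2 <= eps ^+ 2 * sin delta ->
    `|W t| <= eps * Num.sqrt r2.
  move=> tab ht; have st := st0 tab; have sds := sin_ge_sin_delta tab.
  rewrite -ler_sqr ?nnegrE ?mulr_ge0// real_normK ?num_real// [(eps * _) ^+ 2]exprMn sqr_sqrtr ?(ltW r2_gt0)//.
  rewrite -(ler_pM2r st) W_multiplier//.
  have n3 : 0 < 8 * (n%:R + 1) ^+ 3 :> R by rewrite mulr_gt0// exprn_gt0//; move: n1; lra.
  have c20 := sqr_ge0 (cap_multiplier n t).
  apply: (le_trans (ler_wpM2r c20 r2_lower)).
  have -> : 8 * (n%:R + 1) ^+ 3 * r2 * cap_multiplier n t ^+ 2 =
    r2 * (8 * (n%:R + 1) ^+ 3 * cap_multiplier n t ^+ 2) by ring.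
  have -> : eps ^+ 2 * r2 * sin t = r2 * (eps ^+ 2 * sin t) by ring.
  rewrite ler_pM2l//; apply: (le_trans ht).
  by apply: ler_wpM2l => //; exact: sqr_ge0.
apply: (osc_sublevel t0ab ab2 m1 K0 Km (fun t tab => dW (st0 tab))
  (fun t tab => dW1 (st0 tab)) qK e4) => //.
- by rewrite sqrtr_gt0.
- exact: small.
- exact: small.
Qed.

(** A sine bounded away from 0 survives the error of [osc_asymptotics] once m is large compared with
    K; 96 is chosen to give 128 K <= m. *)
Lemma cap_multiplier_lower t : 96 <= m * sin delta ^+ 2 -> delta <= t <= pi - delta ->
  1 / 8 <= `|sin (m * t - pi / 4)| ->
  sin delta <= 2048 * (n%:R + 1) ^+ 3 * cap_multiplier n t ^+ 2.
Proof.
move=> hm tab hs.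
have Km : 128 * K <= m.
  have -> : 128 * K = 96 / sin delta ^+ 2 by rewrite /K; field; rewrite gt_eqF.
  by rewrite ler_pdivrMr// exprn_gt0.
have Km4 : 4 * K <= m by move: Km K0; lra.
have := osc_asymptotics t0ab ab2 m1 K0 Km4 (fun t tab => dW (st0 tab))
  (fun t tab => dW1 (st0 tab)) qK tab.
rewrite -/r2; set r0 := Num.sqrt r2; set main := W (pi / 2) * _ + _ => h.
have r00 : 0 < r0 by rewrite sqrtr_gt0.
(* At the equator [W] or [W1] vanishes, so [main] is a pure cosine for n odd and a pure sine for n
   even. As m pi / 2 = n pi / 2 + pi / 4, both are sin (m t - pi / 4) up to sign. *)
have mainE : `|main| = r0 * `|sin (m * t - pi / 4)|.
  have [on|en] := boolP (odd n).
    have [k nk] : exists k, n = (2 * k).+1 by exact: odd_eq.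
    have W10 : W1 (pi / 2) = 0 by rewrite W1_pihalf legendre_horner0_odd// mulr0.
    have -> : main = W (pi / 2) * cos (m * (t - pi / 2)).
      by rewrite /main W10 mul0r mul0r addr0.
    have -> : r0 = `|W (pi / 2)|.
      by rewrite /r0 /r2 /osc_energy W10 mul0r expr0n addr0 sqrtr_sqr.
    have -> : sin (m * t - pi / 4) = sin (m * t - (k%:R + 1 + 1 / 4) * pi + (k.+1)%:R * pi).
      by congr sin; rewrite -natr1; field.
    rewrite normrM sinD_natpi [`|(-1) ^+ _ * _|]normrM normrX normrN1 expr1n !mul1r -cosBpihalf.
    congr (_ * _).
    have -> : m * (t - pi / 2) = m * t - (k%:R + 1 + 4^-1) * pi - pi / 2 + pi.
      by rewrite /m nk -natr1 natrM; field.
    by rewrite cosDpi normrN.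
  have [k nk] : exists k, n = (2 * k)%N by exact: even_eq.
  have W0 : W (pi / 2) = 0 by rewrite W_pihalf legendre_deriv_horner0_even.
  have -> : main = W1 (pi / 2) / m * sin (m * (t - pi / 2)).
    by rewrite /main W0 mul0r add0r.
  have -> : r0 = `|W1 (pi / 2) / m|.
    by rewrite /r0 /r2 /osc_energy W0 expr0n add0r sqrtr_sqr.
  have -> : m * t - pi / 4 = m * (t - pi / 2) + k%:R * pi.
    by rewrite /m nk natrM; field.
  by rewrite normrM sinD_natpi [`|(-1) ^+ _ * _|]normrM normrX normrN1 expr1n !mul1r.
(* The error takes at most half of the margin 1/8. What remains is |W| >= r0 / 16, and 2048 = 8 *
   16^2. *)
have Km16 : 8 * (K / m) <= 1 / 16.
  by rewrite mulrA ler_pdivrMr//; move: Km; lra.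
have Wlo : r0 / 16 <= `|W t|.
  have h1 := ler_wpM2r (ltW r00) Km16.
  have h2 := ler_wpM2l (ltW r00) hs.
  have := ler_normD (W t) (main - W t).
  have -> : W t + (main - W t) = main by ring.
  rewrite mainE => h3; rewrite distrC in h.
  by move: h h1 h2 h3; lra.
have st := st0 tab; have sds := sin_ge_sin_delta tab.
have W2 : r2 / 256 <= W t ^+ 2.
  have r16 : 0 <= r0 / 16 by rewrite divr_ge0// ltW.
  have := ler_pM r16 r16 Wlo Wlo.
  have r02 : r0 ^+ 2 = r2 by rewrite sqr_sqrtr// ltW.
  by rewrite -!expr2 real_normK ?num_real// -r02 expr_div_n; lra.
have := ler_pM _ _ W2 sds; rewrite W_multiplier// => h1.
have {}h1 : r2 / 256 * sin delta <= 4 * N ^+ 2 * cap_multiplier n t ^+ 2.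
  by apply: h1 (ltW sd0); exact: divr_ge0 (ltW r2_gt0) (ler0n R 256).
have := le_trans h1 (ler_wpM2r (sqr_ge0 _) r2_lower).
move=> h3; rewrite -(ler_pM2l r2_gt0).
by lra.
Qed.

End legendre_oscillator.

(** * Lower bounds for the multipliers *)

Section cluster_cover.
Context {R : realType}.
Local Notation lambda := (@lebesgue_measure R).

Lemma lebesgue_measure_centered (x r : R) : 0 <= r ->
  lambda `[x - r, x + r] = (2 * r)%:E.
Proof.
move=> r0; rewrite lebesgue_measure_itv /= lte_fin.
have [xr|xr] := ltP (x - r) (x + r); first by rewrite -EFinD; congr EFin; ring.
have -> : r = 0 by lra.
by rewrite mulr0.
Qed.

(** The points of D in one cell of length l all lie within r of any one of them, so J cells need J
    intervals of length 2 r. The induction peels off the last cell. *)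
Lemma cluster_cover (D : set R) (l r : R) (J : nat) : 0 < l -> 0 <= r ->
  (forall x, D x -> 0 <= x < J%:R * l) ->
  (forall x y, D x -> D y -> `|y - x| <= l -> `|y - x| <= r) ->
  exists B, [/\ measurable B, D `<=` B & (lambda B <= (J%:R * (2 * r))%:E)%E].
Proof.
move=> l0 r0; elim: J D => [|J ih] D Dl Dr.
  exists set0; split => //; first by move=> x /Dl; rewrite mul0r => /andP[? ?]; lra.
  by rewrite measure0 mul0r.
have [||B [mB DB lB]] := ih (D `&` [set x | x < J%:R * l]).
- by move=> x [/Dl /andP[x0 _] /= xJ]; rewrite x0.
- by move=> x y [Dx _] [Dy _]; exact: Dr.
have [[x0 [Dx0 Jx0]]|h] := pselect (exists x, D x /\ J%:R * l <= x); last first.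
  exists B; split => //.
    move=> x Dx; apply: DB; split => //=; rewrite ltNge; apply/negP => Jx.
    by apply: h; exists x.
  by apply: (le_trans lB); rewrite lee_fin ler_wpM2r ?ler_nat// mulr_ge0.
exists (B `|` `[x0 - r, x0 + r]); split.
- by apply: measurableU => //; exact: measurable_itv.
- move=> x Dx; have [xJ|Jx] := ltP x (J%:R * l); first by left; apply: DB.
  right; rewrite /= in_itv /=.
  have := Dr _ _ Dx0 Dx; have /andP[_] := Dl _ Dx; have /andP[_] := Dl _ Dx0.
  rewrite -natr1 mulrDl mul1r => h1 h2 h3.
  have : `|x - x0| <= l by rewrite ler_norml; apply/andP; split; lra.
  by move/h3; rewrite ler_norml => /andP[? ?]; apply/andP; split; lra.
- have mI : measurable (`[x0 - r, x0 + r]%classic : set R) by exact: measurable_itv.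
  apply: (le_trans (measureU2 lambda mB mI)).
  rewrite -natr1 mulrDl mul1r EFinD; apply: leeD => //.
  by move: (lexx (2 * r)%:E); rewrite -{1}(lebesgue_measure_centered x0 r0).
Qed.

Lemma borel_cantelli_bounded (F : (set R)^nat) (C : R) : (forall n, measurable (F n)) ->
  (forall n, (\sum_(i < n) lambda (F i) <= C%:E)%E) ->
  {ae lambda, forall x, exists n0, forall n, (n0 <= n)%N -> ~ F n x}.
Proof.
move=> mF hC; exists (lim_sup_set F); split.
- apply: bigcapT_measurable => k; apply: bigcup_measurable => j _; exact: mF.
- apply: lim_sup_set_cvg0 => //; apply: (@le_lt_trans _ _ C%:E); last exact: ltry.
  apply: lime_le; first by apply: is_cvg_nneseries => n _ _; exact: measure_ge0.
  by apply: nearW => n; rewrite big_mkord.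
- move=> x h n _; apply: contrapT => hn; apply: h; exists n => k nk Fk; apply: hn.
  by exists k.
Qed.

(** Comparison with the integral: by the mean value theorem each term after the first is at most a
    decrement of (n + 1)^(1 - s) / (s - 1), and these telescope. *)
Lemma powR_sum_bounded (s : R) : 1 < s -> exists C : R, forall n,
  \sum_(i < n) powR (i%:R + 1) (- s) <= C.
Proof.
move=> s1; have s10 : 0 < s - 1 by lra.
pose g (n : nat) : R := powR (n%:R + 1) (1 - s).
have step (n : nat) : powR (n.+1%:R + 1) (- s) <= (s - 1)^-1 * (g n - g n.+1).
  have n0 : 0 <= n%:R :> R by rewrite ler0n.
  have nn : n%:R + 1 <= n.+1%:R + 1 :> R by rewrite -natr1; lra.
  have [z|z /andP[nz zn] e] := @mvt_itv R (fun x => powR x (1 - s)) (fun x => (1 - s) * powR x (1 - s - 1)) _ _ nn.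
    by move=> /andP[nz zn]; apply: is_derive1_powR; lra.
  have -> : g n - g n.+1 = (s - 1) * powR z (- s).
    rewrite -opprB /g e -natr1 (_ : 1 - s - 1 = - s); last by ring.
    by ring.
  rewrite mulrA mulVf ?gt_eqF// mul1r !powRN lef_pV2 ?posrE ?powR_gt0//; try lra.
  by apply: ge0_ler_powR; rewrite ?nnegrE; lra.
exists (1 + (s - 1)^-1) => n.
have g0 k : 0 <= g k by exact: powR_ge0.
have i0 : 0 <= (s - 1)^-1 by rewrite invr_ge0 ltW.
suff h k : \sum_(i < k.+1) powR (i%:R + 1) (- s) <= 1 + (s - 1)^-1 * (1 - g k).
  case: n => [|k]; first by rewrite big_ord0 addr_ge0.
  apply: (le_trans (h k)); rewrite lerD2l ler_piMr//.
  by have := g0 k; lra.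
elim: k => [|k ih].
  by rewrite big_ord1 /g add0r !powR1 subrr mulr0 addr0.
rewrite big_ord_recr /=; apply: (le_trans (lerD ih (step k))).
by rewrite -addrA -mulrDr (_ : 1 - g k + (g k - g k.+1) = 1 - g k.+1)//; ring.
Qed.

Lemma ae_negligible_finite (A : set R) : finite_set A -> {ae lambda, forall x, ~ A x}.
Proof.
move=> fA; have cA := finite_set_countable fA.
exists A; split; first exact: countable_measurable.
  exact: countable_lebesgue_measure0.
by move=> x /= /contrapT.
Qed.

End cluster_cover.

(** * Lower bounds in all degrees, for almost every radius *)

Section multiplier_decay.
Context {R : realType}.
Local Notation lambda := (@lebesgue_measure R).

(** The quantitative bounds hold for large degrees only; the finitely many others need nothing but
    positivity. *)
Lemma eventually_lower_bound (w : nat -> R) (k : R) (n0 : nat) :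
  (forall n, 0 < w n) -> 0 < k -> (forall n, (n0 <= n)%N -> k <= w n) ->
  exists2 A : R, 0 < A & forall n, 1 <= A ^+ 2 * w n.
Proof.
move=> w0 kp hk.
have [k' k'p hk'] : exists2 k' : R, 0 < k' & forall n, k' <= w n.
  elim: n0 k kp hk => [|n0 ih] k kp hk; first by exists k => // n; exact: hk.
  apply: (ih (Num.min k (w n0))); first by rewrite lt_min kp w0.
  move=> n; rewrite leq_eqVlt => /predU1P[<-|hn]; first by rewrite ge_min lexx orbT.
  by rewrite ge_min hk.
(* This avoids a square root: (1 + 1 / k')^2 k' = k' + 2 + 1 / k'. *)
exists (1 + k'^-1); first by rewrite addr_gt0// invr_gt0.
move=> n; have i0 : 0 < k'^-1 by rewrite invr_gt0.
apply: (@le_trans _ _ ((1 + k'^-1) ^+ 2 * k')); last first.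
  by apply: ler_wpM2l; [exact: sqr_ge0|exact: hk'].
have -> : (1 + k'^-1) ^+ 2 * k' = k' + 2 + k'^-1 by field; rewrite gt_eqF.
by lra.
Qed.

Lemma finite_roots (p : {poly R}) : p != 0 -> finite_set [set x | root p x].
Proof.
move=> p0; apply: (@sub_finite_set _ _ [set` polyrcf.rootsR p]); last exact: finite_seq.
by move=> x /= px; rewrite -(polyrcf.roots_on_rootsR p0) in_itv/=.
Qed.

Lemma ae_mono (P Q : R -> Prop) : (forall x, P x -> Q x) ->
  {ae lambda, forall x, P x} -> {ae lambda, forall x, Q x}.
Proof. by move=> PQ; apply: filterS => //; exact: (ae_filter_ringOfSetsType lambda). Qed.

(** Each multiplier is a polynomial in cos theta, nonzero because its derivative is a nonzero
    multiple of P_n, and P_n(1) = 1. So each degree excludes finitely many radii. *)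
Lemma cap_multiplier_neq0 :
  {ae lambda, forall theta : R, 0 < theta < pi -> forall n, cap_multiplier n theta != 0}.
Proof.
have key n : {ae lambda, forall theta : R, 0 < theta < pi -> cap_multiplier n theta != 0}.
  pose A := [set theta : R | 0 < theta < pi /\ cap_multiplier n theta = 0].
  have fA : finite_set A.
    pose p : {poly R} := (primitive_poly (legendre n)).[1]%:P - primitive_poly (legendre n).
    have p0 : p != 0.
      apply/eqP => /(congr1 (fun q => q^`().[1])).
      rewrite derivB derivC deriv_primitive sub0r hornerN legendre_horner1 deriv0 horner0.
      by move=> ?; lra.
    apply: (@sub_finite_set _ _ (@acos R @` [set x | root p x])); last first.
      by apply: finite_image; exact: finite_roots.
    move=> t [/andP[t0 tp]]; rewrite cap_multiplierE => h.
    exists (cos t); last by rewrite cosK// in_itv/= !ltW.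
    rewrite /= /root /p hornerD hornerN hornerC; apply/eqP.
    by move: h; lra.
  apply: ae_mono (ae_negligible_finite fA) => t hA tp.
  by apply/eqP => h; apply: hA.
by apply: ae_mono (ae_foralln key) => t h tp n; exact: h.
Qed.

Lemma sin_margin_gt0 (delta : R) : 0 < delta -> delta <= pi / 2 -> 0 < sin delta.
Proof.
by move=> d0 d1; apply: sin_gt0_pi; have := pi_gt0 R => p0; apply/andP; split; lra.
Qed.

Lemma eventually_large (delta c : R) : 0 < delta -> delta <= pi / 2 ->
  exists n0, forall n, (n0 <= n)%N -> c <= (n%:R + 1 / 2) * sin delta ^+ 2.
Proof.
move=> delta0 delta1.
have s20 : 0 < sin delta ^+ 2 by rewrite exprn_gt0// sin_margin_gt0.
exists (Num.truncn (`|c| / sin delta ^+ 2)).+1 => n hn.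
apply: (le_trans (ler_norm c)); rewrite -ler_pdivrMr//.
have := truncnS_gt (`|c| / sin delta ^+ 2); set x := `|c| / _ in hn * => hx.
have : (Num.truncn x).+1%:R <= n%:R :> R by rewrite ler_nat.
by move: hx; lra.
Qed.

Section fixed_margin.
Variables (s delta : R).
Hypothesis s1 : 1 < s.
Hypothesis delta0 : 0 < delta.
Hypothesis delta1 : delta <= pi / 2.

(** At a fixed distance from 0 and pi, the radii with a multiplier below n^(-s) times its typical
    size form a set of measure O(n^(-s)), which is summable. *)
Lemma cap_multiplier_ae_margin :
  {ae lambda, forall theta : R, delta <= theta <= pi - delta ->
    exists n0, forall n, (n0 <= n)%N ->
      (powR (n%:R + 1) (- s) / 4) ^+ 2 * sin delta <=
      8 * (n%:R + 1) ^+ 3 * cap_multiplier n theta ^+ 2}.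
Proof.
(* The factor 1/4 keeps e n within the range allowed by [cap_multiplier_sublevel]. *)
pose e n : R := powR (n%:R + 1) (- s) / 4.
have e0 n : 0 <= e n by rewrite divr_ge0// powR_ge0.
have e4 n : e n <= 1 / 4.
  have n1 : 0 < n%:R + 1 :> R by rewrite natr1 ltr0n.
  rewrite /e ler_pM2r// powRN invf_le1 ?powR_gt0//.
  have := @ler_powR R (n%:R + 1) _ 0 s _; rewrite powRr0; apply; last by move: s1; lra.
  by rewrite lerDr.
have [N0 hN0] := eventually_large 3 delta0 delta1.
pose D n := [set t : R | delta <= t <= pi - delta /\
  8 * (n%:R + 1) ^+ 3 * cap_multiplier n t ^+ 2 <= e n ^+ 2 * sin delta].
have cover n : exists B, [/\ measurable B, (N0.+1 <= n)%N -> D n `<=` B &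
    (lambda B <= (256 * powR (n%:R + 1) (- s))%:E)%E].
  (* For the first degrees no covering is claimed; the empty set only fills the sequence. *)
  have [Nn|nN] := leqP N0.+1 n; last first.
    exists set0; split; [exact: measurable0|by []|].
    by rewrite measure0 lee_fin; apply: mulr_ge0 (ler0n R _) (powR_ge0 _ _).
  have n0 : (0 < n)%N by exact: leq_ltn_trans (leq0n _) Nn.
  have n1 : 1 <= n%:R :> R by rewrite ler1n.
  pose m : R := n%:R + 1 / 2.
  have m0 : 0 < m by rewrite /m; lra.
  (* As m <= n + 1, these cells cover a length of at least 4 > pi. The total measure is 128 (n +
     1)^(1 - s) / m, and m >= (n + 1) / 2 gives the constant 256. *)
  have [||||B [mB DB lB]] := @cluster_cover R (D n) (8 * m)^-1 (8 * e n / m) (32 * n.+1).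
  - by rewrite invr_gt0 mulr_gt0.
  - by apply: divr_ge0 (ltW m0); apply: mulr_ge0.
  - move=> x [/andP[dx xp] _]; apply/andP; split; first by move: delta0; lra.
    apply: (@lt_le_trans _ _ 4); first by have := pihalf_lt2 R; move: delta0; lra.
    rewrite ler_pdivlMr ?mulr_gt0// natrM -natr1 /m; lra.
  - move=> x y [xd hx] [yd hy] xy.
    apply: (cap_multiplier_sublevel n0 delta0 delta1 _ _ xd yd hx hy xy).
      by apply: hN0; exact: ltnW.
    by rewrite e0 e4.
  exists B; split => //; apply: (le_trans lB); rewrite lee_fin.
  have -> : (32 * n.+1)%:R * (2 * (8 * e n / m)) = (128 * (n%:R + 1) / m) * powR (n%:R + 1) (- s).
    by rewrite natrM -natr1 /e; field; rewrite gt_eqF.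
  apply: ler_wpM2r; first exact: powR_ge0.
  by rewrite ler_pdivrMr// /m; lra.
have [F hF] := choice cover.
have [C hC] := powR_sum_bounded s1.
have mF n : measurable (F n) by have [] := hF n.
have sumF n : (\sum_(i < n) lambda (F i) <= (256 * C)%:E)%E.
  apply: (@le_trans _ _ (\sum_(i < n) (256 * powR (i%:R + 1) (- s))%:E)%E).
    by apply: lee_sum => i _; have [] := hF i.
  by rewrite sumEFin lee_fin -mulr_sumr; exact: ler_wpM2l (ler0n R _) _ _ (hC n).
apply: ae_mono (borel_cantelli_bounded mF sumF) => t [n0 hn] td.
exists (maxn n0 N0.+1) => n; rewrite geq_max => /andP[n0n Nn].
rewrite leNgt; apply/negP => h; apply: (hn n n0n).
have [_ DF _] := hF n; apply: (DF Nn); split => //; exact: ltW.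
Qed.

End fixed_margin.

Lemma weight_ge (g : R) n : 0 <= g ->
  powR (n%:R + 1) (2 * g) <= powR 2 g * powR (1 + n%:R ^+ 2) g.
Proof.
move=> g0; have n0 : 0 <= n%:R :> R by rewrite ler0n.
have n20 : 0 <= n%:R ^+ 2 :> R by exact: sqr_ge0.
rewrite powRrM -powRM ?addr_ge0//; apply: ge0_ler_powR => //; rewrite ?nnegrE ?powR_ge0//.
have -> : powR (n%:R + 1) 2 = (n%:R + 1) ^+ 2 := powR_mulrn 2 (addr_ge0 n0 ler01).
by have := sqr_ge0 (n%:R - 1 : R); rewrite !expr2; lra.
Qed.

Lemma cap_multiplier_ae_lower (g : R) : 5 / 2 < g ->
  {ae lambda, forall theta : R, 0 < theta < pi -> exists2 A : R, 0 < A &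
    forall n, 1 <= A ^+ 2 * (powR (1 + n%:R ^+ 2) g * cap_multiplier n theta ^+ 2)}.
Proof.
move=> g52; pose s : R := g - 3 / 2.
have s1 : 1 < s by rewrite /s; lra.
pose d (j : nat) : R := (j%:R + 1)^-1.
have j0 (j : nat) : 0 < j%:R + 1 :> R by rewrite natr1 ltr0n.
have d0 j : 0 < d j by rewrite invr_gt0.
have d1 j : d j <= pi / 2.
  by apply: le_trans (pihalf_ge1 R); rewrite invf_le1// lerDr.
have h := ae_foralln (fun j => cap_multiplier_ae_margin s1 (d0 j) (d1 j)).
have hh := @filterI _ _ (ae_filter_ringOfSetsType lambda) _ _ h cap_multiplier_neq0.
apply: ae_mono hh => t [ht hn0] tp.
have {}hn0 := hn0 tp.
have [j /andP[jt tj]] : exists j, d j <= t <= pi - d j.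
  (* Any j with j + 1 >= x gives a margin below both t and pi - t. *)
  pose x := t^-1 + (pi - t)^-1.
  have /andP[t0 tpi] := tp; have pt0 : 0 < pi - t by rewrite subr_gt0.
  have it0 : 0 < t^-1 by rewrite invr_gt0.
  have ipt0 : 0 < (pi - t)^-1 by rewrite invr_gt0.
  have := truncnS_gt x; set k := Num.truncn x => xk.
  rewrite -natr1 in xk.
  exists k; rewrite /d; apply/andP; split.
    by rewrite -[t]invrK lef_pV2 ?posrE//; move: xk; rewrite /x; lra.
  rewrite lerBrDr addrC -lerBrDr -[pi - t]invrK lef_pV2 ?posrE//.
  by move: xk; rewrite /x; lra.
have [|n0 hn] := ht j; first by rewrite jt.
have sd := sin_margin_gt0 (d0 j) (d1 j).
have w0 n : 0 < powR (1 + n%:R ^+ 2 : R) g.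
  by apply: powR_gt0; have := sqr_ge0 (n%:R : R); lra.
apply: (@eventually_lower_bound _ (sin (d j) / (128 * powR 2 g)) n0).
- by move=> n; rewrite mulr_gt0// exprn_even_gt0// hn0.
- apply: divr_gt0 sd _; apply: mulr_gt0; first by rewrite ltr0n.
  by apply: powR_gt0; rewrite ltr0n.
- move=> n n0n; have := hn n n0n.
  have g0 : 0 <= g by lra.
  have := weight_ge n g0.
  set w := powR (1 + _) g; set a := cap_multiplier n t ^+ 2; set p := powR 2 g.
  (* The exponents match because 2 g = 3 + 2 s. *)
  have -> : powR (n%:R + 1) (2 * g) = (n%:R + 1) ^+ 3 / (powR (n%:R + 1) (- s)) ^+ 2.
    have e3 : (n%:R + 1) ^+ 3 = powR (n%:R + 1) 3%:R :> R by exact: esym (powR_mulrn 3 (ltW (j0 n))).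
    have e2 : powR (n%:R + 1) (- s) ^+ 2 = powR (n%:R + 1) (- s * 2%:R).
      by rewrite powRrM; exact: esym (powR_mulrn 2 (powR_ge0 _ _)).
    rewrite e3 e2 -powRB; last by apply/implyP => _; exact: lt0r_neq0 (j0 n).
    by congr powR; rewrite /s; field.
  set y := powR (n%:R + 1) (- s) => h1 h2.
  have y0 : 0 < y by rewrite powR_gt0.
  have p0 : 0 < p by rewrite powR_gt0.
  have a0 : 0 <= a by exact: sqr_ge0.
  have n3 : 0 < (n%:R + 1) ^+ 3 :> R by rewrite exprn_gt0.
  have c0 : 0 < 128 :> R by rewrite ltr0n.
  rewrite ler_pdivrMr; last exact: mulr_gt0 c0 p0.
  rewrite ler_pdivrMr ?exprn_gt0// in h1.
  rewrite -(ler_pM2l n3).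
  have pw : 0 <= p * w * 128 := mulr_ge0 (mulr_ge0 (ltW p0) (ltW (w0 n))) (ltW c0).
  rewrite expr_div_n in h2.
  have k1 := ler_wpM2r (ltW sd) h1; have k2 := ler_wpM2l pw h2.
  by lra.
Qed.

(** With psi = phi - pi / 4 the second angle is 2 psi + pi / 4. If sin psi is small then cos (2 psi)
    is near 1 and sin (2 psi) near 0, so the second sine is close to sin (pi / 4). *)
Lemma sin_quarter_or (phi : R) :
  1 / 8 <= `|sin (phi - pi / 4)| \/ 1 / 8 <= `|sin (2 * phi - pi / 4)|.
Proof.
have [h|h] := leP (1 / 8) `|sin (phi - pi / 4)|; [by left|right].
set psi := phi - pi / 4 in h.
have -> : 2 * phi - pi / 4 = psi *+ 2 + pi / 4 by rewrite /psi mulr2n; field.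
rewrite sinD sin_mulr2n cos_mulr2n; set c := cos psi; set s := sin psi in h *.
have cs : c ^+ 2 + s ^+ 2 = 1 by exact: cos2Dsin2.
have sq : sin (pi / 4) = cos (pi / 4) :> R.
  have := sinBpihalf (pi / 4 : R); have -> : pi / 4 - pi / 2 = - (pi / 4) :> R by field.
  by rewrite sinN => /oppr_inj.
have q2 := cos2Dsin2 (pi / 4 : R); rewrite sq in q2 *.
have q0 : 0 <= cos (pi / 4 : R).
  by apply: cos_ge0_pihalf; have := pi_gt0 R => p0; apply/andP; split; lra.
set q := cos (pi / 4) in q0 q2 *.
have q12 : 1 / 2 <= q.
  by rewrite leNgt; apply/negP => h2; nra.
have s2 : s ^+ 2 <= 1 / 64.
  have := ler_pM (normr_ge0 s) (normr_ge0 s) (ltW h) (ltW h).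
  by rewrite -expr2 real_normK ?num_real//; lra.
have c1 : `|c| <= 1 by rewrite ler_norml cos_geN1 cos_le1.
have cs8 : `|c * s| <= 1 / 8.
  by have := ler_pM (normr_ge0 c) (normr_ge0 s) c1 (ltW h); rewrite normrM; lra.
apply: le_trans (ler_norm _); move: cs8; rewrite ler_norml => /andP[l1 l2].
have X12 : 1 / 2 <= c * s *+ 2 + (c ^+ 2 *+ 2 - 1).
  by move: cs s2 l1; rewrite !expr2; lra.
rewrite -mulrDl; apply: (@le_trans _ _ (1 / 2 * (1 / 2))); first by lra.
by apply: ler_pM => //; lra.
Qed.

(** Large degrees are handled for every theta by [sin_quarter_or] with phi = (n + 1/2) theta; a null
    set is excluded only so that no a_n(theta) vanishes in small degrees. *)
Lemma cap_multiplier_ae_lower2 :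
  {ae lambda, forall theta : R, 0 < theta < pi / 2 -> exists2 A : R, 0 < A &
    forall n, 1 <= A ^+ 2 * (powR (1 + n%:R ^+ 2) (3 / 2) * cap_multiplier n theta ^+ 2) \/
      1 <= A ^+ 2 * (powR (1 + n%:R ^+ 2) (3 / 2) * cap_multiplier n (2 * theta) ^+ 2)}.
Proof.
apply: ae_mono cap_multiplier_neq0 => t hn0 /andP[t0 tp2].
have {}hn0 := hn0 _; have p0 := pi_gt0 R.
have {}hn0 n : cap_multiplier n t != 0 by apply: hn0; apply/andP; split; lra.
(* With this margin both t and 2 t lie in [d, pi - d]. *)
pose d := Num.min t (pi - 2 * t).
have d0 : 0 < d by rewrite lt_min t0 subr_gt0; lra.
have dt : d <= t by rewrite ge_min lexx.
have dpt : d <= pi - 2 * t by rewrite ge_min lexx orbT.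
have d1 : d <= pi / 2 by lra.
have sd := sin_margin_gt0 d0 d1.
have [n0 hn] := eventually_large 96 d0 d1.
have w0 n : 0 < powR (1 + n%:R ^+ 2 : R) (3 / 2).
  by apply: powR_gt0; have := sqr_ge0 (n%:R : R); lra.
(* The maximum merges the alternative into one sequence, to which [eventually_lower_bound]
   applies. *)
pose a n := Num.max (cap_multiplier n t ^+ 2) (cap_multiplier n (2 * t) ^+ 2).
have [|||A A0 hA] := @eventually_lower_bound
    (fun n => powR (1 + n%:R ^+ 2) (3 / 2) * a n) (sin d / (2048 * powR 2 (3 / 2))) n0.+1.
- by move=> n; rewrite mulr_gt0// lt_max exprn_even_gt0// hn0.
- apply: divr_gt0 sd _; apply: mulr_gt0; first by rewrite ltr0n.
  by apply: powR_gt0; rewrite ltr0n.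
- move=> n n0n; have n1 : (0 < n)%N by exact: leq_ltn_trans (leq0n _) n0n.
  have hm := hn n (ltnW n0n).
  have big u : d <= u <= pi - d -> 1 / 8 <= `|sin ((n%:R + 1 / 2) * u - pi / 4)| ->
      cap_multiplier n u ^+ 2 <= a n ->
      sin d / (2048 * powR 2 (3 / 2)) <= powR (1 + n%:R ^+ 2) (3 / 2) * a n.
    move=> ud hs ua; have := cap_multiplier_lower n1 d0 d1 hm ud hs.
    have g0 : 0 <= 3 / 2 :> R by lra.
    have := weight_ge n g0.
    have -> : 2 * (3 / 2) = 3%:R :> R by field.
    rewrite powR_mulrn; last by rewrite addr_ge0.
    set w := powR (1 + _) _; set p := powR 2 _ => h1 h2.
    have p0' : 0 < p by rewrite powR_gt0.
    have c0 : 0 < 2048 :> R by rewrite ltr0n.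
    rewrite ler_pdivrMr; last exact: mulr_gt0 c0 p0'.
    apply: (le_trans h2).
    have b0 := sqr_ge0 (cap_multiplier n u).
    have pw : 0 <= p * w := mulr_ge0 (ltW p0') (ltW (w0 n)).
    have := ler_wpM2r b0 h1; have := ler_wpM2l pw ua.
    by lra.
  have [hs|hs] := sin_quarter_or ((n%:R + 1 / 2) * t).
    by apply: (big t _ hs); [apply/andP; split; lra|rewrite le_max lexx].
  apply: (big (2 * t)); first by apply/andP; split; lra.
    by rewrite mulrCA.
  by rewrite le_max lexx orbT.
exists A => // n; have := hA n; rewrite /a.
by case: (leP (cap_multiplier n t ^+ 2) _) => _ h; [right|left].
Qed.

End multiplier_decay.

(** * Complex measures and functions *)

Section complex_estimate.
Context {R : realType}.
Notation S2 := (@sphere R).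
Local Notation bm := (bounded_measurable S2).
Local Notation mS := (@measurable_sphere R).
Implicit Types (mu : cmeasure (space3 R) R) (Omega : set (space3 R)) (f : space3 R -> R[i]).

Let fs : {finite_measure set (space3 R) -> \bar R} := surface.

Lemma EFin_Rintegral_bm (g : space3 R -> R) : bm g ->
  (\int[surface]_(x in S2) g x)%:E = (\int[surface]_(x in S2) (g x)%:E)%E.
Proof.
move=> bg; rewrite /Rintegral fineK//.
exact: (integrable_fin_num mS (@bounded_measurable_integrable _ _ _ fs _ mS _ bg)).
Qed.

Lemma le_EFin_Rintegral_bm (g h : space3 R -> R) : bm g -> bm h ->
  (forall x, S2 x -> g x <= h x) ->
  ((\int[surface]_(x in S2) g x)%:E <= \int[surface]_(x in S2) (h x)%:E)%E.
Proof.
move=> bg bh gh; rewrite -EFin_Rintegral_bm// lee_fin.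
exact: (@le_Rintegral_bm _ _ _ fs _ mS).
Qed.

Lemma bounded_measurable_sqr (g : space3 R -> R) : bm g -> bm (fun x => g x ^+ 2).
Proof. by move=> bg; have := bounded_measurableM bg bg; congr bounded_measurable. Qed.

Lemma smooth_continuous (F : space3 R -> R) : smooth F -> continuous F.
Proof. by move=> sF x; exact: differentiable_continuous (sF [::] x). Qed.

Lemma continuous_bm (F : space3 R -> R) : continuous F -> bm F.
Proof.
move=> cF; split; last exact: continuous_sphere_bounded.
by apply: measurable_funS (continuous_measurable3 cF).
Qed.

Lemma le_sqrte (x y : \bar R) : (0 <= x -> x <= y -> sqrte x <= sqrte y)%E.
Proof. by move=> x0 xy; rewrite lee_sqrt// (le_trans x0). Qed.

Lemma normc_sqr (a b : R) : Normc.normc (a +i* b)%C ^+ 2 = a ^+ 2 + b ^+ 2.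
Proof. by rewrite /Normc.normc sqr_sqrtr// addr_ge0// sqr_ge0. Qed.

Lemma normc_le_sum (a b : R) : Normc.normc (a +i* b)%C <= `|a| + `|b|.
Proof.
rewrite -ler_sqr ?nnegrE ?addr_ge0 ?sqrtr_ge0// normc_sqr sqrrD !real_normK ?num_real//.
by have := mulr_ge0 (normr_ge0 a) (normr_ge0 b); rewrite mulr2n; lra.
Qed.

(** Meant for the real part and the negated imaginary part of mu, both bounded by the modulus. *)
Lemma cap_L2_le mu (rho : {charge set (space3 R) -> \bar R}) Omega theta :
  measurable Omega -> Omega `<=` S2 ->
  (forall B, measurable B -> fine (rho B) ^+ 2 <= Normc.normc (cmval mu B) ^+ 2) ->
  (sqrte (cap_L2 rho Omega theta)%:E <= cap_L2norm mu Omega theta)%E.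
Proof.
move=> mO OS h; rewrite /cap_L2norm.
have -> : (fun x => (Normc.normc (cmval mu (cap x theta `&` Omega)) ^+ 2)%:E) =
    (fun x => (charge_on_cap (cm_Re mu) Omega theta x ^+ 2 +
      charge_on_cap (cm_Im mu) Omega theta x ^+ 2)%:E).
  by apply/funext => x; rewrite /cmval normc_sqr.
have b nu := bounded_measurable_sqr (@bm_charge_on_cap _ nu Omega mO OS theta).
apply: le_sqrte; first by rewrite lee_fin; apply: Rintegral_ge0 => x _; exact: sqr_ge0.
apply: le_EFin_Rintegral_bm => //; first exact: bounded_measurableD.
move=> x Sx; have := h (cap x theta `&` Omega); rewrite /cmval normc_sqr; apply.
by apply: measurableI => //; exact: measurable_cap.
Qed.

Lemma harmonic_projE f F1 F2 n x : (forall y, S2 y -> f y = (F1 y +i* F2 y)%C) ->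
  harmonic_proj f n x = (harmonic_part F1 n x +i* harmonic_part F2 n x)%C.
Proof.
move=> fE; rewrite /harmonic_proj /cRintegral /harmonic_part /zonal_transform.
by congr (_ +i* _)%C; apply: eq_Rintegral => y; rewrite inE => Sy; rewrite fE//=; ring.
Qed.

Lemma energy_sum_le (W : nat -> R) f F1 F2 F : (forall n, 0 <= W n) -> bm F1 -> bm F2 ->
  (forall y, S2 y -> f y = (F1 y +i* F2 y)%C) -> F = F1 \/ F = F2 ->
  (sqrte (\sum_(0 <= n <oo) (W n)%:E * (energy F n)%:E) <=
   sqrte (\sum_(0 <= n <oo) (W n)%:E *
     \int[surface]_(x in S2) (Normc.normc (harmonic_proj f n x) ^+ 2)%:E))%E.
Proof.
move=> W0 b1 b2 fE hF.
have t0 n : (0 <= (W n)%:E * (energy F n)%:E)%E by rewrite mule_ge0// lee_fin// energy_ge0.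
apply: le_sqrte; first by apply: nneseries_ge0 => n _ _; exact: t0.
apply: lee_nneseries => [n _ _|n _]; first exact: t0.
apply: lee_wpmul2l; first by rewrite lee_fin.
have bh G := fun bG => bounded_measurable_sqr (@bm_harmonic_part _ G n bG).
under eq_integral do rewrite (harmonic_projE _ _ fE) normc_sqr.
apply: le_EFin_Rintegral_bm.
- by case: hF => ->; exact: bh.
- by apply: bounded_measurableD; exact: bh.
- move=> x Sx; have := sqr_ge0 (harmonic_part F1 n x); have := sqr_ge0 (harmonic_part F2 n x).
  by case: hF => ->; lra.
Qed.

Lemma mule4 (x : \bar R) : (0 <= x -> 4%:E * x = x + x + (x + x))%E.
Proof.
move=> x0; have -> : 4 = 1 + 1 + (1 + 1) :> R by ring.
by rewrite !EFinD !ge0_muleDl// ?mul1e// adde_ge0.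
Qed.

(** The real and imaginary parts of the integral combine two real pairings each; all four are at
    most [X], whence the factor 4. Conjugation only negates the imaginary charge. *)
Lemma complex_estimate (g : R) Omega theta1 theta2 (c1 c2 : nat -> R) (A : R) mu f :
  measurable Omega -> Omega `<=` S2 -> smooth_on_sphere f -> 0 < A ->
  (forall n, c1 n ^+ 2 <= A ^+ 2 * powR (1 + n%:R ^+ 2) g) ->
  (forall n, c2 n ^+ 2 <= A ^+ 2 * powR (1 + n%:R ^+ 2) g) ->
  (forall n, c1 n * cap_multiplier n theta1 + c2 n * cap_multiplier n theta2 = 1) ->
  ((Normc.normc (cmintegral (cmconj mu) Omega f))%:E <=
   (4 * A)%:E * sobolev_norm g f *
     (cap_L2norm mu Omega theta1 + cap_L2norm mu Omega theta2))%E.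
Proof.
move=> mO OS [F1 [F2 [/smooth_continuous cF1 /smooth_continuous cF2 fE]]] A0 h1 h2 h12.
have b1 := continuous_bm cF1; have b2 := continuous_bm cF2.
have W0 n : 0 <= powR (1 + n%:R ^+ 2) g :> R by exact: powR_ge0.
set X := (A%:E * sobolev_norm g f * (cap_L2norm mu Omega theta1 + cap_L2norm mu Omega theta2))%E.
have piece (rho : {charge set (space3 R) -> \bar R}) F : (forall B, measurable B -> fine (rho B) ^+ 2 <= Normc.normc (cmval mu B) ^+ 2) ->
    F = F1 \/ F = F2 -> (`|charge_Rintegral rho Omega F|%:E <= X)%E.
  move=> hr hF.
  have bF : bm F by case: hF => ->.
  have cF y : S2 y -> {for y, continuous F} by move=> _; case: hF => ->; [exact: cF1|exact: cF2].
  apply: le_trans (real_estimate rho mO OS bF cF A0 W0 h1 h2 h12) _.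
  apply: lee_pmul.
  - by rewrite mule_ge0// ?lee_fin ?sqrte_ge0// ltW.
  - by rewrite adde_ge0// sqrte_ge0.
  - apply: lee_wpmul2l; first by rewrite lee_fin ltW.
    exact: energy_sum_le W0 b1 b2 fE hF.
  - by apply: leeD; exact: cap_L2_le.
have hRe B : measurable B -> fine (cm_Re mu B) ^+ 2 <= Normc.normc (cmval mu B) ^+ 2.
  by move=> mB; rewrite /cmval normc_sqr lerDl sqr_ge0.
have hIm B : measurable B -> fine (cscale (-1) (cm_Im mu) B) ^+ 2 <= Normc.normc (cmval mu B) ^+ 2.
  move=> mB; rewrite /cmval normc_sqr /cscale /= fineM// ?fin_num_measure//.
  by rewrite /= mulN1r sqrrN lerDr sqr_ge0.
have e rho : charge_Rintegral rho Omega (fun x => complex.Re (f x)) = charge_Rintegral rho Omega F1.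
  by apply: eq_charge_Rintegral => x; rewrite inE => Ox; rewrite fE//; exact: OS.
have e' rho : charge_Rintegral rho Omega (fun x => complex.Im (f x)) = charge_Rintegral rho Omega F2.
  by apply: eq_charge_Rintegral => x; rewrite inE => Ox; rewrite fE//; exact: OS.
have X0 : (0 <= X)%E.
  by apply: le_trans (piece _ F1 hRe (or_introl erefl)); rewrite lee_fin.
rewrite (_ : (_ * _ * _)%E = (4%:E * X)%E); last by rewrite /X EFinM -!muleA.
rewrite mule4//.
rewrite /cmintegral /= !e !e'.
apply: le_trans (_ : _ <= (`|charge_Rintegral (cm_Re mu) Omega F1|
   + `|charge_Rintegral (cscale (-1) (cm_Im mu)) Omega F2| +
   (`|charge_Rintegral (cm_Re mu) Omega F2| +
    `|charge_Rintegral (cscale (-1) (cm_Im mu)) Omega F1|))%:E)%E _.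
  rewrite lee_fin; apply: le_trans (normc_le_sum _ _) _.
  by apply: lerD; [exact: ler_normB|exact: ler_normD].
rewrite !EFinD; apply: leeD; apply: leeD; apply: piece => //; by [left|right].
Qed.

End complex_estimate.

Theorem theorem14 (R : realType) :
  (forall gamma : R, 5 / 2 < gamma ->
    {ae lebesgue_measure, forall theta : R, 0 < theta < pi ->
      exists2 c : R, 0 < c &
        forall (Omega : set (space3 R)) (mu : cmeasure (space3 R) R)
               (f : space3 R -> R[i]),
          measurable Omega -> Omega `<=` sphere ->
          carried_by mu sphere -> smooth_on_sphere f ->
          ((Normc.normc (cmintegral (cmconj mu) Omega f))%:E
           <= c%:E * cap_L2norm mu Omega theta * sobolev_norm gamma f)%E})
  /\
  {ae lebesgue_measure, forall theta : R, 0 < theta < pi / 2 ->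
    exists2 c : R, 0 < c &
      forall (Omega : set (space3 R)) (mu : cmeasure (space3 R) R)
             (f : space3 R -> R[i]),
        measurable Omega -> Omega `<=` sphere ->
        carried_by mu sphere -> smooth_on_sphere f ->
        ((Normc.normc (cmintegral (cmconj mu) Omega f))%:E
         <= c%:E * sobolev_norm (3 / 2) f *
            (cap_L2norm mu Omega theta + cap_L2norm mu Omega (2 * theta)))%E}.
Proof.
have inv (A W a : R) : 1 <= A ^+ 2 * (W * a ^+ 2) -> a != 0 /\ a^-1 ^+ 2 <= A ^+ 2 * W.
  move=> h; have a0 : a != 0 by apply/eqP => a0; move: h; rewrite a0 expr0n/= !mulr0; lra.
  split => //; rewrite exprVn -[leLHS]mul1r ler_pdivrMr; first by rewrite -mulrA.
  by rewrite exprn_even_gt0.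
have AW0 (A g : R) n : 0 <= A ^+ 2 * powR (1 + n%:R ^+ 2) g.
  by rewrite mulr_ge0// ?sqr_ge0// powR_ge0.
split.
  move=> gamma g52; apply: ae_mono (cap_multiplier_ae_lower g52) => theta h /h[A A0 hA].
  (* The two-radius estimate is used with the same radius twice and c2 = 0: the bracket is twice the
     cap norm, and 4 A * 2 = 8 A. *)
  exists (8 * A); first by rewrite mulr_gt0.
  move=> Omega mu f mO OS _ sf.
  have h1 n : (cap_multiplier n theta)^-1 ^+ 2 <= A ^+ 2 * powR (1 + n%:R ^+ 2) gamma.
    by have [] := inv _ _ _ (hA n).
  have h2 n : 0 ^+ 2 <= A ^+ 2 * powR (1 + n%:R ^+ 2) gamma by rewrite expr0n.
  have h3 n : (cap_multiplier n theta)^-1 * cap_multiplier n theta +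
      0 * cap_multiplier n theta = 1.
    by have [a0 _] := inv _ _ _ (hA n); rewrite mul0r addr0 mulVf.
  have := complex_estimate mu mO OS sf A0 h1 h2 h3.
  set C := cap_L2norm _ _ _; set S := sobolev_norm _ _.
  have C0 : (0 <= C)%E by exact: sqrte_ge0.
  have -> : (C + C = 2%:E * C)%E.
    by have -> : 2 = 1 + 1 :> R by []; rewrite EFinD ge0_muleDl// !mul1e.
  by rewrite muleACA -EFinM (_ : 4 * A * 2 = 8 * A)%R ?[(S * C)%E]muleC ?muleA//; ring.
apply: ae_mono (cap_multiplier_ae_lower2 (R := R)) => theta h /h[A A0 hA].
exists (4 * A); first by rewrite mulr_gt0.
move=> Omega mu f mO OS _ sf.
pose W n : R := powR (1 + n%:R ^+ 2) (3 / 2).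
pose t n := 1 <= A ^+ 2 * (W n * cap_multiplier n theta ^+ 2).
have hA2 n : ~~ t n -> 1 <= A ^+ 2 * (W n * cap_multiplier n (2 * theta) ^+ 2).
  by move=> /negP tn; case: (hA n).
apply: (@complex_estimate R _ Omega theta (2 * theta)
  (fun n => if t n then (cap_multiplier n theta)^-1 else 0)
  (fun n => if t n then 0 else (cap_multiplier n (2 * theta))^-1)) => // n.
- by case: ifP => [/inv[]//|_]; rewrite expr0n.
- by case: ifPn => [_|/hA2/inv[]//]; rewrite expr0n.
- case: ifPn => [/inv[a0 _]|/hA2/inv[a0 _]]; first by rewrite mul0r addr0 mulVf.
  by rewrite mul0r add0r mulVf.
Qed.
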